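(* Let $S$ be a polynomial ring over a field $k$, and $G$ a finite group acting on $S$ by degree-preserving $k$-algebra automorphisms. If $G$ is abelian, then $\omega_{S^G}$ is isomorphic to a graded ideal of $S^G$, and hence $b(S^G)\le 0$.
   Context: $S=k[x_1,\dots,x_n]$ is a standard-graded polynomial ring in finitely many indeterminates, and $S^G$ is the ring of invariants with the inherited grading. For a normal $\mathbb{N}$-graded ring $R$, finitely generated over a field $[R]_0$, $\omega_R$ denotes the graded canonical module of $R$, $\omega_R^{-1}=\mathrm{Hom}_R(\omega_R,R)$ is the graded anticanonical module, and $b(R)=\min\{i\in\mathbb{Z}\mid [\omega_R^{-1}]_i\neq 0\}$. ''Isomorphic'' means isomorphic as graded modules, via a degree-preserving isomorphism. *)

(* Defs.v *)
From HB Require Import structures.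
From mathcomp Require Import all_boot all_order all_fingroup all_algebra.
From mathcomp Require Import boolp.
From mathcomp Require Import mpoly.

Set Implicit Arguments.
Unset Strict Implicit.
Unset Printing Implicit Defensive.

Import Order.TTheory GRing.Theory Num.Theory.
Local Open Scope ring_scope.
Local Open Scope quotient_scope.

(** * Gradings *)

(* [V] is the internal direct sum of the subgroups [c i]. *)
Record is_grading (I : eqType) (V : zmodType) (c : I -> V -> Prop) : Prop := {
  grading0 : forall i, c i 0;
  gradingB : forall i x y, c i x -> c i y -> c i (x - y);
  grading_span : forall x, exists2 l : seq V,
    (forall y, y \in l -> exists i, c i y) & x = \sum_(y <- l) y;
  grading_direct : forall (s : seq I) (u : I -> V), uniq s ->
    (forall i, c i (u i)) -> \sum_(i <- s) u i = 0 ->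
    forall i, i \in s -> u i = 0 }.

Section GradingTheory.
Variables (I : eqType) (V : zmodType) (c : I -> V -> Prop).
Hypothesis grc : is_grading c.

Lemma gradingN i x : c i x -> c i (- x).
Proof. by move=> cx; rewrite -sub0r; apply: gradingB => //; apply: grading0. Qed.

Lemma gradingD i x y : c i x -> c i y -> c i (x + y).
Proof.
by move=> cx cy; rewrite -[y]opprK; apply: gradingB => //; apply: gradingN.
Qed.

Lemma big_supp (s t : seq I) (u : I -> V) : uniq s -> uniq t ->
    {subset s <= t} -> (forall i, i \notin s -> u i = 0) ->
  \sum_(i <- t) u i = \sum_(i <- s) u i.
Proof.
move=> us ut st u0; rewrite (bigID (mem s)) /= [X in _ + X]big1 // addr0.
rewrite -big_filter; apply: perm_big; apply: uniq_perm => //.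
  by rewrite filter_uniq.
by move=> i; rewrite mem_filter; case: (boolP (i \in s)) => // /st->.
Qed.

Lemma grading_uniq (s t : seq I) (u v : I -> V) : uniq s -> uniq t ->
    (forall i, c i (u i)) -> (forall i, c i (v i)) ->
    (forall i, i \notin s -> u i = 0) -> (forall i, i \notin t -> v i = 0) ->
  \sum_(i <- s) u i = \sum_(i <- t) v i -> forall i, u i = v i.
Proof.
move=> us ut cu cv u0 v0 e i.
have uU := undup_uniq (s ++ t).
have e0 : \sum_(j <- undup (s ++ t)) (u j - v j) = 0.
  rewrite sumrB (big_supp us uU) ?(big_supp ut uU) ?e ?subrr // => j jt;
  by rewrite mem_undup mem_cat jt ?orbT.
have [iU|] := boolP (i \in undup (s ++ t)).
  apply/eqP; rewrite -subr_eq0; apply/eqP.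
  apply: (grading_direct grc uU _ e0) iU => j; exact: gradingB.
by rewrite mem_undup mem_cat negb_or => /andP[/u0-> /v0->].
Qed.

(* Every sum of homogeneous elements satisfying an additive property [N]
   regroups as a sum over pairwise distinct degrees. *)
Lemma grading_regroup (N : V -> Prop) (l : seq V) :
    N 0 -> (forall x y, N x -> N y -> N (x + y)) ->
    (forall y, y \in l -> exists i, c i y /\ N y) ->
  exists (s : seq I) (u : I -> V), [/\ uniq s, forall i, c i (u i),
    forall i, N (u i), forall i, i \notin s -> u i = 0
    & \sum_(y <- l) y = \sum_(i <- s) u i].
Proof.
move=> N0 ND; elim: l => [|y l IH] Hl.
  exists [::], (fun=> 0); split=> //; last by rewrite !big_nil.
  by move=> i; apply: grading0.
have [|s [u [us cu Nu u0 eu]]] := IH.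
  by move=> z zl; apply: Hl; rewrite inE zl orbT.
have [i [ciy Ny]] : exists i, c i y /\ N y by apply: Hl; rewrite inE eqxx.
exists (undup (i :: s)), (fun j => (if j == i then y else 0) + u j); split.
- exact: undup_uniq.
- move=> j; apply: gradingD => //; case: eqP => [->//|_]; exact: grading0.
- by move=> j; apply: ND => //; case: eqP.
- move=> j; rewrite mem_undup inE negb_or => /andP[/negbTE-> js].
  by rewrite u0 // addr0.
have iU : i \in undup (i :: s) by rewrite mem_undup inE eqxx.
have e1 : \sum_(j <- undup (i :: s)) (if j == i then y else 0) = y.
  rewrite (bigD1_seq i) ?undup_uniq //= eqxx big1 ?addr0 // => j.
  by move=> /negbTE->.
rewrite big_cons eu big_split /= e1; congr (_ + _) => /=.
case: ifP => is_; first by rewrite undup_id.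
by rewrite big_cons u0 ?is_ // add0r undup_id.
Qed.

Lemma grading_decomp x : exists (u : I -> V), exists s : seq I,
  [/\ uniq s, forall i, c i (u i),
    forall i, i \notin s -> u i = 0 & x = \sum_(i <- s) u i].
Proof.
have [l Hl ->] := grading_span grc x.
have [//|//||s [u [us cu _ u0 e]]] := @grading_regroup (fun=> True) l.
  by move=> y /Hl[i ci]; exists i.
by exists u, s.
Qed.
End GradingTheory.

(** * Graded domains and graded modules *)

(* An N-graded domain R with [R]_0 = k; every normal N-graded ring over the
   field [R]_0 is one. *)
Record gdomain (k : fieldType) := GDomain {
  gdom_sort :> idomainType;
  gdom_scal : {rmorphism k -> gdom_sort};
  gdom_comp : nat -> gdom_sort -> Prop;
  gdom_grading : is_grading gdom_comp;
  gdom_compM : forall i j x y,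
    gdom_comp i x -> gdom_comp j y -> gdom_comp (i + j) (x * y);
  gdom_comp0 : forall x, gdom_comp 0 x <-> exists a, x = gdom_scal a }.

Record gmodule (k : fieldType) (R : gdomain k) := GModule {
  gmod_sort :> lmodType R;
  gmod_comp : int -> gmod_sort -> Prop;
  gmod_grading : is_grading gmod_comp;
  gmod_compZ : forall i j r x,
    gdom_comp i r -> gmod_comp j x -> gmod_comp (i%:Z + j) (r *: x) }.

Arguments gmod_comp {k R} M i x : rename.

Definition giso (k : fieldType) (R : gdomain k) (M N : gmodule R) : Prop :=
  exists2 phi : {linear M -> N}, bijective phi &
    forall i x, gmod_comp M i x <-> gmod_comp N i (phi x).

(* [gmod_hom_comp i phi] : phi is in [Hom_R(M, N)]_i. *)
Definition gmod_hom_comp (k : fieldType) (R : gdomain k) (M N : gmodule R)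
    (i : int) (phi : {linear M -> N}) : Prop :=
  forall j x, gmod_comp M j x -> gmod_comp N (j + i) (phi x).

Section Regular.
Variables (k : fieldType) (R : gdomain k).

Definition gdom_zcomp (j : int) (x : R) : Prop :=
  match j with Posz i => gdom_comp i x | Negz _ => x = 0 end.

Lemma gdom_zgrading : is_grading gdom_zcomp.
Proof.
have grR := gdom_grading R; split.
- by move=> [i|i] //=; apply: grading0.
- by move=> [i|i] x y /=; [apply: gradingB | move=> -> ->; rewrite subr0].
- move=> x; have [l Hl e] := grading_span grR x; exists l => // y /Hl[i ci].
  by exists (Posz i).
move=> s u us cu su0.
pose s' := pmap (fun j : int => if j is Posz i then Some i else None) s.
have us' : uniq s'.
  apply: (@pmap_uniq _ _ (fun j : int => if j is Posz i then Some i else None) Posz) => //.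
  by case.
have ms' i : (i \in s') = (Posz i \in s).
  rewrite mem_pmap; apply/mapP/idP => [[[j|j] js //[->]]//|is_].
  by exists (Posz i).
have Ns j : u (Negz j) = 0 by exact: (cu (Negz j)).
have e : \sum_(i <- s') u (Posz i) = 0.
  rewrite -[RHS]su0 /s'; elim: (s) => [|[j|j] t IH] /=; rewrite ?big_nil //.
    by rewrite !big_cons IH.
  by rewrite big_cons Ns add0r.
case=> [i|i] // is_; apply: (grading_direct grR us' _ e); last by rewrite ms'.
by move=> j; exact: (cu (Posz j)).
Qed.

Lemma gdom_zcompM i j x y :
  gdom_comp i x -> gdom_zcomp j y -> gdom_zcomp (i%:Z + j) (x * y).
Proof.
case: j => [j|j] cx /=; first exact: gdom_compM.
move=> ->; rewrite mulr0; exact: (grading0 gdom_zgrading).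
Qed.

Definition gregular : gmodule R :=
  @GModule k R R^o gdom_zcomp gdom_zgrading gdom_zcompM.
End Regular.

(** * Graded submodules and quotients *)

Record gsubmodule (k : fieldType) (R : gdomain k) (M : gmodule R) :=
  GSubmodule {
    gsub_set :> M -> Prop;
    gsub0 : gsub_set 0;
    gsub_linear : forall r x y,
      gsub_set x -> gsub_set y -> gsub_set (r *: x + y);
    gsub_span : forall x, gsub_set x -> exists2 l : seq M,
      (forall y, y \in l -> exists i, gmod_comp M i y /\ gsub_set y) &
      x = \sum_(y <- l) y }.

Definition gideal (k : fieldType) (R : gdomain k) := gsubmodule (gregular R).

Section SubQuotient.
Variables (k : fieldType) (R : gdomain k) (M : gmodule R) (N : gsubmodule M).

Definition gsub_pred : {pred M} := fun x => `[< N x >].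

Lemma gsub_predP x : reflect (N x) (x \in gsub_pred).
Proof. exact: asboolP. Qed.

Lemma gsub_pred_submod : submod_closed gsub_pred.
Proof.
split=> [|r x y /gsub_predP Nx /gsub_predP Ny]; apply/gsub_predP.
  exact: gsub0.
exact: gsub_linear.
Qed.

HB.instance Definition _ :=
  GRing.isSubmodClosed.Build R M gsub_pred gsub_pred_submod.

Lemma gsubD x y : N x -> N y -> N (x + y).
Proof. by move=> Nx Ny; rewrite -[x]scale1r; apply: gsub_linear. Qed.

Lemma gsub_homog (s : seq int) (u : int -> M) : uniq s ->
    (forall i, gmod_comp M i (u i)) -> N (\sum_(i <- s) u i) ->
  forall i, i \in s -> N (u i).
Proof.
have grM := gmod_grading M.
move=> us cu /gsub_span[l Hl e].
have [t [v [ut cv Nv v0 ev]]] := grading_regroup grM (gsub0 N) gsubD Hl.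
move=> i is_; pose u' j := if j \in s then u j else 0.
suff e' : u' i = v i by rewrite -[u i]/(if true then u i else 0) -is_ -/(u' i) e'.
apply: (grading_uniq grM us ut) => //.
- by move=> j; rewrite /u'; case: ifP => // _; apply: grading0.
- by move=> j /negbTE; rewrite /u' => ->.
by rewrite -ev -e; apply: eq_big_seq => j; rewrite /u' => ->.
Qed.

Definition gsub_type := {x : M | x \in gsub_pred}.
HB.instance Definition _ := SubChoice.on gsub_type.
HB.instance Definition _ := [SubChoice_isSubLmodule of gsub_type by <:].

Definition gsub_comp (i : int) (x : gsub_type) := gmod_comp M i (val x).

Lemma gsub_grading : is_grading gsub_comp.
Proof.
have grM := gmod_grading M; split.
- by move=> i; rewrite /gsub_comp raddf0; apply: grading0.
- by move=> i x y cx cy; rewrite /gsub_comp raddfB; apply: gradingB.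
- move=> x; have [l Hl e] := gsub_span (elimT (gsub_predP _) (valP x)).
  have Nl y : y \in l -> y \in gsub_pred.
    by move=> /Hl[i [_ Ny]]; apply/gsub_predP.
  exists (pmap (insub : M -> option gsub_type) l).
    move=> y; rewrite mem_pmap => /mapP[z /[dup] /Hl[i [cz _]] zl].
    rewrite insubT ?Nl // => H [->]; by exists i.
  apply: val_inj; rewrite e raddf_sum /=.
  elim: l Nl {e Hl} => [|y l IH] Nl; first by rewrite !big_nil.
  have Ny : y \in gsub_pred by rewrite Nl ?inE ?eqxx.
  rewrite /= insubT /= !big_cons IH // => z zl.
  by rewrite Nl // inE zl orbT.
move=> s u us cu su0 i is_; apply: val_inj; rewrite raddf0.
apply: (grading_direct grM us (u := val \o u)) is_ => //=.
have -> : \sum_(j <- s) val (u j) = val (\sum_(j <- s) u j) by rewrite raddf_sum.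
by rewrite su0 raddf0.
Qed.

Lemma gsub_compZ i j r x :
  gdom_comp i r -> gsub_comp j x -> gsub_comp (i%:Z + j) (r *: x).
Proof. by move=> cr cx; rewrite /gsub_comp linearZ /=; apply: gmod_compZ. Qed.

Definition gsub_gmodule : gmodule R := GModule gsub_grading gsub_compZ.

Definition gquot_type := Quotient.quot gsub_pred.
HB.instance Definition _ := GRing.Zmodule.on gquot_type.
HB.instance Definition _ := EqQuotient.on gquot_type.

Definition gquot_pi (x : M) : gquot_type := \pi_(Quotient.quot gsub_pred) x.

Lemma gquot_pi_eq x y : reflect (gquot_pi x = gquot_pi y) (x - y \in gsub_pred).
Proof. by rewrite Quotient.idealrBE; apply: eqP. Qed.

Lemma gquot_piB x y : gquot_pi (x - y) = gquot_pi x - gquot_pi y.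
Proof. exact: (raddfB (\pi_(Quotient.quot gsub_pred))). Qed.

Lemma gquot_piD x y : gquot_pi (x + y) = gquot_pi x + gquot_pi y.
Proof. exact: (raddfD (\pi_(Quotient.quot gsub_pred))). Qed.

Lemma gquot_pi0 : gquot_pi 0 = 0.
Proof. exact: (raddf0 (\pi_(Quotient.quot gsub_pred))). Qed.

Lemma gquot_pi_sum (I : Type) (s : seq I) (u : I -> M) :
  gquot_pi (\sum_(i <- s) u i) = \sum_(i <- s) gquot_pi (u i).
Proof. exact: (big_morph _ gquot_piD gquot_pi0). Qed.

Lemma gquot_pi_surj (q : gquot_type) : exists x, q = gquot_pi x.
Proof. by exists (generic_quotient.repr q); rewrite /gquot_pi reprK. Qed.

Definition gquot_scale (r : R) (q : gquot_type) : gquot_type :=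
  gquot_pi (r *: (generic_quotient.repr q : M)).

Lemma gquot_scaleE r x : gquot_scale r (gquot_pi x) = gquot_pi (r *: x).
Proof.
apply/gquot_pi_eq; rewrite -scalerBr; apply: rpredZ.
by apply/gquot_pi_eq; rewrite /gquot_pi reprK.
Qed.

Lemma gquot_scaleA r r' q :
  gquot_scale r (gquot_scale r' q) = gquot_scale (r * r') q.
Proof. by have [x ->] := gquot_pi_surj q; rewrite !gquot_scaleE scalerA. Qed.

Lemma gquot_scale1 : left_id 1 gquot_scale.
Proof.
by move=> q; have [x ->] := gquot_pi_surj q; rewrite gquot_scaleE scale1r.
Qed.

Lemma gquot_scaleDr : right_distributive gquot_scale +%R.
Proof.
move=> r p q; have [x ->] := gquot_pi_surj p; have [y ->] := gquot_pi_surj q.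
by rewrite -gquot_piD !gquot_scaleE scalerDr gquot_piD.
Qed.

Lemma gquot_scaleDl q : {morph gquot_scale^~ q : r s / r + s}.
Proof.
move=> r s; have [x ->] := gquot_pi_surj q.
by rewrite !gquot_scaleE scalerDl gquot_piD.
Qed.

HB.instance Definition _ := GRing.Zmodule_isLmodule.Build R gquot_type
  gquot_scaleA gquot_scale1 gquot_scaleDr gquot_scaleDl.

Definition gquot_comp (i : int) (q : gquot_type) :=
  exists2 x, gmod_comp M i x & q = gquot_pi x.

Lemma gquot_grading : is_grading gquot_comp.
Proof.
have grM := gmod_grading M; split.
- by move=> i; exists 0; [apply: grading0 | rewrite gquot_pi0].
- move=> i _ _ [x cx ->] [y cy ->]; exists (x - y); first exact: gradingB.
  by rewrite gquot_piB.
- move=> q; have [x ->] := gquot_pi_surj q.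
  have [l Hl ->] := grading_span grM x.
  exists (map gquot_pi l); last by rewrite big_map gquot_pi_sum.
  by move=> _ /mapP[y /Hl[i cy] ->]; exists i, y.
move=> s u us cu su0 i is_.
have /choice[v Hv] j : exists x, gmod_comp M j x /\ u j = gquot_pi x.
  by have [x] := cu j; exists x.
have [_ ->] := Hv i; rewrite -gquot_pi0; apply/gquot_pi_eq; rewrite subr0.
apply/gsub_predP; apply: gsub_homog is_ => //; first by move=> j; case: (Hv j).
apply/gsub_predP; rewrite -[X in X \in _]subr0; apply/gquot_pi_eq.
rewrite gquot_pi0 -[RHS]su0 gquot_pi_sum; apply: eq_bigr => j _.
by have [_ ->] := Hv j.
Qed.

Lemma gquot_compZ i j r q :
  gdom_comp i r -> gquot_comp j q -> gquot_comp (i%:Z + j) (r *: q).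
Proof.
move=> cr [x cx ->]; exists (r *: x); first exact: gmod_compZ.
exact: gquot_scaleE.
Qed.

Definition gquot_gmodule : gmodule R := GModule gquot_grading gquot_compZ.
End SubQuotient.

(** * Graded dual *)

Section GradedDual.
Variables (k : fieldType) (R : gdomain k) (M : gmodule R).

Definition klinear (phi : M -> k) : Prop :=
  (forall x y, phi (x + y) = phi x + phi y) /\
  (forall a x, phi (gdom_scal R a *: x) = a * phi x).

Definition finite_degrees (phi : M -> k) : Prop := exists s : seq int,
  forall i x, i \notin s -> gmod_comp M i x -> phi x = 0.

(* The direct sum of the Hom_k([M]_i, k), as a submodule of Hom_k(M, k). *)
Record gdual_type := GDual {
  gdual_fun :> M -> k;
  gdual_klinear : klinear gdual_fun;
  gdual_finite : finite_degrees gdual_fun }.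

HB.instance Definition _ := gen_eqMixin gdual_type.
HB.instance Definition _ := gen_choiceMixin gdual_type.

Implicit Types phi psi : gdual_type.

Lemma gdual_eqP phi psi : (forall x, phi x = psi x) -> phi = psi.
Proof.
case: phi psi => [f f1 f2] [g g1 g2] /= /funext e.
by case: _ / e in g1 g2 *; congr GDual; apply: Prop_irrelevance.
Qed.

Lemma gdual0_klinear : klinear (fun=> 0).
Proof. by split=> [x y|a x]; rewrite ?addr0 ?mulr0. Qed.
Lemma gdual0_finite : finite_degrees (fun=> 0).
Proof. by exists [::]. Qed.
Definition gdual0 := GDual gdual0_klinear gdual0_finite.

Lemma gdualD_klinear phi psi : klinear (fun x => phi x + psi x).
Proof.
have [f1 f2] := gdual_klinear phi; have [g1 g2] := gdual_klinear psi.
by split=> [x y|a x]; rewrite ?f1 ?g1 ?f2 ?g2 ?mulrDr // addrACA.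
Qed.
Lemma gdualD_finite phi psi : finite_degrees (fun x => phi x + psi x).
Proof.
have [s Hs] := gdual_finite phi; have [t Ht] := gdual_finite psi.
exists (s ++ t) => i x; rewrite mem_cat negb_or => /andP[is_ it] cx.
by rewrite (Hs i) ?(Ht i) ?addr0.
Qed.
Definition gdualD phi psi := GDual (gdualD_klinear phi psi) (gdualD_finite phi psi).

Lemma gdualN_klinear phi : klinear (fun x => - phi x).
Proof.
have [f1 f2] := gdual_klinear phi.
by split=> [x y|a x]; rewrite ?f1 ?f2 ?opprD ?mulrN.
Qed.
Lemma gdualN_finite phi : finite_degrees (fun x => - phi x).
Proof.
have [s Hs] := gdual_finite phi; exists s => i x is_ cx.
by rewrite (Hs i) ?oppr0.
Qed.
Definition gdualN phi := GDual (gdualN_klinear phi) (gdualN_finite phi).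

Lemma gdualA : associative gdualD.
Proof. by move=> *; apply: gdual_eqP => x /=; rewrite addrA. Qed.
Lemma gdualC : commutative gdualD.
Proof. by move=> *; apply: gdual_eqP => x /=; rewrite addrC. Qed.
Lemma gdual0D : left_id gdual0 gdualD.
Proof. by move=> *; apply: gdual_eqP => x /=; rewrite add0r. Qed.
Lemma gdualND : left_inverse gdual0 gdualN gdualD.
Proof. by move=> *; apply: gdual_eqP => x /=; rewrite addNr. Qed.

HB.instance Definition _ :=
  GRing.isZmodule.Build gdual_type gdualA gdualC gdual0D gdualND.

Lemma klinear0 (f : M -> k) : klinear f -> f 0 = 0.
Proof. by case=> _ fZ; rewrite -(scaler0 _ (gdom_scal R 0)) fZ mul0r. Qed.

Lemma klinear_sum (f : M -> k) (I : Type) (s : seq I) (u : I -> M) :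
  klinear f -> f (\sum_(i <- s) u i) = \sum_(i <- s) f (u i).
Proof. by move=> fl; apply: (big_morph f fl.1 (klinear0 fl)). Qed.

Lemma gdualZ_klinear (r : R) phi : klinear (fun x => phi (r *: x)).
Proof.
have [f1 f2] := gdual_klinear phi; split=> [x y|a x].
  by rewrite scalerDr f1.
by rewrite scalerA mulrC -scalerA f2.
Qed.
Lemma gdualZ_finite (r : R) phi : finite_degrees (fun x => phi (r *: x)).
Proof.
have [f1 f2] := gdual_klinear phi; have [s Hs] := gdual_finite phi.
have [l Hl ->] := grading_span (gdom_grading R) r.
elim: l Hl => [|y l IH] Hl.
  by exists [::] => i x _ _; rewrite big_nil scale0r (klinear0 (conj f1 f2)).
have [|t Ht] := IH; first by move=> z zl; apply: Hl; rewrite inE zl orbT.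
have [j cy] : exists j, gdom_comp j y by apply: Hl; rewrite inE eqxx.
exists ([seq i - j%:Z | i <- s] ++ t) => i x.
rewrite mem_cat negb_or => /andP[is_ it] cx.
rewrite big_cons scalerDl f1 (Ht i) // addr0.
apply: (Hs (j%:Z + i)); last exact: gmod_compZ.
by apply: contra is_ => ji; apply/mapP; exists (j%:Z + i) => //; rewrite addrC addKr.
Qed.
Definition gdualZ (r : R) phi : gdual_type :=
  GDual (gdualZ_klinear r phi) (gdualZ_finite r phi).

Lemma gdualZA r s phi : gdualZ r (gdualZ s phi) = gdualZ (r * s) phi.
Proof. by apply: gdual_eqP => x /=; rewrite scalerA mulrC. Qed.
Lemma gdualZ1 : left_id 1 gdualZ.
Proof. by move=> phi; apply: gdual_eqP => x /=; rewrite scale1r. Qed.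
Lemma gdualZDr : right_distributive gdualZ +%R.
Proof. by move=> r phi psi; apply: gdual_eqP. Qed.
Lemma gdualZDl phi : {morph gdualZ^~ phi : r s / r + s}.
Proof.
move=> r s; apply: gdual_eqP => x /=.
by rewrite scalerDl (gdual_klinear phi).1.
Qed.

HB.instance Definition _ := GRing.Zmodule_isLmodule.Build R gdual_type
  gdualZA gdualZ1 gdualZDr gdualZDl.

(* [M^*]_i = Hom_k([M]_(-i), k). *)
Definition gdual_comp (i : int) (phi : gdual_type) : Prop :=
  forall j x, j != - i -> gmod_comp M j x -> phi x = 0.

Lemma gdual_sumE (I : Type) (s : seq I) (u : I -> gdual_type) x :
  (\sum_(i <- s) u i : gdual_type) x = \sum_(i <- s) u i x.
Proof. exact: (big_morph (fun phi : gdual_type => phi x)). Qed.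

Lemma gdual_grading : is_grading gdual_comp.
Proof.
have grM := gmod_grading M; split.
- by [].
- move=> i phi psi cphi cpsi j x ji cx.
  by rewrite -[LHS]/(phi x - psi x) (cphi j) ?(cpsi j) ?subrr.
- move=> phi; have [phiD phiZ] := gdual_klinear phi.
  have [w Hw] := choice (grading_decomp grM).
  have compP x s u : uniq s -> (forall i, gmod_comp M i (u i)) ->
      (forall i, i \notin s -> u i = 0) -> x = \sum_(i <- s) u i ->
      forall i, w x i = u i.
    move=> us cu u0 e; have [t [ut cw w0 ew]] := Hw x.
    by apply: (grading_uniq grM ut us); rewrite -?e -?ew.
  have wc x i : gmod_comp M i (w x i) by have [t []] := Hw x.
  have wD x y i : w (x + y) i = w x i + w y i.
    have [s [us _ s0 es]] := Hw x; have [t [ut _ t0 et]] := Hw y.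
    have uU := undup_uniq (s ++ t).
    apply: (compP _ _ (fun j => w x j + w y j) uU) => [j|j|]; first exact: gradingD.
      by rewrite mem_undup mem_cat negb_or => /andP[js jt]; rewrite s0 ?t0 ?addr0.
    have sU : {subset s <= undup (s ++ t)}.
      by move=> j js; rewrite mem_undup mem_cat js.
    have tU : {subset t <= undup (s ++ t)}.
      by move=> j jt; rewrite mem_undup mem_cat jt orbT.
    rewrite big_split /= (big_supp us uU sU s0) (big_supp ut uU tU t0).
    by congr (_ + _).
  have wZ a x i : w (gdom_scal R a *: x) i = gdom_scal R a *: w x i.
    have [s [us _ s0 es]] := Hw x.
    apply: (compP _ _ (fun j => gdom_scal R a *: w x j) us) => [j|j js|].
    - rewrite -[in X in gmod_comp _ X _](add0r j).
      apply: (@gmod_compZ _ _ M 0%N) => //.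
      by apply/gdom_comp0; exists a.
    - by rewrite s0 ?scaler0.
    by rewrite -scaler_sumr; congr (_ *: _).
  have wE i j x : gmod_comp M j x -> w x i = if i == j then x else 0.
    move=> cx; apply: (compP x [:: j] (fun i => if i == j then x else 0)) => //.
    - by move=> l; case: eqP => [->//|_]; exact: grading0.
    - by move=> l; rewrite inE => /negbTE->.
    by rewrite big_seq1 eqxx.
  have [s0 Hs0] := gdual_finite phi; pose s := undup s0.
  have us : uniq s by exact: undup_uniq.
  have Hs i x : i \notin s -> gmod_comp M i x -> phi x = 0.
    by rewrite mem_undup; apply: Hs0.
  have pl i : klinear (fun x => phi (w x i)).
    by split=> [x y|a x]; rewrite ?wD ?wZ.
  have pf i : finite_degrees (fun x => phi (w x i)).
    exists [:: i] => j x; rewrite inE => ji cx.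
    by rewrite (wE i j) // eq_sym (negbTE ji) (klinear0 (gdual_klinear phi)).
  exists [seq GDual (pl i) (pf i) | i <- s].
    move=> _ /mapP[i _ ->]; exists (- i) => j x; rewrite opprK => ji cx /=.
    by rewrite (wE i j) // eq_sym (negbTE ji) (klinear0 (gdual_klinear phi)).
  apply: gdual_eqP => x; rewrite big_map gdual_sumE /=.
  have [t [ut _ t0 et]] := Hw x.
  rewrite {1}et (klinear_sum _ _ (gdual_klinear phi)).
  have uU := undup_uniq (s ++ t).
  have p0 := klinear0 (gdual_klinear phi).
  have sU : {subset s <= undup (s ++ t)}.
    by move=> j js; rewrite mem_undup mem_cat js.
  have tU : {subset t <= undup (s ++ t)}.
    by move=> j jt; rewrite mem_undup mem_cat jt orbT.
  have vt i : i \notin t -> phi (w x i) = 0 by move=> /t0->.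
  have vs i : i \notin s -> phi (w x i) = 0 by move=> /Hs; apply.
  by rewrite -(big_supp ut uU tU vt) (big_supp us uU sU vs).
move=> s u us cu su0 i is_; apply: gdual_eqP => x.
have [l Hl ->] := grading_span grM x.
rewrite (klinear_sum _ _ (gdual_klinear _)) big1_seq // => y /andP[_ /Hl[j cy]].
have [ji|ji] := eqVneq j (- i); last exact: (cu i j).
have := congr1 (fun phi : gdual_type => phi y) su0.
rewrite gdual_sumE (bigD1_seq i) //= big1 ?addr0 // => i' i'i.
by apply: (cu i' j) => //; rewrite ji eqr_opp eq_sym.
Qed.

Lemma gdual_compZ i j r phi :
  gdom_comp i r -> gdual_comp j phi -> gdual_comp (i%:Z + j) (r *: phi).
Proof.
move=> cr cphi l x lij cx; apply: (cphi (i%:Z + l)); last exact: gmod_compZ.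
apply: contra lij => /eqP e; apply/eqP.
by rewrite opprD -e addKr.
Qed.

Definition gdual_gmodule : gmodule R := GModule gdual_grading gdual_compZ.
End GradedDual.

(** * Localizations of a graded domain *)

Section FractionModule.
Variables (k : fieldType) (R : gdomain k).

Definition fracmod : Type := {fraction R}.
HB.instance Definition _ := GRing.Field.on fracmod.

Definition fracmod_scale (r : R) (x : fracmod) : fracmod := tofrac r * x.

Lemma fracmod_scaleA r s x :
  fracmod_scale r (fracmod_scale s x) = fracmod_scale (r * s) x.
Proof. by rewrite /fracmod_scale rmorphM mulrA. Qed.
Lemma fracmod_scale1 : left_id 1 fracmod_scale.
Proof. by move=> x; rewrite /fracmod_scale rmorph1 mul1r. Qed.
Lemma fracmod_scaleDr : right_distributive fracmod_scale +%R.
Proof. by move=> r x y; rewrite /fracmod_scale mulrDr. Qed.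
Lemma fracmod_scaleDl x : {morph fracmod_scale^~ x : r s / r + s}.
Proof. by move=> r s; rewrite /fracmod_scale rmorphD mulrDl. Qed.

HB.instance Definition _ := GRing.Zmodule_isLmodule.Build R fracmod
  fracmod_scaleA fracmod_scale1 fracmod_scaleDr fracmod_scaleDl.

Definition frac_div (a g : R) (t : nat) : fracmod :=
  (tofrac a : fracmod) / (tofrac g : fracmod) ^+ t.

(* The localization R_g, inside the fraction field. *)
Definition in_loc (g : R) (x : fracmod) : Prop :=
  exists a t, x = frac_div a g t.

Lemma frac_divD a b g t : frac_div (a + b) g t = frac_div a g t + frac_div b g t.
Proof. by rewrite /frac_div rmorphD mulrDl. Qed.
Lemma frac_divB a b g t : frac_div (a - b) g t = frac_div a g t - frac_div b g t.
Proof. by rewrite /frac_div rmorphB mulrBl. Qed.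
Lemma frac_div0 g t : frac_div 0 g t = 0.
Proof. by rewrite /frac_div rmorph0 mul0r. Qed.
Lemma frac_divZ r a g t : r *: frac_div a g t = frac_div (r * a) g t.
Proof.
by rewrite /frac_div -[LHS]/(tofrac r * _) mulrA -rmorphM.
Qed.
Lemma frac_div_sum (I : Type) (s : seq I) (u : I -> R) g t :
  frac_div (\sum_(i <- s) u i) g t = \sum_(i <- s) frac_div (u i) g t.
Proof.
exact: (big_morph (fun a => frac_div a g t)
  (fun a b => frac_divD a b g t) (frac_div0 g t)).
Qed.
Lemma tofrac_neq0 (g : R) : g != 0 -> (tofrac g : fracmod) != 0.
Proof. by move=> g0; rewrite tofrac_eq0. Qed.
Lemma frac_div_expand a g h t : h != 0 ->
  frac_div a g t = frac_div (a * h ^+ t) (g * h) t.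
Proof.
move=> h0; rewrite /frac_div !rmorphM rmorphXn exprMn invfM.
by rewrite mulrACA mulfV ?mulr1 // expf_neq0 // tofrac_neq0.
Qed.
Lemma frac_div_raise a g t u : g != 0 ->
  frac_div a g t = frac_div (a * g ^+ u) g (t + u).
Proof.
move=> g0; rewrite /frac_div !rmorphM rmorphXn exprD invfM.
by rewrite mulrACA mulfV ?mulr1 // expf_neq0 // tofrac_neq0.
Qed.
Lemma frac_div_inj a b g t : g != 0 -> frac_div a g t = frac_div b g t -> a = b.
Proof.
move=> g0 /(mulIf _) e; apply/eqP; rewrite -tofrac_eq; apply/eqP; apply: e.
by rewrite invr_eq0 expf_neq0 // tofrac_neq0.
Qed.
End FractionModule.

Arguments frac_div {k} R a g t.

Record helt (k : fieldType) (R : gdomain k) := HElt {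
  helt_val : R;
  helt_deg : nat;
  helt_neq0 : helt_val != 0;
  helt_homog : gdom_comp helt_deg helt_val }.

Section Localization.
Variables (k : fieldType) (R : gdomain k) (h : helt R).
Local Notation g := (helt_val h).

Definition loc_pred : {pred fracmod R} := fun x => `[< in_loc g x >].

Lemma loc_predP x : reflect (in_loc g x) (x \in loc_pred).
Proof. exact: asboolP. Qed.

Lemma loc_pred_submod : submod_closed loc_pred.
Proof.
have g0 := helt_neq0 h.
split=> [|r _ _ /loc_predP[a [t ->]] /loc_predP[b [u ->]]]; apply/loc_predP.
  by exists 0, 0%N; rewrite frac_div0.
exists (r * (a * g ^+ u) + b * g ^+ t), (t + u)%N.
rewrite frac_divD -frac_divZ -frac_div_raise //; congr (_ + _).
by rewrite addnC -frac_div_raise.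
Qed.

HB.instance Definition _ :=
  GRing.isSubmodClosed.Build R (fracmod R) loc_pred loc_pred_submod.

Definition loc_type := {x : fracmod R | x \in loc_pred}.
HB.instance Definition _ := SubChoice.on loc_type.
HB.instance Definition _ := [SubChoice_isSubLmodule of loc_type by <:].

(* a / g^t with a homogeneous has degree deg a - t deg g. *)
Definition frac_comp (j : int) (x : fracmod R) : Prop := exists a t,
  gdom_zcomp (j + (t * helt_deg h)%N%:Z) a /\ x = frac_div R a g t.

Definition loc_comp (j : int) (x : loc_type) : Prop := frac_comp j (val x).

Lemma gdom_compX i (x : R) t : gdom_comp i x -> gdom_comp (t * i) (x ^+ t).
Proof.
move=> cx; elim: t => [|t IH]; last by rewrite exprS mulSn; apply: gdom_compM.
by apply/gdom_comp0; exists 1; rewrite rmorph1.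
Qed.

Lemma frac_comp_raise j (a : R) t u :
    gdom_zcomp (j + (t * helt_deg h)%N%:Z) a ->
  gdom_zcomp (j + ((t + u) * helt_deg h)%N%:Z) (a * g ^+ u).
Proof.
move=> ca; rewrite mulrC mulnDl PoszD addrA addrC; apply: gdom_zcompM ca.
exact/gdom_compX/(helt_homog h).
Qed.

Lemma frac_comp_in_loc j x : frac_comp j x -> x \in loc_pred.
Proof. by case=> a [t [_ ->]]; apply/loc_predP; exists a, t. Qed.

Lemma loc_span x : in_loc g x -> exists2 l : seq (fracmod R),
  (forall y, y \in l -> exists j, frac_comp j y) & x = \sum_(y <- l) y.
Proof.
case=> a [t ->]; have [l Hl ->] := grading_span (gdom_zgrading R) a.
exists [seq frac_div R y g t | y <- l]; last by rewrite big_map frac_div_sum.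
move=> _ /mapP[y /Hl[i cy] ->].
by exists (i - (t * helt_deg h)%N%:Z), y, t; rewrite subrK.
Qed.

Lemma loc_lift (N : fracmod R -> Prop) (l : seq (fracmod R)) :
    (forall y, y \in l -> (exists j, frac_comp j y) /\ N y) ->
  exists2 l' : seq loc_type,
    (forall y, y \in l' -> exists j, loc_comp j y /\ N (val y)) &
    \sum_(y <- l) y = \sum_(y <- l') val y.
Proof.
elim: l => [|y l IH] Hl; first by exists [::]; rewrite ?big_nil.
have [|l' Hl' e] := IH; first by move=> z zl; apply: Hl; rewrite inE zl orbT.
have [[j cy] Ny] := Hl y (mem_head _ _).
exists ((Sub y (frac_comp_in_loc cy) : loc_type) :: l').
  move=> z; rewrite inE => /predU1P[->|]; last exact: Hl'.
  by exists j; rewrite /loc_comp SubK.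
by rewrite !big_cons e SubK.
Qed.

Lemma loc_grading : is_grading loc_comp.
Proof.
have grR := gdom_zgrading R; have g0 := helt_neq0 h; split.
- move=> i; exists 0, 0%N; rewrite frac_div0 raddf0; split=> //.
  exact: grading0.
- move=> i x y [a [t [ca ex]]] [b [u [cb ey]]].
  exists (a * g ^+ u - b * g ^+ t), (t + u)%N; split.
    apply: gradingB => //; first exact: frac_comp_raise.
    by rewrite addnC; apply: frac_comp_raise.
  rewrite raddfB /= ex ey frac_divB -frac_div_raise //; congr (_ - _).
  by rewrite addnC -frac_div_raise.
- move=> x; have [l Hl e] := loc_span (elimT (loc_predP _) (valP x)).
  have [|l' Hl' e'] := @loc_lift (fun=> True) l.
    by move=> y /Hl.
  exists l'; first by move=> y /Hl'[j [cy _]]; exists j.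
  by apply: val_inj; rewrite e e' raddf_sum.
move=> s u us cu su0.
have [a Ha] := choice cu; have [t Ht] := choice Ha.
pose T := (\sum_(j <- s) t j)%N; pose e := (T * helt_deg h)%N%:Z.
have tT j : j \in s -> (t j <= T)%N.
  by move=> js; rewrite /T (bigD1_seq j) //= leq_addr.
pose b i := if i - e \in s then a (i - e) * g ^+ (T - t (i - e)) else 0.
have cb i : gdom_zcomp i (b i).
  rewrite /b; case: ifP => [is_|_]; last exact: grading0.
  have [ca _] := Ht (i - e).
  have := frac_comp_raise (T - t (i - e)) ca.
  by rewrite subnKC ?tT // -/e subrK.
have ub j : j \in s -> val (u j) = frac_div R (b (j + e)) g T.
  move=> js; have [_ ->] := Ht j.
  by rewrite /b addrK js (frac_div_raise _ _ (T - t j)) // subnKC ?tT.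
have us' : uniq [seq j + e | j <- s] by rewrite map_inj_uniq //; exact: addIr.
have b0 : \sum_(i <- [seq j + e | j <- s]) b i = 0.
  apply: (@frac_div_inj k R _ _ g T) => //.
  rewrite frac_div0 frac_div_sum big_map.
  transitivity (val (\sum_(j <- s) u j)); last by rewrite su0 raddf0.
  by rewrite raddf_sum; apply: eq_big_seq => j js /=; rewrite ub.
move=> j js; apply: val_inj; rewrite ub // raddf0.
by rewrite (grading_direct grR us' cb b0) ?frac_div0 // (map_f (fun i => i + e)).
Qed.

Lemma loc_compZ i j r x :
  gdom_comp i r -> loc_comp j x -> loc_comp (i%:Z + j) (r *: x).
Proof.
move=> cr [a [t [ca ex]]]; exists (r * a), t; split.
  by rewrite -addrA; apply: gdom_zcompM.
by rewrite linearZ /= ex frac_divZ.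
Qed.

Definition loc_gmodule : gmodule R := GModule loc_grading loc_compZ.
End Localization.

(** * The graded canonical module *)

(* A homogeneous system of parameters of R: homogeneous elements of positive
   degree, algebraically independent over k, over which R is module-finite.
   In particular [hsop_dim] is the dimension of R. *)
Record hsop (k : fieldType) (R : gdomain k) := HSop {
  hsop_dim : nat;
  hsop_elt : 'I_hsop_dim -> R;
  hsop_deg : 'I_hsop_dim -> nat;
  hsop_deg_gt0 : forall i, (0 < hsop_deg i)%N;
  hsop_homog : forall i, gdom_comp (hsop_deg i) (hsop_elt i);
  hsop_indep : forall P : {mpoly k[hsop_dim]},
    mmap (gdom_scal R) hsop_elt P = 0 -> P = 0;
  hsop_finite : exists (m : nat) (b : 'I_m -> R), forall r : R,
    exists c : 'I_m -> {mpoly k[hsop_dim]},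
      r = \sum_(j < m) mmap (gdom_scal R) hsop_elt (c j) * b j }.

Section CanonicalModule.
Variables (k : fieldType) (R : gdomain k) (f : hsop R).
Local Notation d := (hsop_dim f).
Local Notation x := (@hsop_elt _ _ f).

Lemma hsop_neq0 i : x i != 0.
Proof.
apply/eqP => xi0; have := @hsop_indep _ _ f 'X_i.
rewrite mmapX mmap1U xi0 => /(_ erefl) /(congr1 (mcoeff U_(i)%MM)).
by rewrite mcoeffX eqxx mcoeff0 => /eqP; rewrite oner_eq0.
Qed.

Lemma hsop_prod_neq0 (P : pred 'I_d) : \prod_(i | P i) x i != 0.
Proof. by apply/prodf_neq0 => i _; apply: hsop_neq0. Qed.

Lemma hsop_prod_homog (P : pred 'I_d) :
  gdom_comp (\sum_(i | P i) hsop_deg i)%N (\prod_(i | P i) x i).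
Proof.
apply: (big_rec2 (fun n y => gdom_comp n y)).
  by apply/gdom_comp0; exists 1; rewrite rmorph1.
by move=> i n y _ cy; apply: gdom_compM cy; apply: hsop_homog.
Qed.

Definition hsop_prod (P : pred 'I_d) : helt R :=
  HElt (hsop_prod_neq0 P) (hsop_prod_homog P).

(* R_(x_1 ... x_d) and R_(x_1 ... x_d omitting x_i): the last two terms of the
   Cech complex of x_1, ..., x_d. *)
Definition cech_top : gmodule R := loc_gmodule (hsop_prod predT).
Definition cech_face (i : 'I_d) : helt R := hsop_prod (predC1 i).

Definition cech_boundary (y : cech_top) : Prop :=
  exists2 u : 'I_d -> fracmod R,
    forall i, in_loc (helt_val (cech_face i)) (u i) & val y = \sum_i u i.

Lemma cech_boundary0 : cech_boundary 0.
Proof.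
exists (fun=> 0); last by rewrite raddf0 big1.
by move=> i; exists 0, 0%N; rewrite frac_div0.
Qed.

Lemma cech_boundary_linear r y z :
  cech_boundary y -> cech_boundary z -> cech_boundary (r *: y + z).
Proof.
move=> [u Hu ey] [v Hv ez]; exists (fun i => r *: u i + v i).
  move=> i; apply/loc_predP; apply: rpredD; last exact/loc_predP.
  by apply: rpredZ; apply/loc_predP.
have -> : val (r *: y + z) = r *: val y + val z by [].
by rewrite ey ez big_split /= scaler_sumr.
Qed.

Lemma cech_face_comp i j y :
  frac_comp (cech_face i) j y -> frac_comp (hsop_prod predT) j y.
Proof.
have eg : helt_val (hsop_prod predT) = helt_val (cech_face i) * x i.
  by rewrite /= (bigD1 i) //= mulrC.
have ed : helt_deg (hsop_prod predT) = (hsop_deg i + helt_deg (cech_face i))%N.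
  by rewrite /= (bigD1 i).
case=> a [t [ca ->]]; exists (a * x i ^+ t), t; split; last first.
  by rewrite eg -frac_div_expand // hsop_neq0.
rewrite ed mulnDr PoszD mulrC addrCA.
by apply: gdom_zcompM => //; apply: gdom_compX; apply: hsop_homog.
Qed.

Lemma cech_boundary_span y : cech_boundary y -> exists2 l : seq cech_top,
  (forall z, z \in l -> exists i, gmod_comp cech_top i z /\ cech_boundary z) &
  y = \sum_(z <- l) z.
Proof.
move=> [u Hu ey].
have H i : exists l : seq cech_top,
    (forall z, z \in l ->
       exists j, gmod_comp cech_top j z /\ cech_boundary z) /\
    u i = \sum_(z <- l) val z.
  have [l Hl ->] := loc_span (Hu i).
  have [|l' Hl' ->] := @loc_lift _ _ (hsop_prod predT)
      (in_loc (helt_val (cech_face i))) l.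
    move=> z /Hl[j cz]; split; first by exists j; apply: cech_face_comp cz.
    by apply/loc_predP; apply: frac_comp_in_loc cz.
  exists l'; split=> // z /Hl'[j [cz Nz]]; exists j; split=> //.
  exists (fun i' => if i' == i then val z else 0).
    move=> i'; case: eqP => [->//|_]; by exists 0, 0%N; rewrite frac_div0.
  by rewrite -big_mkcond big_pred1_eq.
have [L HL] := choice H.
exists (flatten [seq L i | i <- enum 'I_d]).
  move=> z /flatten_mapP[i _ zL]; have [Hi _] := HL i; exact: Hi.
apply: val_inj; rewrite ey raddf_sum /= big_flatten big_map big_enum /=.
by apply: eq_bigr => i _; have [_ ->] := HL i.
Qed.

Definition cech_image : gsubmodule cech_top :=
  GSubmodule cech_boundary0 cech_boundary_linear cech_boundary_span.

(* H^d_m(R), d = dim R. *)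
Definition top_local_cohomology : gmodule R := gquot_gmodule cech_image.

(* The graded k-dual of H^d_m(R); its isomorphism class does not depend on
   the system of parameters. *)
Definition canonical_module : gmodule R := gdual_gmodule top_local_cohomology.

(* [omega_R^(-1)]_i != 0, where omega_R^(-1) = Hom_R(omega_R, R). *)
Definition anticanonical_nonzero (i : int) : Prop :=
  exists2 phi : {linear canonical_module -> gregular R},
    gmod_hom_comp i phi & exists w, phi w != 0.

(* [is_b_invariant b] : the set of degrees above has a minimum, equal to b. *)
Definition is_b_invariant (b : int) : Prop :=
  anticanonical_nonzero b /\ forall i, anticanonical_nonzero i -> b <= i.
End CanonicalModule.

(** * Invariant rings *)

(* [action] is the library's notion of right action; g |-> act^~ g^-1 is the
   corresponding left action and has the same invariants.  Each [act^~ a] is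
   bijective because of the group action laws. *)
Record galg_action (k : fieldType) (n : nat) (gT : finGroupType) :=
  GAlgAction {
    galg_act :> {action gT &-> {mpoly k[n]}};
    galg_linear : forall a, linear (galg_act^~ a);
    galg_mult : forall a, monoid_morphism (galg_act^~ a);
    galg_homog : forall a d p, p \is d.-homog -> galg_act p a \is d.-homog }.

Section Invariants.
Variables (k : fieldType) (n : nat) (gT : finGroupType).
Variable rho : galg_action k n gT.

Definition invariant : {pred {mpoly k[n]}} :=
  fun p => [forall a, rho p a == p].

Lemma invariantP p : reflect (forall a, rho p a = p) (p \in invariant).
Proof. by apply: (iffP forallP) => H a; apply/eqP; apply: H. Qed.

Lemma galg_additive a : zmod_morphism (rho^~ a).
Proof. by move=> p q; have := galg_linear rho a (-1) q p; rewrite !scaleN1r !(addrC (- _)). Qed.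

Lemma galg0 a : rho 0 a = 0.
Proof. by have := galg_additive a 0 0; rewrite !subrr. Qed.

Lemma invariant_divring : divring_closed invariant.
Proof.
split=> [|p q /invariantP Hp /invariantP Hq|p q /invariantP Hp /invariantP Hq];
  apply/invariantP => a.
- exact: (galg_mult rho a).1.
- by rewrite galg_additive Hp Hq.
pose phi := rho^~ a.
pose phiZ := GRing.isZmodMorphism.Build _ _ phi (galg_additive a).
pose phiM := GRing.isMonoidMorphism.Build _ _ phi (galg_mult rho a).
pose phiR : {rmorphism {mpoly k[n]} -> {mpoly k[n]}} := HB.pack phi phiZ phiM.
rewrite (galg_mult rho a).2 Hp; congr (_ * _).
have [qU|qN] := boolP (q \is a GRing.unit); last by rewrite invr_out.
by rewrite -[LHS]/(phiR q^-1) rmorphV //= /phi Hq.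
Qed.

HB.instance Definition _ :=
  GRing.isDivringClosed.Build {mpoly k[n]} invariant invariant_divring.

Definition invariant_type := {p : {mpoly k[n]} | p \in invariant}.
HB.instance Definition _ := SubChoice.on invariant_type.
HB.instance Definition _ := [SubChoice_isSubIntegralDomain of invariant_type by <:].

Lemma galgC a c : rho c%:MP a = c%:MP.
Proof.
have rho0 := galg0 a.
have := galg_linear rho a c 1 0.
by rewrite !addr0 (galg_mult rho a).1 rho0 addr0 -mul_mpolyC mulr1.
Qed.

Lemma invariantC c : c%:MP \in invariant.
Proof. by apply/invariantP => a; apply: galgC. Qed.

Definition invariant_scal (c : k) : invariant_type := Sub c%:MP (invariantC c).

Lemma invariant_scal_zmod : zmod_morphism invariant_scal.
Proof. by move=> c c'; apply: val_inj; rewrite raddfB /= mpolyCB. Qed.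
Lemma invariant_scal_monoid : monoid_morphism invariant_scal.
Proof.
by split=> [|c c']; apply: val_inj; rewrite ?rmorph1 ?rmorphM //= mpolyCM.
Qed.
HB.instance Definition _ := GRing.isZmodMorphism.Build k invariant_type
  invariant_scal invariant_scal_zmod.
HB.instance Definition _ := GRing.isMonoidMorphism.Build k invariant_type
  invariant_scal invariant_scal_monoid.

Definition invariant_comp (d : nat) (p : invariant_type) : Prop :=
  val p \is d.-homog.

Lemma galg_sum a (I : Type) (s : seq I) (u : I -> {mpoly k[n]}) :
  rho (\sum_(i <- s) u i) a = \sum_(i <- s) rho (u i) a.
Proof.
have rho0 := galg0 a.
apply: (big_morph (rho^~ a)) => // p q.
by rewrite -{1}[q]opprK galg_additive -(sub0r q) galg_additive rho0 sub0r opprK.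
Qed.

Lemma homog_direct (s : seq nat) (u : nat -> {mpoly k[n]}) : uniq s ->
    (forall d, u d \is d.-homog) -> \sum_(d <- s) u d = 0 ->
  forall d, d \in s -> u d = 0.
Proof.
move=> us cu su0 d ds; have := congr1 (pihomog mdeg d) su0.
rewrite pihomog0 raddf_sum (bigD1_seq d) //= pihomog_dE // big1 ?addr0 //.
by move=> e /negbTE ed; rewrite (pihomog_ne0 (d := e)) ?ed.
Qed.

Lemma pihomog_invariant d p : p \in invariant -> pihomog mdeg d p \in invariant.
Proof.
move=> /invariantP Hp; apply/invariantP => a.
pose K := maxn (msize p) d.+1.
pose u e := rho (pihomog mdeg e p) a - pihomog mdeg e p.
have cu e : u e \is e.-homog.
  by rewrite rpredB ?pihomogP //; apply: galg_homog; apply: pihomogP.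
have pE : p = \sum_(e < K) pihomog mdeg e p.
  by apply: pihomog_partitionE; rewrite (leq_trans _ (leq_maxl _ _)) // msize_mdeg_lt.
have u0 : \sum_(e <- iota 0 K) u e = 0.
  rewrite sumrB -galg_sum; have <- : p = \sum_(e <- iota 0 K) pihomog mdeg e p.
    by rewrite [LHS]pE -(big_mkord xpredT (fun e => pihomog mdeg e p)) /index_iota subn0.
  by rewrite Hp subrr.
apply/eqP; rewrite -subr_eq0; apply/eqP.
apply: (homog_direct (iota_uniq 0 K) cu u0).
by rewrite mem_iota /= add0n leq_maxr.
Qed.

Lemma invariant_grading : is_grading invariant_comp.
Proof.
split.
- by move=> d; rewrite /invariant_comp raddf0 rpred0.
- by move=> d p q cp cq; rewrite /invariant_comp raddfB rpredB.
- move=> p; pose K := msize (val p).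
  exists [seq (Sub (pihomog mdeg d (val p)) (pihomog_invariant d (valP p))
                 : invariant_type) | d <- iota 0 K].
    move=> _ /mapP[d _ ->]; exists d; rewrite /invariant_comp SubK.
    exact: pihomogP.
  apply: val_inj; rewrite big_map raddf_sum /=.
  have pE : val p = \sum_(e < K) pihomog mdeg e (val p).
    exact: pihomog_partitionE.
  by rewrite [LHS]pE -(big_mkord xpredT (fun e => pihomog mdeg e (val p)))
    /index_iota subn0.
move=> s u us cu su0 d ds; apply: val_inj; rewrite raddf0.
apply: (homog_direct us (u := fun d => val (u d))) => //.
have -> : \sum_(i <- s) val (u i) = val (\sum_(i <- s) u i) by rewrite raddf_sum.
by rewrite su0 raddf0.
Qed.

Lemma invariant_compM i j p q :
  invariant_comp i p -> invariant_comp j q -> invariant_comp (i + j) (p * q).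
Proof. by move=> cp cq; rewrite /invariant_comp rmorphM dhomogM. Qed.

Lemma invariant_comp0 p : invariant_comp 0 p <-> exists c, p = invariant_scal c.
Proof.
split=> [cp|[c ->]].
  exists (mcoeff 0%MM (val p)); apply: val_inj => /=; apply/mpolyP => m.
  rewrite mcoeffC; have [<-|m0] := eqVneq 0%MM m; first by rewrite mulr1.
  rewrite mulr0; apply: (dhomog_nemf_coeff cp).
  by rewrite mdeg_eq0 eq_sym.
by rewrite /invariant_comp SubK -[c%:MP]mulr1 mul_mpolyC rpredZ ?dhomog1.
Qed.

Definition invariant_ring : gdomain k :=
  GDomain invariant_grading invariant_compM invariant_comp0.
End Invariants.

(* Main.v *)
(* Let R = S^G, with parameters f_1, ..., f_d spanning a polynomial ring P.
   Sending a functional on top local cohomology to the generating function of its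
   values on the fractions r / f^(a+1) embeds omega_R in Hom_P(R, P). Composing with
   the trace over the image of G in Aut(S), which is nonzero by Dedekind, gives a
   G-invariant element of Hom_P(S, P). Such a functional is contracted against the
   Bezoutian Delta = det(b), where f_i(Y) - f_i(x) = sum_j b_ij (Y_j - x_j): this is
   S-linear, injective, of degree sum_i deg(f_i) - n, and, since Delta is unique
   modulo the f_i(Y) - f_i(x), it turns invariant functionals into polynomials q
   with det(g) g(q) = q. For abelian G there is a nonzero form h of degree n with
   g(h) = det(g) h, a product of norm forms over the composition factors of S_1, and
   phi |-> h q embeds omega_R in R in degree 0. *)

Require Import Defs.
From HB Require Import structures.
From mathcomp Require Import all_boot all_order all_fingroup all_algebra.
From mathcomp Require Import boolp.
From mathcomp Require Import mpoly.

Import GRing.Theory Num.Theory.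
Local Open Scope ring_scope.
Set Implicit Arguments.
Unset Strict Implicit.
Unset Printing Implicit Defensive.

(** * Ideals generated by finite families *)

(** The field k is arbitrary: S_1 need not be semisimple and G need not have eigenvectors in it.
    This is why h is assembled from composition factors instead of a product of common eigenvectors.
    Only injections are built. Where duality over P would use a free basis of S, the argument takes
    elements of S forming a basis of Frac(S) over Frac(P) and carries a common denominator s0. The
    equality d = n, without which Delta is no determinant, is itself extracted from the nonvanishing
    of a Bezoutian. The factor det(g) has a geometric meaning: q dx_1 ... dx_n is a G-invariant
    n-form, and h turns such forms into invariant polynomials. The degrees cancel: generating
    functions shift by - sum_i deg(f_i), Delta by sum_i deg(f_i) - n, and h by n. The embedding is a
    degree-0 element of the anticanonical module, but b(R) also requires that element to be nonzero
    and the set of degrees to be bounded below. The first comes from a residue functional showing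
    omega_R nonzero, the second from omega_R having rank one. *)

Section Ideal.
Variables (B : comNzRingType) (r : nat) (F : 'I_r -> B).
Implicit Types p q : B.

Definition in_ideal p : Prop := exists c : 'I_r -> B, p = \sum_i c i * F i.

Lemma ideal0 : in_ideal 0.
Proof. by exists (fun=> 0); rewrite big1 // => i _; rewrite mul0r. Qed.

Lemma idealD p q : in_ideal p -> in_ideal q -> in_ideal (p + q).
Proof.
case=> a -> [b ->]; exists (fun i => a i + b i).
by rewrite -big_split; apply: eq_bigr => i _; rewrite mulrDl.
Qed.

Lemma idealM p q : in_ideal q -> in_ideal (p * q).
Proof.
case=> a ->; exists (fun i => p * a i).
by rewrite mulr_sumr; apply: eq_bigr => i _; rewrite mulrA.
Qed.

Lemma idealMr p q : in_ideal q -> in_ideal (q * p).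
Proof. by rewrite mulrC; apply: idealM. Qed.

Lemma idealN p : in_ideal p -> in_ideal (- p).
Proof. by move=> Fp; rewrite -mulN1r; apply: idealM. Qed.

Lemma ideal_sum (I : Type) (s : seq I) (P : pred I) (u : I -> B) :
  (forall i, P i -> in_ideal (u i)) -> in_ideal (\sum_(i <- s | P i) u i).
Proof.
by move=> Fu; elim/big_rec: _ => [|i p Pi Fp]; [apply: ideal0|apply: idealD; auto].
Qed.

Lemma ideal_gen i : in_ideal (F i).
Proof.
exists (fun j => (j == i)%:R); rewrite (bigD1 i) //= eqxx mul1r big1 ?addr0 //.
by move=> j /negbTE->; rewrite mul0r.
Qed.

Lemma ideal_trans p q s : in_ideal (p - q) -> in_ideal (q - s) -> in_ideal (p - s).
Proof. by move=> /idealD H /H; rewrite addrA subrK. Qed.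
End Ideal.

Lemma ideal_sub (B : comNzRingType) r r' (F : 'I_r -> B) (F' : 'I_r' -> B) p :
  (forall i, in_ideal F (F' i)) -> in_ideal F' p -> in_ideal F p.
Proof. by move=> FF' [c ->]; apply: ideal_sum => i _; apply: idealM. Qed.

Lemma ideal_morph (B C : comNzRingType) r (F : 'I_r -> B) (g : {rmorphism B -> C}) p :
  in_ideal F p -> in_ideal (fun i => g (F i)) (g p).
Proof.
case=> c ->; exists (fun i => g (c i)).
by rewrite rmorph_sum; apply: eq_bigr => i _; rewrite rmorphM.
Qed.

(** * Coefficientwise extension of additive maps *)

Section CoefficientExtension.
Variables (n : nat) (A : comNzRingType) (W : zmodType).
Variable u : 'X_{1..n} -> A -> W.
Hypothesis uD : forall m, {morph u m : a b / a + b}.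

Definition mext (p : {mpoly A[n]}) : W := \sum_(m <- msupp p) u m p@_m.

Lemma mext_coef0 m : u m 0 = 0.
Proof. by apply: (addrI (u m 0)); rewrite -uD !addr0. Qed.

Lemma mextE (s : seq 'X_{1..n}) p : uniq s -> {subset msupp p <= s} ->
  mext p = \sum_(m <- s) u m p@_m.
Proof.
move=> us ps; apply/esym/big_supp => // m.
by move/memN_msupp_eq0->; apply: mext_coef0.
Qed.

Lemma mextD : {morph mext : p q / p + q}.
Proof.
move=> p q; pose s := undup (msupp p ++ msupp q).
have us : uniq s by exact: undup_uniq.
have sub r : {subset msupp r <= msupp p ++ msupp q} -> {subset msupp r <= s}.
  by move=> H m /H; rewrite mem_undup.
rewrite !(mextE us); first by rewrite -big_split; apply: eq_bigr => m _; rewrite mcoeffD uD.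
- by apply: sub => m mq; rewrite mem_cat mq orbT.
- by apply: sub => m mq; rewrite mem_cat mq.
- exact/sub/msuppD_le.
Qed.

Lemma mext0 : mext 0 = 0.
Proof. by apply: (addrI (mext 0)); rewrite -mextD !addr0. Qed.

Lemma mextN : {morph mext : p / - p}.
Proof. by move=> p; apply: (addrI (mext p)); rewrite -mextD !subrr mext0. Qed.

Lemma mextB : {morph mext : p q / p - q}.
Proof. by move=> p q; rewrite mextD mextN. Qed.

Lemma mext_sum (I : Type) (s : seq I) (P : pred I) (v : I -> {mpoly A[n]}) :
  mext (\sum_(i <- s | P i) v i) = \sum_(i <- s | P i) mext (v i).
Proof. exact: (big_morph mext mextD mext0). Qed.

Lemma mext_mon a m : mext (a *: 'X_[m]) = u m a.
Proof.
rewrite (@mextE [:: m]) //; first by rewrite big_seq1 mcoeffZ mcoeffX eqxx mulr1.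
by move=> l /msuppZ_le; rewrite msuppX.
Qed.
End CoefficientExtension.

(** * Koszul-type lifting for the variables *)

Section Wiebe.
Variables (n : nat) (A : comNzRingType).
Local Notation B := {mpoly A[n]}.

(* An abstract form of "every syzygy of z is a Koszul syzygy". *)
Definition koszul_regular (z : 'I_n -> B) : Prop :=
  forall r (F : 'I_r -> B) (kap : 'I_n -> B),
    (forall j l, in_ideal F (z l * kap j - z j * kap l)) ->
  forall rho : 'I_n -> B, \sum_j rho j * z j = 0 ->
    in_ideal F (\sum_j rho j * kap j).

(** The hypothesis on [kap] makes X_j |-> kap_j a well-defined homomorphism from the ideal (X_1,
    ..., X_n) to B/(F), and a homomorphism sends a syzygy to 0. *)
Lemma koszul_regularX : koszul_regular (fun j => 'X_j).
Proof.
move=> r F kap kapP rho rho0.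
(* One variable dividing X^m is traded for the matching kap_j; [vP] shows that the choice is
   immaterial modulo F. The default 0 concerns m = 0 only, which is never a monomial of a multiple
   of X_j. *)
pose v (m : 'X_{1..n}) : B :=
  if [pick j | m j != 0%N] is Some j then 'X_[m - U_(j)] * kap j else 0.
pose u m a := a *: v m.
have uD m : {morph u m : a b / a + b} by move=> a b; rewrite /u scalerDl.
have vP m j : in_ideal F ('X_[m] * kap j - v (m + U_(j))%MM).
  rewrite /v; case: pickP => [l lm|/(_ j)]; last by rewrite mnmDE mnm1E eqxx addn1.
  have [->|jl] := eqVneq l j; first by rewrite addmK subrr; apply: ideal0.
  have lm' : (U_(l) <= m)%MM.
    apply/mnm_lepP => i; rewrite mnm1E; case: eqP => //= <-.
    by move: lm; rewrite mnmDE mnm1E [j == l]eq_sym (negbTE jl) addn0 lt0n.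
  have -> : 'X_[m] = 'X_[m - U_(l)] * 'X_l :> B by rewrite -mpolyXD submK.
  have -> : (m + U_(j) - U_(l) = m - U_(l) + U_(j))%MM.
    by rewrite addmC -addmBA // addmC.
  rewrite mpolyXD -!mulrA -mulrBr; exact/idealM/kapP.
have V j : in_ideal F (rho j * kap j - mext u (rho j * 'X_j)).
  rewrite [rho j]mpolyE !mulr_suml mext_sum //.
  rewrite -sumrB; apply: ideal_sum => m _.
  rewrite -!scalerAl -mpolyXD mext_mon // /u -scalerBr -mul_mpolyC.
  exact/idealM/vP.
have := @ideal_sum _ _ _ _ (index_enum _) xpredT _ (fun j _ => V j).
by rewrite sumrB -mext_sum // rho0 mext0 // subr0.
Qed.

Lemma koszul_regular_iso (z : 'I_n -> B) (g h : {rmorphism B -> B}) :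
  cancel g h -> koszul_regular (fun j => g (z j)) -> koszul_regular z.
Proof.
move=> gK gz r F kap kapP rho rho0.
have e : \sum_j g (rho j) * g (z j) = 0.
  have := congr1 g rho0; rewrite rmorph0 rmorph_sum => e0.
  by rewrite -[RHS]e0; apply: eq_bigr => j _; rewrite rmorphM.
have kapP' j l : in_ideal (g \o F) (g (z l) * g (kap j) - g (z j) * g (kap l)).
  by have := ideal_morph g (kapP j l); rewrite rmorphB !rmorphM.
have [c ec] := gz _ _ _ kapP' _ e.
exists (h \o c); rewrite -[LHS]gK rmorph_sum.
under eq_bigr do rewrite rmorphM.
by rewrite ec rmorph_sum; apply: eq_bigr => i _; rewrite rmorphM /= gK.
Qed.

(* Replacing one row changes the determinant by a syzygy paired with the
   cofactors of that row. *)
Lemma det_syzygy_ideal (z : 'I_n -> B) : koszul_regular z ->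
  forall M M' : 'M[B]_n,
    (forall i, \sum_j M i j * z j = \sum_j M' i j * z j) ->
  in_ideal (fun i => \sum_j M i j * z j) (\det M - \det M').
Proof.
move=> zreg M M' eM; set F := (fun i => _).
(* N t interpolates from M to M' one row at a time, with N t z = F throughout. *)
pose N t : 'M[B]_n := \matrix_(i, j) if (i < t)%N then M' i j else M i j.
have NF t i : \sum_j N t i j * z j = F i.
  by case: (ltnP i t) => it; under eq_bigr do rewrite mxE ?it ?ltnNge ?it /= //;
  rewrite /F // ?eM.
have step t : in_ideal F (\det (N t) - \det (N t.+1)).
  have [tn|nt] := ltnP t n; last first.
    have -> : N t.+1 = N t; last by rewrite subrr; apply: ideal0.
    apply/matrixP => i j; rewrite !mxE.
    by rewrite !(leq_trans (ltn_ord i)) // ltnW.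
  pose i0 := Ordinal tn.
  have co j : cofactor (N t) i0 j = cofactor (N t.+1) i0 j.
    rewrite /cofactor; congr (_ * \det _); apply/matrixP => a b; rewrite !mxE.
    have ne : nat_of_ord (lift i0 a) != t.
      by apply: contra (neq_lift i0 a) => /eqP e; apply/eqP/val_inj.
    by rewrite [in RHS]ltnS [in RHS]leq_eqVlt (negbTE ne).
  rewrite (expand_det_row (N t) i0) (expand_det_row (N t.+1) i0) -sumrB.
  under eq_bigr do rewrite -co -mulrBl.
  apply: (zreg); last first.
    by under eq_bigr do rewrite mulrBl; rewrite sumrB !NF subrr.
  move=> j l; set M0 := N t.
  (* With the unit vector e_j in row i0, det N0 is the cofactor at (i0, j). The adjugate applied to
     N0 z then computes z_l times this cofactor: row i0 contributes z_j times the cofactor at (i0,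
     l), and every other row lies in F. This is the Koszul relation for the cofactors. *)
  pose N0 : 'M[B]_n := \matrix_(a, b) if a == i0 then (b == j)%:R else M0 a b.
  have co0 b : cofactor N0 i0 b = cofactor M0 i0 b.
    rewrite /cofactor; congr (_ * \det _); apply/matrixP => a c; rewrite !mxE.
    by rewrite eq_sym (negbTE (neq_lift _ _)).
  have detN0 : \det N0 = cofactor M0 i0 j.
    rewrite (expand_det_row N0 i0) (bigD1 j) //= mxE !eqxx mul1r co0 big1 ?addr0 //.
    by move=> b /negbTE bj; rewrite mxE eqxx bj mul0r.
  have e : z l * cofactor M0 i0 j =
      \sum_a cofactor N0 a l * \sum_b N0 a b * z b.
    have /matrixP/(_ l ord0) := congr1 (mulmx^~ (\col_b z b)) (mul_adj_mx N0).
    rewrite mul_scalar_mx -mulmxA !mxE detN0 mulrC => <-; apply: eq_bigr => a _.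
    by rewrite !mxE; congr (_ * _); apply: eq_bigr => b _; rewrite !mxE.
  rewrite e (bigD1 i0) //= co0.
  have -> : \sum_b N0 i0 b * z b = z j.
    rewrite (bigD1 j) //= mxE !eqxx mul1r big1 ?addr0 // => b /negbTE bj.
    by rewrite mxE eqxx bj mul0r.
  rewrite mulrC addrC addrK; apply: ideal_sum => a ai; apply: idealM.
  under eq_bigr do rewrite mxE (negbTE ai).
  by rewrite NF; apply: ideal_gen.
have eM0 : M = N 0%N by apply/matrixP => i j; rewrite mxE.
have eM1 : M' = N n by apply/matrixP => i j; rewrite mxE ltn_ord.
suff H t : in_ideal F (\det (N 0%N) - \det (N t)) by rewrite {1}eM0 eM1.
elim: t => [|t IH]; first by rewrite subrr; apply: ideal0.
exact: ideal_trans IH (step t).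
Qed.
End Wiebe.

Lemma mpoly_rmorph_ext n (A C : comNzRingType) (f g : {rmorphism {mpoly A[n]} -> C}) :
  (forall c, f c%:MP = g c%:MP) -> (forall i, f 'X_i = g 'X_i) -> f =1 g.
Proof.
move=> fgC fgX p; rewrite (mpolyE p) !rmorph_sum; apply: eq_bigr => m _.
rewrite -mul_mpolyC !rmorphM fgC mpolyXE_id !rmorph_prod; congr (_ * _).
by apply: eq_bigr => i _; rewrite !rmorphXn fgX.
Qed.

(** * Koszul regularity of the differences Y_j - x_j *)

Section Translation.
Variables (n : nat) (A : comNzRingType).
Local Notation B := {mpoly A[n]}.
Implicit Types x : 'I_n -> A.

Definition translate x : {rmorphism B -> B} :=
  mmap (@mpolyC n A) (fun j => 'X_j + (x j)%:MP).

Lemma translateK x : cancel (translate x) (translate (fun j => - x j)).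
Proof.
pose f : {rmorphism B -> B} := translate (fun j => - x j) \o translate x.
move=> p; apply: (@mpoly_rmorph_ext _ _ _ f idfun) => [c|i] /=.
  by rewrite /translate /= !mmapC.
rewrite /translate /= mmapX mmap1U rmorphD /= mmapX mmap1U mmapC.
by rewrite mpolyCN subrK.
Qed.

Lemma koszul_regular_sub x : koszul_regular (fun j => 'X_j - (x j)%:MP : B).
Proof.
apply: koszul_regular_iso (translateK x) _.
have -> : (fun j => translate x ('X_j - (x j)%:MP)) = (fun j => 'X_j).
  apply/funext => j; rewrite rmorphB /translate /= mmapX mmap1U mmapC.
  by rewrite addrK.
exact: koszul_regularX.
Qed.
End Translation.

(** * Separated variables *)

Section Separated.
Variables (n : nat) (A : comNzRingType).
Local Notation B := {mpoly A[n]}.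

Definition in_var (j : 'I_n) (p : {poly A}) : B := (map_poly (@mpolyC n A) p).['X_j].

Lemma in_varM j : {morph in_var j : p q / p * q}.
Proof. by move=> p q; rewrite /in_var rmorphM hornerM. Qed.

Lemma in_var_wide j (p : {poly A}) N : (size p <= N)%N ->
  in_var j p = \sum_(i < N) p`_i *: 'X_j ^+ i.
Proof.
move=> pN; rewrite /in_var (@horner_coef_wide _ N); last first.
  exact: leq_trans (size_poly _ _) pN.
by apply: eq_bigr => i _; rewrite coef_map mul_mpolyC.
Qed.

Lemma in_varXn j i : in_var j 'X^i = 'X_j ^+ i.
Proof. by rewrite /in_var map_polyXn hornerXn. Qed.

Lemma in_varXsubC j a : in_var j ('X - a%:P) = 'X_j - a%:MP.
Proof. by rewrite /in_var map_polyXsubC hornerXsubC. Qed.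

Section Residue.
Variable th : 'I_n -> {poly A} -> A.
Hypothesis thL : forall j, linear_for *%R (th j).

(** The tensor product of the one-variable functionals th_j. *)
Definition sep_residue : B -> A :=
  mext (fun m a => a * \prod_j th j 'X^(m j)).

Lemma sep_residue_coefD m : {morph (fun a : A => a * \prod_j th j 'X^(m j)) : a b / a + b}.
Proof. by move=> a b; rewrite mulrDl. Qed.

Lemma sep_residue_sum (I : Type) (s : seq I) (P : pred I) (v : I -> B) :
  sep_residue (\sum_(i <- s | P i) v i) = \sum_(i <- s | P i) sep_residue (v i).
Proof. by apply: mext_sum; apply: sep_residue_coefD. Qed.

Lemma sep_residueZ a p : sep_residue (a *: p) = a * sep_residue p.
Proof.
rewrite (mpolyE p) scaler_sumr !sep_residue_sum mulr_sumr.
apply: eq_bigr => m _; rewrite scalerA /sep_residue.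
by rewrite !mext_mon ?mulrA //; apply: sep_residue_coefD.
Qed.

Lemma th_sum j (p : {poly A}) N : (size p <= N)%N -> th j p = \sum_(i < N) p`_i * th j 'X^i.
Proof.
move=> pN.
have th0 : th j 0 = 0.
  by have := thL j (-1) 0 0; rewrite scaler0 addr0 mulN1r addNr.
have thD : {morph th j : p q / p + q}.
  by move=> q r; rewrite -[q]scale1r thL mul1r scale1r.
have thZ a q : th j (a *: q) = a * th j q by rewrite -[a *: q]addr0 thL th0 addr0.
have -> : p = \sum_(i < N) p`_i *: 'X^i.
  rewrite -poly_def; apply/polyP => i; rewrite coef_poly; case: ltnP => // Ni.
  by rewrite nth_default // (leq_trans pN).
rewrite (big_morph _ thD th0); apply: eq_bigr => i _; rewrite thZ; congr (_ * _).
rewrite coef_sum (bigD1 i) //= coefZ coefXn eqxx mulr1 big1 ?addr0 // => l li.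
by rewrite coefZ coefXn eq_sym -val_eqE in li *; rewrite (negbTE li) mulr0.
Qed.

Lemma sep_residue_prod (p : 'I_n -> {poly A}) :
  sep_residue (\prod_j in_var j (p j)) = \prod_j th j (p j).
Proof.
pose N := (\max_j size (p j))%N.
have pN j : (size (p j) <= N)%N by exact: leq_bigmax.
under eq_bigr do rewrite (in_var_wide _ (pN _)).
under [RHS]eq_bigr do rewrite (th_sum _ (pN _)).
rewrite !bigA_distr_bigA sep_residue_sum; apply: eq_bigr => f _.
rewrite scaler_prod sep_residueZ big_split /=; congr (_ * _).
have -> : \prod_j 'X_j ^+ f j = 'X_[[multinom nat_of_ord (f j) | j < n]] :> B.
  by rewrite mpolyXE_id; apply: eq_bigr => j _; rewrite mnmE.
rewrite -[X in sep_residue X]scale1r /sep_residue mext_mon; last exact: sep_residue_coefD.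
by rewrite mul1r; apply: eq_bigr => j _; rewrite mnmE.
Qed.
End Residue.

(* The functional reads off the coefficient of the top monomial of the free
   module A[Y] / (W_1(Y_1), ..., W_n(Y_n)). *)
Lemma residue_functional (W e : 'I_n -> {poly A}) (x : 'I_n -> A) :
    (forall j, W j \is monic) -> (forall j, W j = e j * ('X - (x j)%:P)) ->
  forall s, in_ideal (fun j => in_var j (W j)) (s%:MP * \prod_j in_var j (e j)) -> s = 0.
Proof.
move=> Wm We s [c ec].
have em j : e j \is monic.
  by have := Wm j; rewrite We monicMr ?monicXsubC.
have sW j : size (W j) = (size (e j)).+1.
  rewrite We size_Mmonic ?monicXsubC ?monic_neq0 // size_XsubC addn2 //=.
(* The index is deg e_j = deg W_j - 1. So e_j is its own remainder and, being monic, has value 1,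
   while multiples of W_j have value 0. *)
pose th j p := (Pdiv.CommonRing.rmodp p (W j))`_(size (e j)).-1.
have thL j : linear_for *%R (th j).
  move=> a p q; rewrite /th Pdiv.RingMonic.rmodpD // Pdiv.RingMonic.rmodpZ //.
  by rewrite coefD coefZ.
have thW j q : th j (q * W j) = 0.
  by rewrite /th Pdiv.RingMonic.rmodp_mull // coef0.
have the j : th j (e j) = 1.
  rewrite /th Pdiv.CommonRing.rmodp_small ?sW //; exact/eqP/(em j).
have := congr1 (sep_residue th) ec.
rewrite mul_mpolyC sep_residueZ // sep_residue_prod // big1 // mulr1 => ->.
rewrite sep_residue_sum big1 // => j _.
(* The multiplier c_j is arbitrary; split into monomials, each term becomes a separated product with
   a multiple of W_j in slot j. *)
rewrite (mpolyE (c j)) mulr_suml sep_residue_sum big1 // => m _.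
rewrite -scalerAl sep_residueZ // mpolyXE_id.
have -> : (\prod_i 'X_i ^+ m i) * in_var j (W j) =
    \prod_i in_var i (if i == j then 'X^(m i) * W i else 'X^(m i)).
  rewrite (bigD1 j) //= mulrAC [RHS](bigD1 j) //= eqxx in_varM in_varXn.
  by congr (_ * _); apply: eq_bigr => i /negbTE->; rewrite in_varXn.
by rewrite sep_residue_prod // (bigD1 j) //= eqxx thW mul0r mulr0.
Qed.
End Separated.

(** * Homogeneity with integer degrees *)

Section IntegerDegree.
Variables (n : nat) (K : comNzRingType).
Implicit Types (D E : int) (p q : {mpoly K[n]}).

(** Degrees are integers because differences such as E - |m| or i - n may be negative; a form of
    negative degree is then 0. *)
Definition ihomog D p : Prop := forall m, p@_m != 0 -> (mdeg m)%:Z = D.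

Lemma ihomog_nat d p : ihomog d%:Z p <-> p \is d.-homog.
Proof.
split=> [hp|/dhomogP hp m]; last by rewrite -mcoeff_msupp => /hp->.
by apply/dhomogP => m; rewrite mcoeff_msupp => /hp[].
Qed.

Lemma ihomog_neg d p : ihomog (Negz d) p -> p = 0.
Proof.
move=> hp; apply/mpolyP => m; rewrite mcoeff0; apply/eqP.
by apply: contraT => /hp.
Qed.

Lemma ihomog0 D : ihomog D 0.
Proof. by move=> m; rewrite mcoeff0 eqxx. Qed.

Lemma ihomogD D p q : ihomog D p -> ihomog D q -> ihomog D (p + q).
Proof.
move=> hp hq m; rewrite mcoeffD => pq0; have [p0|/hp//] := eqVneq p@_m 0.
by apply: hq; rewrite p0 add0r in pq0.
Qed.

Lemma ihomogZ D a p : ihomog D p -> ihomog D (a *: p).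
Proof.
move=> hp m; rewrite mcoeffZ => ap0; apply: hp.
by apply: contra ap0 => /eqP->; rewrite mulr0.
Qed.

Lemma ihomog_sum D (I : Type) (s : seq I) (P : pred I) (u : I -> {mpoly K[n]}) :
  (forall i, P i -> ihomog D (u i)) -> ihomog D (\sum_(i <- s | P i) u i).
Proof. by move=> hu; elim/big_ind: _ => //; [exact: ihomog0|exact: ihomogD]. Qed.

Lemma ihomogM D E p q : ihomog D p -> ihomog E q -> ihomog (D + E) (p * q).
Proof.
move=> hp hq m; rewrite -mcoeff_msupp => /msuppM_le /allpairsP[[a b] /= [ap bq ->]].
by move: ap bq; rewrite !mcoeff_msupp mdegD PoszD => /hp-> /hq->.
Qed.

Lemma ihomogC a : ihomog 0 (a%:MP : {mpoly K[n]}).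
Proof.
by move=> m; rewrite mcoeffC; have [->|] := eqVneq m 0%MM; rewrite ?mdeg0 ?mulr0 ?eqxx.
Qed.

Lemma ihomogX i : ihomog 1 ('X_i : {mpoly K[n]}).
Proof.
move=> m; rewrite mcoeffX; have [<-|_] := eqVneq U_(i)%MM m; last by rewrite eqxx.
by rewrite mdeg1.
Qed.
End IntegerDegree.

(** * Total degree in the two sets of variables x and Y *)

Section TotalDegree.
Variables (n : nat) (K : comNzRingType).
Local Notation A := {mpoly K[n]}.
Local Notation B := {mpoly A[n]}.
Implicit Types (D E : int) (p q : B).

Definition tot E p : Prop := forall m, ihomog (E - (mdeg m)%:Z) p@_m.

Lemma tot0 E : tot E 0.
Proof. by move=> m; rewrite mcoeff0; apply: ihomog0. Qed.

Lemma totD E p q : tot E p -> tot E q -> tot E (p + q).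
Proof. by move=> hp hq m; rewrite mcoeffD; apply: ihomogD. Qed.

Lemma totM D E p q : tot D p -> tot E q -> tot (D + E) (p * q).
Proof.
move=> hp hq m; rewrite mcoeffM; apply: ihomog_sum => k /eqP em.
have -> : D + E - (mdeg m)%:Z = D - (mdeg k.1)%:Z + (E - (mdeg k.2)%:Z).
  by rewrite {1}em mdegD PoszD opprD addrACA.
exact: ihomogM.
Qed.

Lemma totC D a : ihomog D a -> tot D (a%:MP : B).
Proof.
move=> ha m; rewrite mcoeffC; have [->|_] := eqVneq m 0%MM.
  by rewrite mulr1 mdeg0 subr0.
by rewrite mulr0; apply: ihomog0.
Qed.

Lemma totN E p : tot E p -> tot E (- p).
Proof.
move=> hp; rewrite -mulN1r -(add0r E); apply: totM => //.
rewrite -(rmorph1 (@mpolyC n A)) -rmorphN; apply: totC.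
by rewrite -(rmorph1 (@mpolyC n K)) -rmorphN; apply: ihomogC.
Qed.

Lemma tot_sum E (I : Type) (s : seq I) (P : pred I) (u : I -> B) :
  (forall i, P i -> tot E (u i)) -> tot E (\sum_(i <- s | P i) u i).
Proof. by move=> hu; elim/big_ind: _ => //; [exact: tot0|exact: totD]. Qed.

Lemma tot1 : tot 0 1.
Proof.
by rewrite -(rmorph1 (@mpolyC n A)); apply/totC; rewrite -(rmorph1 (@mpolyC n K)); apply: ihomogC.
Qed.

Lemma tot_prod (I : Type) (s : seq I) (E : I -> int) (u : I -> B) :
  (forall i, tot (E i) (u i)) -> tot (\sum_(i <- s) E i) (\prod_(i <- s) u i).
Proof.
move=> hu; apply: (big_ind2 (fun p E => tot E p)) => // [|p D q D' hp hq].
  exact: tot1.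
exact: totM.
Qed.

Lemma tot_det r (E : 'I_r -> int) (M : 'M[B]_r) :
  (forall i j, tot (E i) (M i j)) -> tot (\sum_i E i) (\det M).
Proof.
move=> hM; apply: tot_sum => s _; rewrite -[\sum_i _]add0r; apply: totM.
  by rewrite -signr_odd; case: odd; [rewrite expr1; apply/totN/tot1|apply: tot1].
exact: tot_prod.
Qed.
End TotalDegree.

(** * Difference quotients *)

Section DifferenceQuotient.
Variables (n : nat) (K : comNzRingType).
Local Notation A := {mpoly K[n]}.
Local Notation B := {mpoly A[n]}.
Implicit Types (D E : int) (p q : A).

(* [A[Y]] is the coordinate ring of two copies of affine space: a polynomial p
   gives p(Y), with scalar coefficients, and the constant p(x). *)
Definition in_Y : {rmorphism A -> B} := map_mpoly (@mpolyC n K).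
Definition zdiff (j : 'I_n) : B := 'X_j - ('X_j)%:MP.

Lemma in_YX j : in_Y 'X_j = 'X_j.
Proof. by rewrite /in_Y /= map_mpolyX. Qed.

Lemma in_YC c : in_Y c%:MP = (c%:MP)%:MP.
Proof. by rewrite /in_Y /= map_mpolyC. Qed.

Lemma in_YD : {morph in_Y : p q / p + q}.
Proof. exact: (rmorphD in_Y). Qed.

Lemma in_YM : {morph in_Y : p q / p * q}.
Proof. exact: (rmorphM in_Y). Qed.

Lemma tot_in_Y D p : ihomog D p -> tot D (in_Y p).
Proof.
move=> hp m; rewrite /in_Y mcoeff_map_mpoly /=.
have [->|/hp <-] := eqVneq p@_m 0; first by rewrite mpolyC0; apply: ihomog0.
by rewrite subrr; apply: ihomogC.
Qed.

(* Unification would otherwise try to compute with [map_mpoly]. *)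
#[global] Opaque in_Y.

Definition diffquot D p : Prop := ihomog D p /\
  exists2 b : 'I_n -> B, forall j, tot (D - 1) (b j) &
    in_Y p - p%:MP = \sum_j b j * zdiff j.

Lemma diffquotD D p q : diffquot D p -> diffquot D q -> diffquot D (p + q).
Proof.
move=> [hp [b hb eb]] [hq [c hc ec]]; split; first exact: ihomogD.
exists (fun j => b j + c j); first by move=> j; apply: totD.
rewrite in_YD mpolyCD opprD addrACA.
rewrite [X in X + _]eb [X in _ + X]ec -big_split.
by apply: eq_bigr => j _; rewrite mulrDl.
Qed.

Lemma diffquotM D E p q : diffquot D p -> diffquot E q -> diffquot (D + E) (p * q).
Proof.
move=> [hp [b hb eb]] [hq [c hc ec]]; split; first exact: ihomogM.
exists (fun j => in_Y p * c j + b j * q%:MP).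
  move=> j; apply: totD; first by rewrite -addrA; apply/totM/hc/tot_in_Y.
  by rewrite -addrA [E - 1]addrC addrA; apply/totM/totC/hq.
have -> : in_Y (p * q) - (p * q)%:MP =
    in_Y p * (in_Y q - q%:MP) + (in_Y p - p%:MP) * q%:MP.
  by rewrite in_YM mpolyCM mulrBr mulrBl addrA subrK.
rewrite [X in _ * X + _]ec [X in _ + X * _]eb mulr_sumr mulr_suml -big_split; apply: eq_bigr => j _.
by rewrite mulrDl mulrA [b j * _ * _]mulrAC.
Qed.

Lemma diffquotC c : diffquot 0 c%:MP.
Proof.
split; first exact: ihomogC.
exists (fun=> 0); first by move=> j; apply: tot0.
by rewrite in_YC subrr big1 // => j _; rewrite mul0r.
Qed.

Lemma diffquotX i : diffquot 1 'X_i.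
Proof.
split; first exact: ihomogX.
exists (fun j => (j == i)%:R).
  by move=> j; rewrite subrr; case: (j == i); [apply: tot1 | apply: tot0].
rewrite (bigD1 i) //= eqxx mul1r in_YX big1 ?addr0 // => j /negbTE->.
by rewrite mul0r.
Qed.

(** [diffquot] includes homogeneity so that the product rule p(Y)q(Y) - p(x)q(x) = p(Y)(q(Y) - q(x))
    + (p(Y) - p(x))q(x) keeps track of degrees; everything then reduces to constants and
    variables. *)
Lemma diffquot_homog D p : ihomog D p -> diffquot D p.
Proof.
move=> hp; rewrite (mpolyE p); rewrite big_seq.
elim/big_ind: _ => [||m mp]; last 1 first.
- rewrite -(hp m) -?mcoeff_msupp // -mul_mpolyC -[_%:Z]add0r.
  apply: diffquotM; first exact: diffquotC.
  rewrite mpolyXE_id mdegE.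
  apply: (big_ind2 (fun p (D : nat) => diffquot D%:Z p)) => // [|p1 D1 p2 D2|i _].
  + exact: (diffquotC 1).
  + by rewrite PoszD; apply: diffquotM.
  elim: (m i) => [|t IH]; first exact: (diffquotC 1).
  by rewrite exprS -add1n PoszD; apply: diffquotM => //; apply: diffquotX.
- split; first exact: ihomog0.
  exists (fun=> 0); first by move=> j; apply: tot0.
  by rewrite (rmorph0 in_Y) mpolyC0 subrr big1 // => j _; rewrite mul0r.
- exact: diffquotD.
Qed.
End DifferenceQuotient.

(** * Congruences modulo an ideal, and Cramer's rule *)

Section Congruence.
Variables (B : comNzRingType) (r : nat) (F : 'I_r -> B).

Lemma ideal_congrM (p q p' q' : B) :
  in_ideal F (p - p') -> in_ideal F (q - q') -> in_ideal F (p * q - p' * q').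
Proof.
move=> hp hq; have -> : p * q - p' * q' = p * (q - q') + (p - p') * q'.
  by rewrite mulrBr mulrBl addrA subrK.
by apply: idealD; [apply: idealM | apply: idealMr].
Qed.

Lemma ideal_congr_prod (I : Type) (s : seq I) (u v : I -> B) :
  (forall i, in_ideal F (u i - v i)) ->
  in_ideal F (\prod_(i <- s) u i - \prod_(i <- s) v i).
Proof.
move=> uv; apply: (big_ind2 (fun p q => in_ideal F (p - q))) => //.
  by rewrite subrr; apply: ideal0.
by move=> *; apply: ideal_congrM.
Qed.

Lemma ideal_congrX (p q : B) t : in_ideal F (p - q) -> in_ideal F (p ^+ t - q ^+ t).
Proof.
move=> pq; elim: t => [|t IH]; first by rewrite subrr; apply: ideal0.
by rewrite !exprS; apply: ideal_congrM.
Qed.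

Lemma mpoly_rmorph_congr n (A : comNzRingType) (f g : {rmorphism {mpoly A[n]} -> B}) :
    (forall c, in_ideal F (f c%:MP - g c%:MP)) ->
    (forall i, in_ideal F (f 'X_i - g 'X_i)) ->
  forall p, in_ideal F (f p - g p).
Proof.
move=> hC hX p; rewrite (mpolyE p) !rmorph_sum -sumrB; apply: ideal_sum => m _.
rewrite -mul_mpolyC !rmorphM; apply: ideal_congrM => //.
rewrite mpolyXE_id !rmorph_prod; apply: ideal_congr_prod => i.
by rewrite !rmorphXn; apply: ideal_congrX.
Qed.
End Congruence.

Lemma cramer_ideal (B : comNzRingType) n (M : 'M[B]_n) (u : 'I_n -> B) j :
  in_ideal (fun i => \sum_l M i l * u l) (\det M * u j).
Proof.
have /matrixP/(_ j ord0) := congr1 (mulmx^~ (\col_b u b)) (mul_adj_mx M).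
rewrite mul_scalar_mx -mulmxA !mxE => <-; apply: ideal_sum => i _.
rewrite !mxE; apply: idealM; under eq_bigr do rewrite mxE.
exact: ideal_gen.
Qed.

(** * The Bezoutian *)

Section Bezoutian.
Variables (n : nat) (K : comNzRingType).
Local Notation A := {mpoly K[n]}.
Local Notation B := {mpoly A[n]}.

Lemma in_Y_congr (p : A) : in_ideal (@zdiff n K) (in_Y n K p - p%:MP).
Proof.
apply: (@mpoly_rmorph_congr _ _ _ _ _ (in_Y n K) (@mpolyC n A)) => [c|i].
  by rewrite in_YC subrr; apply: ideal0.
by rewrite in_YX; apply: ideal_gen.
Qed.

Variables (F : 'I_n -> B) (b : 'M[B]_n).
Hypothesis Fb : forall i, F i = \sum_j b i j * zdiff K j.

(** p(Y) - p(x) is a combination of the differences Y_j - x_j, and Cramer's rule puts det b times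
    each difference in F. Sliding p from x to Y across Delta is what makes contraction linear over
    S. *)
Lemma bezoutian_slide (p : A) : in_ideal F ((in_Y n K p - p%:MP) * \det b).
Proof.
have [c ->] := in_Y_congr p; rewrite mulr_suml; apply: ideal_sum => j _.
rewrite -mulrA [_ * \det b]mulrC; apply: idealM.
have -> : F = (fun i => \sum_l b i l * zdiff K l) by apply/funext.
exact: cramer_ideal.
Qed.

Lemma bezoutian_unique (b' : 'M[B]_n) :
    (forall i, F i = \sum_j b' i j * zdiff K j) ->
  in_ideal F (\det b - \det b').
Proof.
move=> Fb'; have -> : F = (fun i => \sum_l b i l * zdiff K l) by apply/funext.
by apply: det_syzygy_ideal => [|i]; [apply: koszul_regular_sub | rewrite -Fb -Fb'].
Qed.

(** Writing W_j = e_j (T - x_j) gives w_j = W_j(Y_j) a diagonal difference matrix D. Since w = N F,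
    uniqueness yields det D = det N det b modulo w. Cramer's rule for N carries s det b in (F) to s
    det D in (w), where the residue functional reads off s. *)
Lemma bezoutian_nondegenerate (W : 'I_n -> {poly A}) :
    (forall j, W j \is monic) -> (forall j, root (W j) 'X_j) ->
    (forall j, in_ideal F (in_var j (W j))) ->
  forall s : A, in_ideal F (s%:MP * \det b) -> s = 0.
Proof.
move=> Wm W0 WF s.
have [e We] := choice (fun j => elimT (factor_theorem (W j) 'X_j) (W0 j)).
have [M eM] := choice WF.
pose N : 'M[B]_n := \matrix_(i, j) M i j.
pose D : 'M[B]_n := diag_mx (\row_j in_var j (e j)).
pose w j := in_var j (W j).
have Dz i : \sum_j D i j * zdiff K j = w i.
  rewrite (bigD1 i) //= !mxE eqxx mulr1n big1 ?addr0.
    by rewrite /w We in_varM in_varXsubC.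
  by move=> j /negbTE ji; rewrite !mxE eq_sym ji mulr0n mul0r.
have Nz i : \sum_j (N *m b) i j * zdiff K j = w i.
  rewrite /w eM; under [RHS]eq_bigr do rewrite Fb mulr_sumr.
  rewrite exchange_big; apply: eq_bigr => j _; rewrite !mxE mulr_suml.
  by apply: eq_bigr => l _; rewrite mxE mulrA.
have eD : in_ideal w (\det D - \det (N *m b)).
  have -> : w = (fun i => \sum_l D i l * zdiff K l) by apply/funext => i; rewrite Dz.
  by apply: det_syzygy_ideal => [|i]; [apply: koszul_regular_sub | rewrite Nz Dz].
move=> [c ec]; apply: (residue_functional Wm We); rewrite -/w.
have -> : \prod_j in_var j (e j) = \det D.
  by rewrite det_diag; apply: eq_bigr => j _; rewrite mxE.
have -> : s%:MP * \det D =
    s%:MP * (\det D - \det (N *m b)) + \det N * (s%:MP * \det b).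
  by rewrite det_mulmx mulrBr [\det N * (_ * _)]mulrCA subrK.
apply: idealD; first exact: idealM.
rewrite ec mulr_sumr; apply: ideal_sum => i _.
rewrite mulrCA; apply: idealM.
have -> : w = (fun j => \sum_l N j l * F l).
  by apply/funext => j; rewrite /w eM; apply: eq_bigr => l _; rewrite mxE.
exact: cramer_ideal.
Qed.
End Bezoutian.

(** * Number of algebraically independent polynomials *)

Section IndependentCard.
Variables (K : fieldType) (n d : nat) (f : 'I_d -> {mpoly K[n]}).

Definition deg_le t (p : {mpoly K[n]}) : Prop := forall m, m \in msupp p -> (mdeg m <= t)%N.

Lemma deg_leM s t p q : deg_le s p -> deg_le t q -> deg_le (s + t) (p * q).
Proof.
move=> hp hq m /msuppM_le /allpairsP[[a b] /= [ap bq ->]].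
by rewrite mdegD leq_add ?hp ?hq.
Qed.

Lemma deg_le1 : deg_le 0 1.
Proof. by move=> m; rewrite msupp1 inE => /eqP->; rewrite mdeg0. Qed.

Lemma deg_leX s t p : deg_le s p -> deg_le (t * s) (p ^+ t).
Proof.
move=> hp; elim: t => [|t IH]; first exact: deg_le1.
by rewrite exprS mulSn; apply: deg_leM.
Qed.

(* There are N^d monomials of exponents < N in f, all lying in a space of
   dimension at most (c N)^n with c independent of N. *)
Lemma indep_leq : (forall p : {mpoly K[d]}, mmap (@mpolyC n K) f p = 0 -> p = 0) ->
  (d <= n)%N.
Proof.
move=> indep; rewrite leqNgt; apply/negP => nd.
pose D := (\max_i msize (f i))%N.
have fD i : deg_le D (f i).
  move=> m /msize_mdeg_lt/ltnW/leq_trans; apply; exact: leq_bigmax.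
(* M = c N exceeds d N D, a bound for the degree of a monomial in f with exponents below N. As c^n <
   N, (c N)^n < N^(n+1) <= N^d, so C has more rows than columns. *)
pose c := (d * D).+1; pose N := (c ^ n).+1; pose M := (c * N)%N.
pose R := {ffun 'I_d -> 'I_N}; pose Q := {ffun 'I_n -> 'I_M}.
pose mR (g : R) : 'X_{1..d} := [multinom nat_of_ord (g i) | i < d].
pose mQ (g : Q) : 'X_{1..n} := [multinom nat_of_ord (g i) | i < n].
pose C : 'M[K]_(#|R|, #|Q|) :=
  \matrix_(a, b) (mmap (@mpolyC n K) f 'X_[mR (enum_val a)])@_(mQ (enum_val b)).
have RQ : (#|Q| < #|R|)%N.
  rewrite !card_ffun !card_ord /M expnMn.
  apply: (@leq_trans (N ^ n.+1)); last by rewrite leq_exp2l // ltnS expn_gt0.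
  by rewrite expnS ltn_mul2r expn_gt0 /=.
have /rowV0Pn[u /sub_kermxP uC u0] : kermx C != 0.
  rewrite kermx_eq0 -row_leq_rank -ltnNge; exact: leq_ltn_trans (rank_leq_col C) RQ.
pose p := \sum_a u 0 a *: 'X_[mR (enum_val a)].
have mRI : injective mR.
  move=> g h /mnmP gh; apply/ffunP => i; apply/val_inj.
  by have := gh i; rewrite !mnmE.
have p0 : p != 0.
  have [a ua] : exists a, u 0 a != 0.
    apply/existsP; rewrite -negb_forall; apply: contra u0 => /forallP u0.
    by apply/eqP/rowP => a; rewrite mxE; apply/eqP.
  apply/eqP => /(congr1 (mcoeff (mR (enum_val a)))); rewrite mcoeff0 raddf_sum.
  rewrite (bigD1 a) //= mcoeffZ mcoeffX eqxx mulr1 big1 ?addr0; first exact/eqP.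
  move=> b ba; rewrite mcoeffZ mcoeffX; case: eqP => [/mRI/enum_val_inj e|]; last by rewrite mulr0.
  by rewrite e eqxx in ba.
case/eqP: p0; apply: indep.
have pE : mmap (@mpolyC n K) f p =
    \sum_a u 0 a *: mmap (@mpolyC n K) f 'X_[mR (enum_val a)].
  rewrite /p raddf_sum; apply: eq_bigr => a _.
  by rewrite /= mmapZ mul_mpolyC.
apply/mpolyP => m; rewrite mcoeff0 pE raddf_sum /=.
have [mM|] := boolP [forall i : 'I_n, m i < M]%N.
  pose g : Q := [ffun i => Ordinal (forallP mM i)].
  have -> : m = mQ g by apply/mnmP => i; rewrite mnmE ffunE.
  have /matrixP/(_ 0 (enum_rank g)) := uC; rewrite !mxE => e.
  by rewrite -[RHS]e; apply: eq_bigr => a _; rewrite mcoeffZ !mxE enum_rankK.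
rewrite negb_forall => /existsP[i]; rewrite -leqNgt => Mi.
rewrite big1 // => a _; rewrite mcoeffZ memN_msupp_eq0 ?mulr0 //.
have hd : deg_le (\sum_(j < d) N * D) (mmap (@mpolyC n K) f 'X_[mR (enum_val a)]).
  rewrite mmapX /mmap1; apply: (big_ind2 (fun p s => deg_le s p)) => [||j _].
  - exact: deg_le1.
  - by move=> *; apply: deg_leM.
  move=> l /(deg_leX (fD j))/leq_trans; apply.
  by rewrite mnmE leq_mul2r (ltnW (ltn_ord _)) orbT.
apply/negP => /hd; rewrite sum_nat_const card_ord leqNgt => /negP; apply.
apply: (@leq_trans (m i)); last by rewrite mdegE (bigD1 i) //= leq_addr.
apply: leq_trans Mi; rewrite /M /c mulSn mulnA [(d * N * D)%N]mulnAC.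
by rewrite -[X in (X < _)%N]add0n ltn_add2r.
Qed.
End IndependentCard.

(** * Substitution of parameters and integral equations *)

Section SystemOfParameters.
Variables (K : fieldType) (n d : nat) (f : 'I_d -> {mpoly K[n]}).
Local Notation A := {mpoly K[n]}.
Local Notation B := {mpoly A[n]}.
Local Notation P0 := {mpoly K[d]}.

Definition hsub : {rmorphism P0 -> A} := mmap (@mpolyC n K) f.

Lemma hsubX i : hsub 'X_i = f i.
Proof. by rewrite /hsub /= mmapX mmap1U. Qed.

Lemma hsubC c : hsub c%:MP = c%:MP.
Proof. by rewrite /hsub /= mmapC. Qed.

Definition fdiff (i : 'I_d) : B := in_Y n K (f i) - (f i)%:MP.

Lemma hsub_congr p : in_ideal fdiff (in_Y n K (hsub p) - (hsub p)%:MP).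
Proof.
pose g1 : {rmorphism P0 -> B} := in_Y n K \o hsub.
pose g2 : {rmorphism P0 -> B} := @mpolyC n A \o hsub.
apply: (mpoly_rmorph_congr (f := g1) (g := g2)) => [c|i] /=.
  by rewrite hsubC in_YC subrr; apply: ideal0.
by rewrite hsubX; apply: ideal_gen.
Qed.

(** Renaming x to Y in the equation gives W(f(Y))(Y_j) = 0, and W(f(x))(Y_j) differs from this by
    multiples of the f_i(Y) - f_i(x). *)
Lemma integral_in_ideal (W : {poly P0}) j :
  root (map_poly hsub W) 'X_j -> in_ideal fdiff (in_var j (map_poly hsub W)).
Proof.
move=> /rootP W0.
have e : \sum_(i < size W) in_Y n K (hsub W`_i) * 'X_j ^+ i = 0.
  have := congr1 (in_Y n K) W0; rewrite (rmorph0 (in_Y n K)).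
  rewrite (@horner_coef_wide _ (size W)) ?size_poly // (rmorph_sum (in_Y n K)) => W1.
  rewrite -[RHS]W1; apply: eq_bigr => i _.
  by rewrite coef_map in_YM (rmorphXn (in_Y n K)) in_YX.
rewrite (@in_var_wide _ _ _ _ (size W)) ?size_poly //.
rewrite -[X in in_ideal _ X](subr0) -[X in _ - X]e.
rewrite -sumrB; apply: ideal_sum => i _.
rewrite coef_map -mul_mpolyC -mulrBl; apply: idealMr.
by rewrite -opprB; apply/idealN/hsub_congr.
Qed.
End SystemOfParameters.

(** * Existence of the Bezoutian of a system of parameters *)

Section BezoutianExists.
Variables (K : fieldType) (n d : nat) (f : 'I_d -> {mpoly K[n]}) (e : 'I_d -> nat).
Local Notation A := {mpoly K[n]}.
Local Notation B := {mpoly A[n]}.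
Hypothesis f_homog : forall i, ihomog (e i)%:Z (f i).
Hypothesis f_integral : forall j : 'I_n, integralOver (hsub f) 'X_j.
Hypothesis f_indep : forall p, hsub f p = 0 -> p = 0.

Lemma fdiff_matrix : exists b : 'I_d -> 'I_n -> B,
  (forall i j, tot ((e i)%:Z - 1) (b i j)) /\
  forall i, fdiff f i = \sum_j b i j * zdiff K j.
Proof.
have H i : exists b : 'I_n -> B, (forall j, tot ((e i)%:Z - 1) (b j)) /\
    fdiff f i = \sum_j b j * zdiff K j.
  by have [_ [b hb eb]] := diffquot_homog (@f_homog i); exists b.
have [b hb] := choice H.
by exists b; split=> i; have [] := hb i.
Qed.

Lemma integral_polys : exists W : 'I_n -> {poly A},
  [/\ forall j, W j \is monic, forall j, root (W j) 'X_j
    & forall j, in_ideal (fdiff f) (in_var j (W j))].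
Proof.
have H (j : 'I_n) : exists W : {poly {mpoly K[d]}},
    W \is monic /\ root (map_poly (hsub f) W) 'X_j.
  by have [W Wm W0] := f_integral j; exists W.
have [W hW] := choice H; exists (fun j => map_poly (hsub f) (W j)).
split=> j; have [Wm W0] := hW j => //; first exact: monic_map.
exact: integral_in_ideal.
Qed.

(** Independence gives d <= n. If d < n, pad the f_i(Y) - f_i(x) with zeros to n elements: their
    difference matrix has a zero row, so its determinant is 0, and nondegeneracy at s = 1 yields 1 =
    0. *)
Lemma hsop_size_eq : d = n.
Proof.
apply/eqP; rewrite eqn_leq (@indep_leq _ _ _ f f_indep) /=.
rewrite leqNgt; apply/negP => dn.
have [b [_ eb]] := fdiff_matrix.
have [W [Wm W0 WF]] := integral_polys.
pose F' (i : 'I_n) : B := if insub (val i) is Some i' then fdiff f i' else 0.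
pose b' : 'M[B]_n :=
  \matrix_(i, j) if insub (val i) is Some i' then b i' j else 0.
have Fb i : F' i = \sum_j b' i j * zdiff K j.
  rewrite /F'; under eq_bigr do rewrite mxE.
  case: (insub _) => [i'|]; first exact: eb.
  by rewrite big1 // => j _; rewrite mul0r.
have WF' j : in_ideal F' (in_var j (W j)).
  apply: ideal_sub (WF j) => i.
  have -> : fdiff f i = F' (widen_ord (ltnW dn) i) by rewrite /F' /= valK.
  exact: ideal_gen.
have det0 : \det b' = 0.
  rewrite (expand_det_row _ (Ordinal dn)) big1 // => j _.
  by rewrite mxE /= insubF ?ltnn // mul0r.
have := bezoutian_nondegenerate Fb Wm W0 WF' (s := 1).
by rewrite det0 mulr0 => /(_ (ideal0 _))/eqP; rewrite oner_eq0.
Qed.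
End BezoutianExists.

Theorem bezoutian_exists (K : fieldType) n d (f : 'I_d -> {mpoly K[n]}) (e : 'I_d -> nat) :
    (forall i, ihomog (e i)%:Z (f i)) ->
    (forall j : 'I_n, integralOver (hsub f) 'X_j) ->
    (forall p, hsub f p = 0 -> p = 0) ->
  exists Del : {mpoly {mpoly K[n]}[n]},
  [/\ tot (\sum_i (e i)%:Z - n%:Z) Del,
      forall p, in_ideal (fdiff f) ((in_Y n K p - p%:MP) * Del),
      forall s, in_ideal (fdiff f) (s%:MP * Del) -> s = 0
    & forall (g : {rmorphism {mpoly {mpoly K[n]}[n]} -> {mpoly {mpoly K[n]}[n]}})
        (N : 'M[K]_n),
      (forall i, g (fdiff f i) = fdiff f i) ->
      (forall j, g (zdiff K j) = \sum_l ((N j l)%:MP)%:MP * zdiff K l) ->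
      in_ideal (fdiff f) (Del - ((\det N)%:MP)%:MP * g Del)].
Proof.
move=> f_homog f_integral f_indep.
have ed := hsop_size_eq f_homog f_integral f_indep; subst d.
have [b0 [hb eb]] := fdiff_matrix f_homog.
have [W [Wm W0 WF]] := integral_polys f_integral.
pose b : 'M_n := \matrix_(i, j) b0 i j.
have Fb i : fdiff f i = \sum_j b i j * zdiff K j.
  by rewrite eb; apply: eq_bigr => j _; rewrite mxE.
exists (\det b); split.
- have -> : \sum_i (e i)%:Z - n%:Z = \sum_(i < n) ((e i)%:Z - 1).
    by rewrite sumrB sumr_const card_ord -natz.
  by apply: tot_det => i j; rewrite mxE.
- exact: bezoutian_slide.
- by move=> s; apply: (bezoutian_nondegenerate Fb Wm W0 WF).
move=> g N gF gz.
(* As g fixes F and transforms the differences by N, the matrix g(b) N is a second difference matrix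
   for F; its determinant is det N g(Delta). *)
pose cc : {rmorphism K -> {mpoly {mpoly K[n]}[n]}} := @mpolyC n _ \o @mpolyC n K.
rewrite -[_%:MP]/(cc (\det N)) -det_map_mx -det_map_mx mulrC -det_mulmx.
apply: bezoutian_unique => // i; rewrite -gF Fb rmorph_sum.
under eq_bigr do rewrite rmorphM gz mulr_sumr.
rewrite exchange_big; apply: eq_bigr => l _; rewrite mxE mulr_suml.
by apply: eq_bigr => j _; rewrite !mxE mulrA.
Qed.

#[global] Opaque hsub.

(** * Finite extensions of domains *)

Section FiniteExtension.
Variables (P A : idomainType) (iota : {rmorphism P -> A}).

(** Since t is nonzero, a monic equation can be divided by t until its constant term c_0 is nonzero.
    Then q = r T + c_0 gives t (- r(t)) = c_0. *)
Lemma integral_norm (t : A) : integralOver iota t -> t != 0 ->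
  exists (t' : A) (p : P), p != 0 /\ t * t' = iota p.
Proof.
case=> q qm q0 t0; have [N] := ubnP (size q); elim: N q qm q0 => // N IH q qm q0 qN.
have [c0|c0] := eqVneq q`_0 0; last first.
  have /factor_theorem[r er] : root (q - (q`_0)%:P) 0.
    by apply/rootP; rewrite hornerD hornerN hornerC horner_coef0 subrr.
  exists (- (map_poly iota r).[t]), q`_0; split=> //.
  have /rootP := q0; rewrite -[q in map_poly _ q](subrK (q`_0)%:P) er.
  rewrite subr0 rmorphD rmorphM /= map_polyX map_polyC hornerD hornerMX hornerC.
  by move/eqP; rewrite addr_eq0 mulrN mulrC => /eqP->; rewrite opprK.
have /factor_theorem[r er] : root q 0 by apply/rootP; rewrite horner_coef0.
rewrite subr0 in er; apply: (IH r).
- by move: qm; rewrite er monicMr ?monicX.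
- have := q0; rewrite er rmorphM /= map_polyX rootM.
  by rewrite /root hornerX (negbTE t0) orbF.
have rn0 : r != 0.
  by apply/eqP => r0; move: qm; rewrite er r0 mul0r monicE lead_coef0 eq_sym oner_eq0.
by move: qN; rewrite er size_mulX.
Qed.

Variables (N : nat) (g : 'I_N -> A).
Hypothesis g_span : forall v, exists c : 'I_N -> P, v = \sum_i iota (c i) * g i.

Lemma fraction_basis : exists (r : nat) (be : 'I_r -> A) (s0 : P),
  [/\ s0 != 0,
      forall c : 'I_r -> P, \sum_i iota (c i) * be i = 0 -> forall i, c i = 0
    & forall v, exists c : 'I_r -> P, iota s0 * v = \sum_i iota (c i) * be i].
Proof.
pose ind (S : {set 'I_N}) := forall c : 'I_N -> P,
  \sum_(i in S) iota (c i) * g i = 0 -> forall i, i \in S -> c i = 0.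
have ind0 : `[< ind set0 >] by apply/asboolP => c _ i; rewrite inE.
case: (@arg_maxnP _ set0 (fun S => `[< ind S >]) (fun S => #|S|) ind0) => S /asboolP indS maxS.
pose low v := exists c : 'I_N -> P, v = \sum_(i in S) iota (c i) * g i.
have lowD u v : low u -> low v -> low (u + v).
  move=> [a ->] [b ->]; exists (fun i => a i + b i).
  by rewrite -big_split; apply: eq_bigr => i _; rewrite rmorphD mulrDl.
have lowZ p v : low v -> low (iota p * v).
  move=> [a ->]; exists (fun i => p * a i).
  by rewrite mulr_sumr; apply: eq_bigr => i _; rewrite rmorphM mulrA.
have H l : exists p, p != 0 /\ low (iota p * g l).
  have [lS|lS] := boolP (l \in S).
    exists 1; split; first exact: oner_neq0.
    exists (fun i => (i == l)%:R); rewrite (bigD1 l) //= eqxx big1 ?addr0 // => i.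
    by move=> /andP[_ /negbTE->]; rewrite rmorph0 mul0r.
  have : ~ ind (l |: S).
    move=> /asboolP/maxS; by rewrite /= cardsU1 lS add1n /= ltnn.
  move=> /existsNP[c /not_implyP[c0 /existsNP[i /not_implyP[iS /eqP ci]]]].
  move: c0; rewrite big_setU1 //= => c0.
  exists (c l); split; last first.
    exists (fun i => - c i); under eq_bigr do rewrite rmorphN mulNr.
    by rewrite sumrN; apply/eqP; rewrite -addr_eq0 c0.
  apply: contra ci => /eqP cl0; move: c0; rewrite cl0 rmorph0 mul0r add0r => /indS c0.
  by move: iS; rewrite !inE => /predU1P[->|/c0->]; rewrite ?cl0.
have [p Hp] := choice H.
exists #|S|, (fun a => g (enum_val a)), (\prod_l p l); split.
- by apply/prodf_neq0 => l _; case: (Hp l).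
- move=> c c0 a.
  pose c' i := if @idP (i \in S) is ReflectT iS then c (enum_rank_in iS i) else 0.
  have c'E b : c' (enum_val b) = c b.
    rewrite /c'; case: {-}_ / idP => [bS|]; first by rewrite enum_valK_in.
    by case; apply: enum_valP.
  rewrite -c'E; apply: indS (enum_valP a).
  by rewrite big_enum_val -[RHS]c0; apply: eq_bigr => b _; rewrite c'E.
move=> v; have [c ->] := g_span v.
suff [a ->] : low (iota (\prod_l p l) * \sum_i iota (c i) * g i).
  by exists (a \o enum_val); rewrite big_enum_val.
rewrite mulr_sumr; apply: (big_ind low) => [||i _].
- by exists (fun=> 0); rewrite big1 // => i _; rewrite rmorph0 mul0r.
- exact: lowD.
have [_ li] := Hp i.
have -> : iota (\prod_l p l) * (iota (c i) * g i) =
    iota (c i * \prod_(l | l != i) p l) * (iota (p i) * g i).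
  rewrite (bigD1 i) //= !rmorphM [iota (p i) * iota _]mulrC mulrACA.
  by rewrite [iota (c i) * iota _]mulrC.
exact: lowZ.
Qed.

(** A null vector of the Gram matrix is a nonzero tau with eta (tau v) = 0 for all v. Some multiple
    of tau is a nonzero p of P, so p eta = 0. *)
Lemma form_det_nonzero (r : nat) (be : 'I_r -> A) (s0 : P) (eta : A -> P) :
    (forall c : 'I_r -> P, \sum_i iota (c i) * be i = 0 -> forall i, c i = 0) ->
    s0 != 0 ->
    (forall v, exists c : 'I_r -> P, iota s0 * v = \sum_i iota (c i) * be i) ->
    (forall u v, eta (u + v) = eta u + eta v) ->
    (forall p v, eta (iota p * v) = p * eta v) ->
    (forall t, t != 0 -> exists (t' : A) (p : P), p != 0 /\ t * t' = iota p) ->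
  \det (\matrix_(l, i) eta (be l * be i)) = 0 -> forall v, eta v = 0.
Proof.
move=> ind s0n span etaD etaZ norm /eqP/det0P[u u0 uE].
have eta0 : eta 0 = 0 by have := etaZ 0 0; rewrite mulr0 mul0r.
have eta_sum (I : Type) (s : seq I) (w : I -> A) :
    eta (\sum_(i <- s) w i) = \sum_(i <- s) eta (w i) by exact: (big_morph _ etaD eta0).
pose tau := \sum_l iota (u 0 l) * be l.
have tau0 : tau != 0.
  apply: contra u0 => /eqP /(ind (u 0)) u0.
  by apply/eqP/rowP => l; rewrite u0 mxE.
have etau v : eta (tau * v) = 0.
  suff: s0 * eta (tau * v) = 0.
    by move/eqP; rewrite mulf_eq0 (negbTE s0n) => /eqP.
  have [c ec] := span v.
  rewrite -etaZ mulrCA ec mulr_sumr eta_sum big1 // => i _.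
  rewrite mulrCA etaZ /tau mulr_suml eta_sum.
  have /rowP/(_ i) := uE; rewrite !mxE => uE_i.
  rewrite [X in _ * X](_ : _ = 0) ?mulr0 // -[RHS]uE_i.
  by apply: eq_bigr => l _; rewrite -mulrA etaZ mxE.
have [tau' [p [p0 ep]]] := norm tau tau0.
move=> v; have := etau (tau' * v); rewrite mulrA ep etaZ => /eqP.
by rewrite mulf_eq0 (negbTE p0) => /eqP.
Qed.
End FiniteExtension.

(** * The polynomial ring is finite over the parameters *)

Section FiniteOverParameters.
Variables (K : fieldType) (n d : nat) (f : 'I_d -> {mpoly K[n]}).
Local Notation A := {mpoly K[n]}.
Local Notation P0 := {mpoly K[d]}.
Hypothesis f_integral : forall j : 'I_n, integralOver (hsub f) 'X_j.

Lemma mpoly_integral (v : A) : integralOver (hsub f) v.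
Proof.
rewrite (mpolyE v); elim/big_ind: _ => [||m _].
- exact: integral0.
- exact: integral_add.
rewrite -mul_mpolyC; apply: integral_mul; first by rewrite -(hsubC f); apply: integral_id.
rewrite mpolyXE_id; elim/big_ind: _ => [||i _].
- exact: integral1.
- exact: integral_mul.
elim: (m i) => [|t IH]; first exact: integral1.
by rewrite exprS; apply: integral_mul.
Qed.

Lemma mpoly_finite : exists (N : nat) (g : 'I_N -> A),
  forall v, exists c : 'I_N -> P0, v = \sum_i hsub f (c i) * g i.
Proof.
have [W hW] := choice (fun j => let: ex_intro2 W Wm W0 := f_integral j in
  ex_intro (fun W => W \is monic /\ root (map_poly (hsub f) W) 'X_j) W (conj Wm W0)).
pose N := (\max_j size (W j)).+1.
pose Q := {ffun 'I_n -> 'I_N}.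
pose mQ (q : Q) : 'X_{1..n} := [multinom nat_of_ord (q i) | i < n].
exists #|Q|, (fun a => 'X_[mQ (enum_val a)]) => v.
pose sp u := exists c : 'I_#|Q| -> P0, u = \sum_a hsub f (c a) * 'X_[mQ (enum_val a)].
rewrite -/(sp v).
have sp0 : sp 0.
  by exists (fun=> 0); rewrite big1 // => i _; rewrite rmorph0 mul0r.
have spD u w : sp u -> sp w -> sp (u + w).
  move=> [a ->] [b ->]; exists (fun i => a i + b i).
  by rewrite -big_split; apply: eq_bigr => i _; rewrite rmorphD mulrDl.
have spZ p u : sp u -> sp (hsub f p * u).
  move=> [a ->]; exists (fun i => p * a i).
  by rewrite mulr_sumr; apply: eq_bigr => i _; rewrite rmorphM mulrA.
have spQ q : sp 'X_[mQ q].
  exists (fun a => (a == enum_rank q)%:R).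
  rewrite (bigD1 (enum_rank q)) //= eqxx rmorph1 mul1r enum_rankK big1 ?addr0 //.
  by move=> a /negbTE->; rewrite rmorph0 mul0r.
have powN j : exists c : 'I_N -> P0, 'X_j ^+ N = \sum_(t < N) hsub f (c t) * 'X_j ^+ t :> A.
  have [Wm /rootP W0] := hW j.
  have WN : (size (W j) <= N)%N by rewrite leqW // (leq_bigmax j).
  have W1 : (0 < size (W j))%N by rewrite lt0n size_poly_eq0 monic_neq0.
  (* The power of T makes the equation monic of degree exactly N, so that one bound serves all
     variables. *)
  pose V := 'X^(N.+1 - size (W j)) * W j.
  have Vm : V \is monic by rewrite monicMr ?monicXn.
  have sV : size V = N.+1.
    rewrite size_monicM ?monicXn ?monic_neq0 // size_polyXn addSn /=.
    by rewrite subnK // leqW.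
  have : (map_poly (hsub f) V).['X_j] = 0.
    by rewrite /V rmorphM hornerM /= W0 mulr0.
  rewrite (@horner_coef_wide _ N.+1); last by rewrite -sV size_poly.
  rewrite big_ord_recr /= (coef_map_id0 _ _ (rmorph0 (hsub f))).
  have -> : V`_N = 1 by have := eqP Vm; rewrite /lead_coef sV.
  rewrite (rmorph1 (hsub f)) mul1r => /eqP; rewrite addrC addr_eq0 => /eqP->.
  exists (fun t => - V`_t); rewrite -sumrN; apply: eq_bigr => t _.
  by rewrite (coef_map_id0 _ _ (rmorph0 (hsub f))) rmorphN mulNr.
have spX j u : sp u -> sp ('X_j * u).
  move=> [c ->]; rewrite mulr_sumr; apply: (big_ind sp) => // a _.
  rewrite mulrCA; apply: (spZ); move: (enum_val a) => q {c a}.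
  pose upd t : Q := [ffun i => if i == j then t else q i].
  pose rest : A := \prod_(i | i != j) 'X_i ^+ q i.
  have eX (t : 'I_N) : 'X_[mQ (upd t)] = 'X_j ^+ t * rest.
    rewrite mpolyXE_id (bigD1 j) //= mnmE ffunE eqxx; congr (_ * _).
    by apply: eq_bigr => i /negbTE ij; rewrite mnmE ffunE ij.
  have eq : 'X_[mQ q] = 'X_j ^+ q j * rest.
    by rewrite mpolyXE_id (bigD1 j) //= mnmE; congr (_ * _); apply: eq_bigr => i _; rewrite mnmE.
  rewrite eq mulrA -exprS; have [qN|] := ltnP (q j).+1 N.
    by rewrite -(eX (Ordinal qN)).
  rewrite leq_eqVlt ltnNge ltn_ord orbF => /eqP eN; rewrite -eN.
  have [c ->] := powN j; rewrite mulr_suml; apply: (big_ind sp) => // t _.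
  by rewrite -mulrA -eX; apply: spZ.
rewrite (mpolyE v); apply: (big_ind sp) => // m _.
rewrite -mul_mpolyC -(hsubC f); apply: spZ.
rewrite mpolyXE_id -[X in sp X]mulr1.
have sp1 : sp 1.
  have N0 : (0 < N)%N by [].
  rewrite -(mpolyX0 n K); have -> : 0%MM = mQ ([ffun=> Ordinal N0] : Q); last exact: spQ.
  by apply/mnmP => i; rewrite mnm0E /mQ mnmE ffunE.
elim: (index_enum _) => [|j s IH]; first by rewrite big_nil mulr1.
rewrite big_cons -mulrA; elim: (m j) => [|t IHt]; first by rewrite mul1r.
by rewrite exprS -mulrA; apply: spX.
Qed.
End FiniteOverParameters.

(** * Contracting the Bezoutian with a functional *)

Section Contraction.
Variables (K : fieldType) (n d : nat) (f : 'I_d -> {mpoly K[n]}).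
Local Notation A := {mpoly K[n]}.
Local Notation B := {mpoly A[n]}.
Local Notation P0 := {mpoly K[d]}.
Local Notation iota := (hsub f).

Definition param_linear (eta : A -> P0) : Prop :=
  (forall u v, eta (u + v) = eta u + eta v) /\
  (forall p v, eta (iota p * v) = p * eta v).

Section OneFunctional.
Variable eta : A -> P0.
Hypothesis etaP : param_linear eta.

Lemma param_linearC c v : eta (c%:MP * v) = c%:MP * eta v.
Proof. by rewrite -{1}(hsubC f) etaP.2. Qed.

Lemma param_linear_sum (I : Type) (s : seq I) (P : pred I) (u : I -> A) :
  eta (\sum_(i <- s | P i) u i) = \sum_(i <- s | P i) eta (u i).
Proof.
apply: (big_morph _ etaP.1).
by have := etaP.2 0 0; rewrite mulr0 mul0r.
Qed.

(* The map (eta (x) 1) on polynomials in Y with coefficients in A. *)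
Definition contract (p : B) : A := mext (fun m a => iota (eta a) * 'X_[m]) p.

Lemma contract_coefD m : {morph (fun a => iota (eta a) * 'X_[m]) : a b / a + b : A}.
Proof. by move=> a b; rewrite etaP.1 rmorphD mulrDl. Qed.

Lemma contractB : {morph contract : p q / p - q}.
Proof. exact: mextB contract_coefD. Qed.

Lemma contract_sum (I : Type) (s : seq I) (P : pred I) (u : I -> B) :
  contract (\sum_(i <- s | P i) u i) = \sum_(i <- s | P i) contract (u i).
Proof. by apply: mext_sum; apply: contract_coefD. Qed.

Lemma contract_mon a m : contract (a *: 'X_[m]) = iota (eta a) * 'X_[m].
Proof. by rewrite /contract mext_mon //; apply: contract_coefD. Qed.

Lemma contract_in_Y p q : contract (in_Y n K p * q) = p * contract q.
Proof.
rewrite (mpolyE q) mulr_sumr !contract_sum mulr_sumr; apply: eq_bigr => m _.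
rewrite contract_mon [X in in_Y n K X](mpolyE p) (rmorph_sum (in_Y n K)) mulr_suml contract_sum.
rewrite [X in _ = X * _](mpolyE p) mulr_suml; apply: eq_bigr => l _.
have -> : in_Y n K (p@_l *: 'X_[l]) = (p@_l)%:MP *: 'X_[l].
  rewrite -mul_mpolyC in_YM in_YC mul_mpolyC; congr (_ *: _).
  rewrite mpolyXE_id [RHS]mpolyXE_id (rmorph_prod (in_Y n K)).
  by apply: eq_bigr => i _; rewrite (rmorphXn (in_Y n K)) in_YX.
rewrite -scalerAl -scalerAr -mpolyXD scalerA contract_mon param_linearC.
by rewrite rmorphM hsubC mpolyXD -mul_mpolyC mulrACA.
Qed.

Lemma contract_param p q : contract ((iota p)%:MP * q) = iota p * contract q.
Proof.
rewrite (mpolyE q) mulr_sumr !contract_sum mulr_sumr; apply: eq_bigr => m _.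
by rewrite mul_mpolyC scalerA !contract_mon etaP.2 rmorphM mulrA.
Qed.

(** f_i(Y) comes out by linearity in Y and f_i(x) by linearity of eta over P, both as f_i.
    Contraction thus descends to the tensor square of S over P. *)
Lemma contract_ideal p : in_ideal (fdiff f) p -> contract p = 0.
Proof.
case=> c ->; rewrite contract_sum big1 // => i _.
rewrite mulrC /fdiff mulrBl contractB contract_in_Y.
by rewrite -(hsubX f) contract_param subrr.
Qed.
End OneFunctional.

Lemma param_linear_scale eta s : param_linear eta ->
  param_linear (fun v => eta (s * v)).
Proof.
case=> etaD etaZ; split=> [u v|p v]; first by rewrite mulrDr etaD.
by rewrite mulrCA etaZ.
Qed.

Lemma contract_scale eta (etaP : param_linear eta) s p :
  contract (fun v => eta (s * v)) p = contract eta (s%:MP * p).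
Proof.
have etasP := param_linear_scale s etaP.
rewrite (mpolyE p) (contract_sum etasP) mulr_sumr (contract_sum etaP).
apply: eq_bigr => m _.
by rewrite (contract_mon etasP) mul_mpolyC scalerA (contract_mon etaP).
Qed.

Hypothesis f_integral : forall j : 'I_n, integralOver iota 'X_j.
Hypothesis f_indep : forall p, iota p = 0 -> p = 0.
Variable Del : B.
Hypothesis Del_slide : forall p, in_ideal (fdiff f) ((in_Y n K p - p%:MP) * Del).
Hypothesis Del_nondeg : forall s : A, in_ideal (fdiff f) (s%:MP * Del) -> s = 0.

(** eta sees s as s(x); sliding across Delta turns it into s(Y), over which contraction is
    linear. *)
Lemma contract_bezoutianZ eta (etaP : param_linear eta) s :
  contract (fun v => eta (s * v)) Del = s * contract eta Del.
Proof.
rewrite contract_scale // -(contract_in_Y etaP); apply/eqP; rewrite eq_sym -subr_eq0.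
by rewrite -contractB // -mulrBl (contract_ideal etaP (Del_slide s)).
Qed.

(* If eta is nonzero, the form eta (be_l * be_i) is nondegenerate; as it kills the
   coordinates D_i of Del, Del itself would vanish. *)
Lemma contract_nondegenerate eta (etaP : param_linear eta) :
  contract eta Del = 0 -> forall v, eta v = 0.
Proof.
move=> eta0.
have [N [g g_span]] := mpoly_finite f_integral.
have [r [be [s0 [s0n ind span]]]] := fraction_basis g_span.
have [cf cfP] := choice span.
have is0 : iota s0 != 0 by apply: contra s0n => /eqP/f_indep->.
(* Modulo the f_i(Y) - f_i(x), s0 Del = sum_i be_i(x) D_i(Y): the x-coefficients of s0 Del are
   expanded in the basis [be] and their coordinates, which lie in P, are moved to Y. *)
pose D i : A := \sum_(m <- msupp Del) iota (cf Del@_m i) * 'X_[m].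
have DE et (etP : param_linear et) :
    iota s0 * contract et Del = \sum_i iota (et (be i)) * D i.
  rewrite {1}(mpolyE Del) (contract_sum etP) mulr_sumr.
  under [RHS]eq_bigr do rewrite mulr_sumr.
  rewrite exchange_big; apply: eq_bigr => m _ /=.
  rewrite (contract_mon etP) mulrA -(rmorphM iota) -etP.2 cfP (param_linear_sum etP).
  rewrite rmorph_sum mulr_suml; apply: eq_bigr => i _.
  by rewrite etP.2 rmorphM mulrA [iota (et _) * _]mulrC.
have D_nonzero : ~ (forall i, D i = 0).
  move=> D0; case/eqP: is0; apply: Del_nondeg.
  have -> : (iota s0)%:MP * Del =
      (iota s0)%:MP * Del - \sum_i (be i)%:MP * in_Y n K (D i).
    by rewrite big1 ?subr0 // => i _; rewrite D0 (rmorph0 (in_Y n K)) mulr0.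
  have {1}-> : Del = \sum_(m <- msupp Del) Del@_m *: 'X_[m] by exact: mpolyE.
  rewrite mulr_sumr.
  have -> : \sum_i (be i)%:MP * in_Y n K (D i) = \sum_(m <- msupp Del)
      \sum_i (be i)%:MP * (in_Y n K (iota (cf Del@_m i)) * 'X_[m]).
    rewrite exchange_big; apply: eq_bigr => i _ /=.
    rewrite (rmorph_sum (in_Y n K)) mulr_sumr; apply: eq_bigr => m _.
    rewrite in_YM; congr (_ * (_ * _)).
    rewrite mpolyXE_id [RHS]mpolyXE_id (rmorph_prod (in_Y n K)).
    by apply: eq_bigr => j _; rewrite (rmorphXn (in_Y n K)) in_YX.
  rewrite -sumrB; apply: ideal_sum => m _.
  rewrite mul_mpolyC scalerA cfP -mul_mpolyC (raddf_sum (@mpolyC n A)) mulr_suml.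
  rewrite -sumrB; apply: ideal_sum => i _.
  rewrite /= mpolyCM [_%:MP * _%:MP]mulrC -mulrA -mulrBr; apply: idealM.
  rewrite -mulrBl; apply: idealMr; rewrite -opprB; exact/idealN/hsub_congr.
(* Contracting with eta(be_l v) gives be_l times 0, so E kills the vector D; as D is nonzero, det E
   = 0. *)
pose E : 'M[P0]_r := \matrix_(l, i) eta (be l * be i).
have ED l : \sum_i iota (E l i) * D i = 0.
  under eq_bigr do rewrite mxE.
  rewrite -(DE _ (param_linear_scale (be l) etaP)).
  by rewrite (contract_bezoutianZ etaP) eta0 !mulr0.
have detE : \det E = 0.
  apply/eqP/negP => /negP detE; apply: D_nonzero => i.
  have := cramer_ideal (map_mx iota E) D i; case=> c.
  rewrite big1 => [/eqP|l _].
    rewrite mulf_eq0 det_map_mx => /orP[/eqP/f_indep dE|/eqP-> //].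
    by case/eqP: detE; exact: dE.
  under eq_bigr do rewrite mxE.
  by rewrite ED mulr0.
apply: (form_det_nonzero ind s0n span etaP.1 etaP.2 _ detE) => t.
exact/integral_norm/mpoly_integral.
Qed.
End Contraction.

(** * Semi-invariants of abelian groups *)

Section GroupAlgebraPairs.
Variables (K : fieldType) (gT : finGroupType).

Definition is_rep m (B : gT -> 'M[K]_m) : Prop :=
  B 1%g = 1%:M /\ forall g h, B (g * h)%g = B g *m B h.

Definition ract m (B : gT -> 'M[K]_m) (c : gT -> K) : 'M[K]_m := \sum_g c g *: B g.

(* The image of the group algebra in the product of two matrix algebras. *)
Definition ralg m n (B : gT -> 'M[K]_m) (A : gT -> 'M[K]_n) X Y : Prop :=
  exists c, X = ract B c /\ Y = ract A c.

Lemma ract_delta m (B : gT -> 'M[K]_m) g : ract B (fun h => (h == g)%:R) = B g.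
Proof.
rewrite /ract (bigD1 g) //= eqxx scale1r big1 ?addr0 // => h /negbTE->.
by rewrite scale0r.
Qed.

Lemma ractM m (B : gT -> 'M[K]_m) a c : is_rep B ->
  ract B (fun g => \sum_h a h * c (h^-1 * g)%g) = ract B a *m ract B c.
Proof.
move=> [_ BM]; rewrite /ract mulmx_suml.
under [RHS]eq_bigr do rewrite mulmx_sumr.
under [LHS]eq_bigr do rewrite scaler_suml.
rewrite exchange_big; apply: eq_bigr => h _ /=.
rewrite (reindex (mulg h)) /=; last by exists (mulg h^-1) => l _; rewrite ?mulKg ?mulKVg.
by apply: eq_bigr => l _; rewrite mulKg BM -scalemxAl -scalemxAr scalerA.
Qed.

Section Pairs.
Variables (m n : nat) (B : gT -> 'M[K]_m) (A : gT -> 'M[K]_n).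
Hypotheses (Brep : is_rep B) (Arep : is_rep A).
Local Notation ralg := (ralg B A).

Lemma ralg_gen g : ralg (B g) (A g).
Proof. by exists (fun h => (h == g)%:R); rewrite !ract_delta. Qed.

Lemma ralg1 : ralg 1%:M 1%:M.
Proof. by rewrite -Brep.1 -Arep.1; apply: ralg_gen. Qed.

Lemma ralgD X Y X' Y' : ralg X Y -> ralg X' Y' -> ralg (X + X') (Y + Y').
Proof.
move=> [c [-> ->]] [c' [-> ->]]; exists (fun g => c g + c' g).
by rewrite /ract -!big_split; split; apply: eq_bigr => g _; rewrite scalerDl.
Qed.

Lemma ralgZ a X Y : ralg X Y -> ralg (a *: X) (a *: Y).
Proof.
move=> [c [-> ->]]; exists (fun g => a * c g).
by rewrite /ract !scaler_sumr; split; apply: eq_bigr => g _; rewrite scalerA.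
Qed.

Lemma ralgB X Y X' Y' : ralg X Y -> ralg X' Y' -> ralg (X - X') (Y - Y').
Proof. by move=> H H'; rewrite -!scaleN1r; apply: ralgD => //; apply: ralgZ. Qed.

Lemma ralgM X Y X' Y' : ralg X Y -> ralg X' Y' -> ralg (X *m X') (Y *m Y').
Proof.
move=> [c [-> ->]] [c' [-> ->]]; eexists; by rewrite -!ractM.
Qed.

Lemma ralg_sum (I : finType) (t : I -> K) X Y :
  (forall i, ralg (X i) (Y i)) -> ralg (\sum_i t i *: X i) (\sum_i t i *: Y i).
Proof.
move=> XY; apply: (big_ind2 ralg) => [||i _]; last exact: ralgZ.
  by exists (fun=> 0); rewrite /ract !big1 // => g _; rewrite scale0r.
by move=> *; apply: ralgD.
Qed.

Hypothesis abelian_gT : forall g h : gT, (g * h = h * g)%g.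

Lemma ract_comm p (C : gT -> 'M[K]_p) a c : is_rep C ->
  ract C a *m ract C c = ract C c *m ract C a.
Proof.
move=> Crep; rewrite /ract mulmx_suml mulmx_sumr; apply: eq_bigr => g _.
rewrite mulmx_suml mulmx_sumr; apply: eq_bigr => h _.
by rewrite -!scalemxAl -!scalemxAr -!Crep.2 abelian_gT !scalerA mulrC.
Qed.

Lemma ralg_comm X Y X' Y' : ralg X Y -> ralg X' Y' ->
  X *m X' = X' *m X /\ Y *m Y' = Y' *m Y.
Proof. by move=> [c [-> ->]] [c' [-> ->]]; rewrite !(ract_comm _ c). Qed.
End Pairs.

(** The cyclic submodule generated by the row vector u. *)
Definition rgen n (A : gT -> 'M[K]_n) (u : 'rV_n) : 'M[K]_n := (\sum_g <<u *m A g>>)%MS.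

Lemma rgenP n (A : gT -> 'M[K]_n) (u v : 'rV_n) :
  reflect (exists c, v = u *m ract A c) (v <= rgen A u)%MS.
Proof.
apply: (iffP idP) => [|[c ->]].
  case/sub_sumsmxP => w ->.
  have /choice[c hc] g : exists a, w g *m <<u *m A g>>%MS = a *: (u *m A g).
    have : (w g *m <<u *m A g>> <= u *m A g)%MS by rewrite (submx_trans (submxMl _ _)) ?genmxE.
    by case/sub_rVP => a ->; exists a.
  exists c; rewrite mulmx_sumr; apply: eq_bigr => g _.
  by rewrite hc scalemxAr.
rewrite mulmx_sumr; apply: summx_sub => g _; rewrite -scalemxAr; apply: scalemx_sub.
by apply: (sumsmx_sup g) => //; rewrite genmxE.
Qed.

Lemma rgen_sub n (A : gT -> 'M[K]_n) (u v : 'rV_n) : is_rep A ->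
  (v <= rgen A u)%MS -> (rgen A v <= rgen A u)%MS.
Proof.
move=> Arep /rgenP[c ->]; apply/sumsmx_subP => g _; rewrite genmxE.
by rewrite -(ract_delta A g) -mulmxA -ractM //; apply/rgenP; eexists.
Qed.

Lemma rgen_id n (A : gT -> 'M[K]_n) (u : 'rV_n) : is_rep A -> (u <= rgen A u)%MS.
Proof.
move=> Arep; apply/rgenP; exists (fun h => (h == 1%g)%:R).
by rewrite ract_delta Arep.1 mulmx1.
Qed.
End GroupAlgebraPairs.

(** * Semi-invariant forms with the determinant character *)

Section SemiInvariants.
Variables (K : fieldType) (gT : finGroupType) (n : nat).
Local Notation A := {mpoly K[n]}.
Hypothesis abelian_gT : forall g h : gT, (g * h = h * g)%g.

Definition linform (v : 'rV[K]_n) : A := \sum_i v 0 i *: 'X_i.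

Lemma linform_sum (I : finType) (t : I -> K) (v : I -> 'rV[K]_n) :
  linform (\sum_i t i *: v i) = \sum_i t i *: linform (v i).
Proof.
rewrite /linform; under [RHS]eq_bigr do rewrite scaler_sumr.
rewrite exchange_big; apply: eq_bigr => j _; rewrite summxE scaler_suml.
by apply: eq_bigr => i _; rewrite mxE scalerA.
Qed.

Lemma linform_homog v : linform v \is 1.-homog.
Proof. apply: rpred_sum => i _; rewrite rpredZ // dhomogX; exact/eqP/mdeg1. Qed.

Lemma linform_eval p v : (linform v).@[p] = \sum_i v 0 i * p i.
Proof.
rewrite /linform (raddf_sum (meval p)); apply: eq_bigr => i _ /=.
by rewrite mevalZ mevalXU.
Qed.

Variables (rA : gT -> 'M[K]_n) (sig : gT -> {rmorphism A -> A}).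
Hypothesis rA_rep : is_rep rA.
Hypothesis sigL : forall g v, sig g (linform v) = linform (v *m rA g).

Definition semi_invariant m (chi : gT -> K) (h : A) : Prop :=
  [/\ h != 0, h \is m.-homog & forall g, sig g h = (chi g)%:MP * h].

Section Simple.
Variables (m : nat) (B : gT -> 'M[K]_m) (w : 'rV[K]_m).
Hypotheses (B_rep : is_rep B) (w0 : w != 0).
Hypothesis B_simple : forall u v : 'rV_m, u != 0 ->
  exists X Y, ralg B rA X Y /\ v = u *m X.
Hypothesis B_faithful : forall X, ralg B rA X 0 -> X = 0.

(** Schur's lemma for a commutative algebra: w generates B, so what kills w kills B. *)
Lemma ralg_eq0 X Y : ralg B rA X Y -> w *m X = 0 -> X = 0.
Proof.
move=> XY wX; apply/row_matrixP => i; rewrite row0 rowE.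
have [X' [Y' [XY' ->]]] := B_simple (delta_mx 0 i) w0.
rewrite -mulmxA (ralg_comm B_rep rA_rep abelian_gT XY' XY).1 mulmxA wX.
by rewrite mul0mx.
Qed.

(* Some component of the representation on linear forms on which the elements
   acting as 1 on the simple module B stay nonzero contains a copy of B. *)
Lemma simple_embeds : (0 < m)%N ->
  exists2 u : 'rV_n, u != 0 & forall X Y, ralg B rA X Y -> w *m X = 0 -> u *m Y = 0.
Proof.
move=> m0.
(* b has least rank on S_1 among the elements acting as 1 on B, and is nonzero by faithfulness. Then
   u is chosen nonzero in the image of b with a cyclic module of least rank. *)
pose P1 r := `[< exists Y, ralg B rA 1%:M Y /\ \rank Y = r >].
have exP1 : exists r, P1 r.
  by exists (\rank (1%:M : 'M[K]_n)); apply/asboolP; exists 1%:M; split=> //; apply: ralg1.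
case: (ex_minnP exP1) => r /asboolP[b [b1 rb]] minr.
have bn0 : b != 0.
  apply/eqP => b0; move: b1; rewrite b0 => /B_faithful /matrixP /(_ (Ordinal m0) (Ordinal m0)).
  by rewrite !mxE eqxx => /eqP; rewrite oner_eq0.
pose P2 s := `[< exists u : 'rV_n, [/\ u != 0, (u <= b)%MS & \rank (rgen rA u) = s] >].
have exP2 : exists s, P2 s.
  have /rowV0Pn[u ub u0] := bn0.
  by exists (\rank (rgen rA u)); apply/asboolP; exists u.
case: (ex_minnP exP2) => s /asboolP[u [u0 ub su]] mins.
exists u => // X Y XY wX; have X0 := ralg_eq0 XY wX; apply/eqP; apply: contraT => uY0.
have [c cY] : exists c, Y = ract rA c by case: XY => c [_ ->]; exists c.
have uYb : (u *m Y <= b)%MS.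
  have /submxP[D ->] := ub; rewrite -mulmxA (ralg_comm B_rep rA_rep abelian_gT b1 XY).2 mulmxA.
  exact: submxMl.
have uYu : (u *m Y <= rgen rA u)%MS by apply/rgenP; exists c; rewrite cY.
have sub := rgen_sub rA_rep uYu.
(* If u Y is nonzero, minimality of u gives u = u Y c'. As X = 0, b - b Y c' still acts as 1 on B;
   its rank is smaller than that of b because 1 - Y c' kills u, which lies in the image of b. *)
have : (u <= rgen rA (u *m Y))%MS.
  apply: submx_trans (rgen_id _ rA_rep) _.
  rewrite -(geq_leqif (mxrank_leqif_sup sub)) su; apply: mins; apply/asboolP.
  by exists (u *m Y).
case/rgenP => c' uc'.
have XY' : ralg B rA (ract B c') (ract rA c') by exists c'.
have bad := ralgB b1 (ralgM B_rep rA_rep b1 (ralgM B_rep rA_rep XY XY')).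
rewrite X0 mul0mx mulmx0 subr0 in bad.
have : P1 (\rank (b - b *m (Y *m ract rA c'))).
  by apply/asboolP; eexists; split; first exact: bad.
move/minr; rewrite -rb leqNgt => /negP[].
have com := (ralg_comm B_rep rA_rep abelian_gT b1 (ralgM B_rep rA_rep XY XY')).2.
set Z := 1%:M - Y *m ract rA c'.
have -> : b - b *m (Y *m ract rA c') = b *m Z by rewrite mulmxBr mulmx1.
have uZ : u *m Z = 0 by rewrite mulmxBr mulmx1 mulmxA -uc' subrr.
rewrite -(mxrank_mul_ker b Z) -[X in (X < _)%N]addn0 ltn_add2l lt0n mxrank_eq0.
apply/eqP => cap0; case/eqP: u0; apply/eqP; rewrite -submx0 -cap0 sub_capmx ub /=.
exact/sub_kermxP.
Qed.

(* The semi-invariant is the norm form of the field which the group algebra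
   induces on B, written in the basis a_i with w a_i = e_i. *)
Lemma semi_invariant_simple : (0 < m)%N ->
  exists h, semi_invariant m (fun g => \det (B g)) h.
Proof.
move=> m0; have [u u0 ukill] := simple_embeds m0.
have /choice[XX] := fun i => B_simple (delta_mx 0 i : 'rV_m) w0.
case/choice => YY XYP.
have XY i : ralg B rA (XX i) (YY i) by have [] := XYP i.
have eX i : w *m XX i = delta_mx 0 i by have [] := XYP i.
(* w a |-> u a is a module embedding of B in S_1, and M is the multiplication table of the a_i
   carried to linear forms. Acting by g multiplies this table on the left by B g. *)
pose M : 'M[A]_m := \matrix_(i, j) linform (u *m YY i *m YY j).
exists (\det M); split.
- have [j uj] : exists j, u 0 j != 0.
    apply/existsP; rewrite -negb_forall; apply: contra u0 => /forallP u0.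
    by apply/eqP/rowP => a; rewrite mxE; apply/eqP.
  pose ev : {rmorphism A -> K} := meval (fun i => (i == j)%:R).
  have evL v : ev (linform v) = v 0 j.
    rewrite /ev /= linform_eval (bigD1 j) //= eqxx mulr1 big1 ?addr0 //.
    by move=> i /negbTE->; rewrite mulr0.
  apply/eqP => /(congr1 ev); rewrite rmorph0 -det_map_mx => /eqP/det0P[t t0 tM].
  (* A null vector t of M at the j-th unit point gives tau = sum_i t_i a_i with (u tau a_l)_j = 0
     for all l. By simplicity tau has an inverse on B, which acts on u as a combination of the a_l;
     hence u_j = 0. *)
  pose X := \sum_i t 0 i *: XX i; pose Y := \sum_i t 0 i *: YY i.
  have XYt : ralg B rA X Y by apply: ralg_sum.
  have wX : w *m X = t.
    rewrite mulmx_sumr [RHS]row_sum_delta; apply: eq_bigr => i _.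
    by rewrite -scalemxAr eX.
  have uYY l : (u *m Y *m YY l) 0 j = 0.
    have /rowP/(_ l) e := tM; rewrite !mxE in e; rewrite -[RHS]e.
    rewrite mulmx_sumr mulmx_suml summxE; apply: eq_bigr => i _.
    by rewrite -scalemxAr -scalemxAl mxE; congr (_ * _); rewrite [RHS]mxE [M i l]mxE evL.
  have [X' [Y' [XY' wX']]] := B_simple w t0.
  have com := (ralg_comm B_rep rA_rep abelian_gT XYt XY').2.
  have kill1 : u *m Y *m Y' = u.
    apply/eqP; rewrite -mulmxA -[X in _ == X]mulmx1 -subr_eq0 -mulmxBr.
    apply/eqP; apply: ukill (ralgB (ralgM B_rep rA_rep XYt XY') (ralg1 B_rep rA_rep)) _.
    by rewrite mulmxBr mulmx1 mulmxA wX -wX' subrr.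
  pose s i := (w *m X') 0 i.
  have kill2 : u *m Y' = u *m (\sum_i s i *: YY i).
    apply/eqP; rewrite -subr_eq0 -mulmxBr.
    apply/eqP; apply: ukill (ralgB XY' (ralg_sum s XY)) _.
    rewrite mulmxBr mulmx_sumr [X in X - _]row_sum_delta -sumrB big1 // => i _.
    by rewrite -scalemxAr eX subrr.
  case/eqP: uj; rewrite -kill1 -mulmxA com mulmxA kill2.
  rewrite [u *m _]mulmx_sumr mulmx_suml summxE big1 // => i _.
  rewrite -scalemxAr -scalemxAl mxE -mulmxA.
  by rewrite -(ralg_comm B_rep rA_rep abelian_gT XYt (XY i)).2 mulmxA uYY mulr0.
- apply: rpred_sum => p _; rewrite -signr_odd.
  have hp : \prod_i M i (p i) \is (\sum_(i < m) 1)%N.-homog.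
    apply: (big_ind2 (fun q (e : nat) => q \is e.-homog)) => [||i _].
    + exact: dhomog1.
    + by move=> *; apply: dhomogM.
    by rewrite mxE linform_homog.
  rewrite sum1_card card_ord in hp.
  by case: (odd _); rewrite ?expr1 ?mulN1r ?rpredN ?expr0 ?mul1r.
move=> g; pose cc : {rmorphism K -> A} := @mpolyC n K.
rewrite -[X in X * _]/(cc (\det (B g))) -!det_map_mx -det_mulmx; congr (\det _).
apply/matrixP => i j; rewrite !mxE sigL.
have -> : u *m YY i *m YY j *m rA g = \sum_l B g i l *: (u *m YY l *m YY j).
  have e : u *m (YY i *m rA g) = u *m (\sum_l B g i l *: YY l).
    apply/eqP; rewrite -subr_eq0 -mulmxBr; apply/eqP.
    apply: ukill (ralgB (ralgM B_rep rA_rep (XY i) (ralg_gen B rA g)) (ralg_sum (B g i) XY)) _.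
    rewrite mulmxBr mulmxA eX -rowE mulmx_sumr [X in X - _]row_sum_delta -sumrB big1 // => l _.
    by rewrite -scalemxAr eX mxE subrr.
  rewrite -!mulmxA (ralg_comm B_rep rA_rep abelian_gT (XY j) (ralg_gen B rA g)).2.
  rewrite [u *m _]mulmxA [_ *m (rA g *m _)]mulmxA -[u *m YY i *m rA g]mulmxA e.
  rewrite mulmx_sumr mulmx_suml; apply: eq_bigr => l _.
  by rewrite -scalemxAr -scalemxAl.
rewrite linform_sum; apply: eq_bigr => l _.
by rewrite !mxE -mul_mpolyC.
Qed.
End Simple.

(** B is a module over the image of the group algebra in End(S_1). Subquotients of S_1 inherit this,
    whereas they need not embed in S_1. *)
Definition rep_faithful m (B : gT -> 'M[K]_m) : Prop := forall X, ralg B rA X 0 -> X = 0.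

(** In a basis that begins with one of U, the action on row vectors is block lower triangular, with
    the submodule U and the quotient by U on the diagonal. An element that is 0 on B is 0 on
    both. *)
Lemma rep_split r s m (B : gT -> 'M[K]_m) (U : 'M_(r, m)) (C : 'M_(s, m)) :
    (r + s = m)%N -> row_full (col_mx U C) ->
    is_rep B -> rep_faithful B -> (forall g, (U *m B g <= U)%MS) ->
  exists (B1 : gT -> 'M[K]_r) (B2 : gT -> 'M[K]_s),
    [/\ is_rep B1 /\ rep_faithful B1, is_rep B2 /\ rep_faithful B2
      & forall g, \det (B g) = \det (B1 g) * \det (B2 g)].
Proof.
move=> e; case: m / e in B U C * => full [B1 BM] faith stab.
have Tu : col_mx U C \in unitmx by rewrite -row_full_unit.
set T := col_mx U C in Tu; pose N g := T *m B g *m invmx T.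
have N1 : N 1%g = 1%:M by rewrite /N B1 mulmx1 mulmxV.
have NM g h : N (g * h)%g = N g *m N h.
  by rewrite /N BM !mulmxA mulmxKV.
have Nur g : ursubmx (N g) = 0.
  have /submxP[D eD] := stab g.
  have UT : U *m invmx T = row_mx 1%:M 0.
    by have := congr1 usubmx (mulmxV Tu); rewrite -mul_usub_mx col_mxKu scalar_mx_block block_mxEv col_mxKu.
  rewrite /ursubmx /N -!mul_usub_mx col_mxKu eD -mulmxA UT.
  by rewrite mul_mx_row mulmx0 row_mxKr.
have NE g : N g = block_mx (ulsubmx (N g)) 0 (dlsubmx (N g)) (drsubmx (N g)).
  by rewrite -(Nur g) submxK.
have raN c : ract N c = T *m ract B c *m invmx T.
  rewrite /ract mulmx_sumr mulmx_suml; apply: eq_bigr => g _.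
  by rewrite -scalemxAr -scalemxAl.
have N0 c : ract rA c = 0 -> ract N c = 0.
  move=> c0; have -> : ract N c = T *m ract B c *m invmx T := raN c.
  by rewrite (faith (ract B c)) ?mulmx0 ?mul0mx //; exists c; rewrite c0.
exists (fun g => ulsubmx (N g)), (fun g => drsubmx (N g)); split; first split.
- split=> [|g h]; first by rewrite N1 scalar_mx_block block_mxKul.
  by rewrite NM (NE g) (NE h) mulmx_block !block_mxKul mul0mx addr0.
- move=> X [c [-> /esym/N0 Nc]].
  have -> : ract (fun g => ulsubmx (N g)) c = ulsubmx (ract N c).
    apply/matrixP => i j; rewrite !mxE !summxE.
    by apply: eq_bigr => g _; rewrite !mxE.
  by rewrite Nc; apply/matrixP => i j; rewrite !mxE.
- split.
    split=> [|g h]; first by rewrite N1 scalar_mx_block block_mxKdr.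
    by rewrite NM (NE g) (NE h) mulmx_block !block_mxKdr mulmx0 add0r.
  move=> X [c [-> /esym/N0 Nc]].
  have -> : ract (fun g => drsubmx (N g)) c = drsubmx (ract N c).
    apply/matrixP => i j; rewrite !mxE !summxE.
    by apply: eq_bigr => g _; rewrite !mxE.
  by rewrite Nc; apply/matrixP => i j; rewrite !mxE.
move=> g; rewrite -(det_lblock _ (dlsubmx (N g))) -NE /N !det_mulmx mulrAC -det_mulmx mulmxV //.
by rewrite det1 mul1r.
Qed.

Lemma semi_invariantM m1 m2 chi1 chi2 h1 h2 :
  semi_invariant m1 chi1 h1 -> semi_invariant m2 chi2 h2 ->
  semi_invariant (m1 + m2) (fun g => chi1 g * chi2 g) (h1 * h2).
Proof.
move=> [h10 hh1 e1] [h20 hh2 e2]; split; first by rewrite mulf_neq0.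
  exact: dhomogM.
by move=> g; rewrite rmorphM e1 e2 mpolyCM mulrACA.
Qed.

(** Induction on the dimension along composition factors: for a proper submodule, determinants
    multiply and dimensions add, as do the semi-invariants and their degrees. A general B is
    required since the induction leaves S_1. *)
Lemma semi_invariant_exists m (B : gT -> 'M[K]_m) : is_rep B -> rep_faithful B ->
  exists h, semi_invariant m (fun g => \det (B g)) h.
Proof.
have [t] := ubnP m; elim: t m B => // t IH [|m] B mt Brep Bf.
  exists 1; split; [exact: oner_neq0|exact: dhomog1|move=> g].
  by rewrite det_mx00 mpolyC1 mul1r rmorph1.
have [sim|] := pselect (forall u v : 'rV_m.+1, u != 0 ->
    exists X Y, ralg B rA X Y /\ v = u *m X).
  have d0 : delta_mx 0 0 != 0 :> 'rV[K]_m.+1.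
    apply/eqP => /rowP/(_ 0); rewrite !mxE !eqxx => /eqP; rewrite oner_eq0 //.
  exact: (semi_invariant_simple Brep d0).
move=> /existsNP[u /existsNP[v /not_implyP[u0 Nv]]].
set U := rgen B u.
have vU : ~~ (v <= U)%MS.
  apply/negP => /rgenP[c vc]; apply: Nv; exists (ract B c), (ract rA c).
  by split=> //; exists c.
have U0 : (0 < \rank U)%N.
  rewrite lt0n mxrank_eq0; apply: contra u0 => /eqP U0.
  by rewrite -submx0 -U0; apply: rgen_id.
have Um : (\rank U < m.+1)%N.
  by rewrite ltn_neqAle rank_leq_row andbT; apply: contra vU => Uf; rewrite submx_full.
have eC : \rank (U^C)%MS = (m.+1 - \rank U)%N by rewrite mxrank_compl.
have stab g : (row_base U *m B g <= row_base U)%MS.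
  rewrite eq_row_base (submx_trans (submxMr _ (_ : row_base U <= U)%MS)) ?eq_row_base //.
  rewrite sumsmxMr; apply/sumsmx_subP => h _.
  rewrite (eqmxMr _ (genmxE _)) -mulmxA -Brep.2.
  by apply: (sumsmx_sup (h * g)%g) => //; rewrite genmxE.
have eU : (\rank U + \rank (U^C)%MS = m.+1)%N by rewrite eC subnKC // ltnW.
have full : row_full (col_mx (row_base U) (row_base (U^C)%MS)).
  rewrite -sub1mx -addsmxE.
  rewrite (submx_trans (_ : 1%:M <= U + U^C)%MS) ?sub1mx ?addsmx_compl_full //.
  by apply: addsmxS; rewrite eq_row_base.
have [B1 [B2 [[r1 f1] [r2 f2] det12]]] := rep_split eU full Brep Bf stab.
have lt1 : (\rank U < t)%N by rewrite (leq_trans Um).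
have lt2 : (\rank (U^C)%MS < t)%N by rewrite eC (@leq_trans m.+1) // ltn_subrL U0.
have [h1 s1] := IH _ B1 lt1 r1 f1.
have [h2 s2] := IH _ B2 lt2 r2 f2.
exists (h1 * h2); have := semi_invariantM s1 s2; rewrite eU => -[hn hh he].
by split=> // g; rewrite det12.
Qed.
End SemiInvariants.

(** * Functionals on top local cohomology *)

Section TopCohomology.
Variables (k : fieldType) (R : gdomain k) (f : hsop R).
Local Notation d := (hsop_dim f).
Local Notation x := (@hsop_elt _ _ f).
Local Notation H := (top_local_cohomology f).
Local Notation P0 := {mpoly k[d]}.
Implicit Types (r s : R) (a : 'X_{1..d}).

Definition hsop_map : {rmorphism P0 -> R} := mmap (gdom_scal R) x.

Lemma hsop_mapX i : hsop_map 'X_i = x i.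
Proof. by rewrite /hsop_map /= mmapX mmap1U. Qed.

Lemma hsop_mapC c : hsop_map c%:MP = gdom_scal R c.
Proof. by rewrite /hsop_map /= mmapC. Qed.

(** The exponents a_i + 1 let a run through N^d: a fraction without some x_i in its denominator is a
    boundary. *)
Definition den a : R := \prod_i x i ^+ (a i).+1.

Lemma den_neq0 a : den a != 0.
Proof. by apply/prodf_neq0 => i _; rewrite expf_neq0 // hsop_neq0. Qed.

Definition pfrac r a : fracmod R := (tofrac r : fracmod R) / tofrac (den a).

Lemma pfracE r s a b : r * den b = s * den a -> pfrac r a = pfrac s b.
Proof.
move=> e; apply/eqP; rewrite /pfrac eqr_div ?tofrac_eq0 ?den_neq0 //.
by rewrite -!rmorphM e.
Qed.

Lemma den_const t : den [multinom t | i < d] = (\prod_i x i) ^+ t.+1.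
Proof. by rewrite /den -prodrXl; apply: eq_bigr => i _; rewrite mnmE. Qed.

Lemma pfrac_const r t : frac_div R r (\prod_i x i) t.+1 = pfrac r [multinom t | i < d].
Proof. by rewrite /pfrac den_const rmorphXn. Qed.

Lemma pfrac_in_loc r a : pfrac r a \in loc_pred (@hsop_prod _ _ f predT).
Proof.
(* |a| bounds every a_i, so |a| + 1 is a common exponent for the denominator. *)
apply/loc_predP; exists (r * \prod_i x i ^+ (mdeg a - a i)), (mdeg a).+1.
rewrite /= pfrac_const; apply: pfracE; rewrite den_const -mulrA; congr (_ * _).
rewrite /den -big_split -prodrXl; apply: eq_bigr => i _ /=.
rewrite -exprD addnS subnK // mdegE (bigD1 i) //=; exact: leq_addr.
Qed.

Definition cfrac r a : cech_top f := Sub (pfrac r a) (pfrac_in_loc r a).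

Definition cls r a : H := gquot_pi (cech_image f) (cfrac r a).

Lemma cls_eq r s a b : r * den b = s * den a -> cls r a = cls s b.
Proof. by move=> e; congr (gquot_pi _ _); apply/val_inj/pfracE. Qed.

Lemma clsD r s a : cls (r + s) a = cls r a + cls s a.
Proof.
rewrite /cls -gquot_piD; congr (gquot_pi _ _); apply: val_inj.
by rewrite raddfD /= /pfrac rmorphD mulrDl.
Qed.

Lemma clsZ r s a : s *: cls r a = cls (s * r) a.
Proof.
rewrite /cls -[LHS]/(gquot_scale s _) gquot_scaleE; congr (gquot_pi _ _).
apply: val_inj; rewrite linearZ /= /pfrac -[LHS]/(tofrac s * _) mulrA.
by rewrite -rmorphM.
Qed.

Lemma denU a i : den (a + U_(i)) = x i * den a.
Proof.
rewrite /den (bigD1 i) //= [in RHS](bigD1 i) //= mulrA -exprS; congr (_ * _).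
  by rewrite mnmDE mnm1E eqxx addn1.
by apply: eq_bigr => j ji; rewrite mnmDE mnm1E eq_sym (negbTE ji) addn0.
Qed.

Lemma cls_shift r a i : cls (x i * r) (a + U_(i)) = cls r a.
Proof. by apply: cls_eq; rewrite denU mulrCA mulrA. Qed.

(** The numerator cancels the only x_i of the denominator, so the fraction lies in the localization
    that omits x_i. *)
Lemma cls_boundary r a i : a i = 0%N -> cls (x i * r) a = 0.
Proof.
move=> ai; rewrite /cls -(gquot_pi0 (cech_image f)).
apply/gquot_pi_eq/gsub_predP; rewrite subr0.
exists (fun j => if j == i then pfrac (x i * r) a else 0); last first.
  by rewrite -big_mkcond big_pred1_eq.
move=> j; case: eqP => [->|_]; last by exists 0, 0%N; rewrite frac_div0.
exists (r * \prod_(l | l != i) x l ^+ (mdeg a - a l)), (mdeg a).+1.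
rewrite /pfrac /frac_div /=.
have g0 : \prod_(l | predC1 i l) x l != 0 := @hsop_prod_neq0 _ _ f _.
apply/eqP; rewrite -rmorphXn eqr_div ?tofrac_eq0 ?den_neq0 ?expf_neq0 //.
rewrite -!rmorphM; apply/eqP; congr tofrac.
have -> : den a = x i * \prod_(l | l != i) x l ^+ (a l).+1.
  by rewrite /den (bigD1 i) //= ai expr1.
rewrite [RHS]mulrACA [x i * r]mulrC; congr (_ * _).
rewrite -big_split -prodrXl; apply: eq_bigr => l _ /=.
rewrite -exprD addnS subnK // mdegE (bigD1 l) //=; exact: leq_addr.
Qed.

Lemma cls_deg e r a : gdom_comp e r ->
  gmod_comp H (e%:Z - (\sum_i (a i).+1 * hsop_deg i)%N%:Z) (cls r a).
Proof.
move=> cr; exists (cfrac r a) => //.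
exists (r * \prod_i x i ^+ (mdeg a - a i)), (mdeg a).+1; split; last first.
  rewrite /= pfrac_const; apply: pfracE; rewrite den_const -mulrA; congr (_ * _).
  rewrite /den -big_split -prodrXl; apply: eq_bigr => i _ /=.
  rewrite -exprD addnS subnK // mdegE (bigD1 i) //=; exact: leq_addr.
have le i : (a i <= mdeg a)%N by rewrite mdegE (bigD1 i) //=; exact: leq_addr.
have -> : e%:Z - (\sum_i (a i).+1 * hsop_deg i)%N%:Z +
    ((mdeg a).+1 * helt_deg (@hsop_prod _ _ f predT))%N%:Z =
    (e + \sum_i (mdeg a - a i) * hsop_deg i)%N%:Z.
  rewrite /= big_distrr /= -addrA PoszD; congr (_ + _).
  apply/eqP; rewrite addrC subr_eq -PoszD eqz_nat -big_split; apply/eqP/eq_bigr => i _ /=.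
  by rewrite -mulnDl addnS subnK.
apply: gdom_compM => //; elim/big_rec2: _ => [|i n y _ cy].
  by apply/gdom_comp0; exists 1; rewrite rmorph1.
by apply: gdom_compM cy; apply: gdom_compX; apply: hsop_homog.
Qed.

Lemma cls_surj (h : H) : exists r a, h = cls r a.
Proof.
have [y ->] := gquot_pi_surj h.
have [r [t e]] := elimT (loc_predP _ _) (valP y).
exists (r * \prod_i x i), [multinom t | i < d]; congr (gquot_pi _ _); apply: val_inj.
rewrite e /= -pfrac_const (@frac_div_raise _ _ r _ t 1) ?hsop_prod_neq0 //.
by rewrite expr1 addn1.
Qed.
End TopCohomology.

Arguments cls {k R} f r a.

(** * Generating functions of functionals *)

Section CoefficientMap.
Variables (k : fieldType) (R : gdomain k) (f : hsop R).
Local Notation d := (hsop_dim f).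
Local Notation x := (@hsop_elt _ _ f).
Local Notation H := (top_local_cohomology f).
Local Notation P0 := {mpoly k[d]}.
Implicit Types (phi : gdual_type H) (r s : R) (a : 'X_{1..d}).

Lemma gdual_clsD phi r s a : phi (cls f (r + s) a) = phi (cls f r a) + phi (cls f s a).
Proof. by rewrite clsD (gdual_klinear phi).1. Qed.

(** The degree of r / x^(a+1) tends to minus infinity with |a|, while phi is supported in finitely
    many degrees. Generating functions are therefore polynomials. *)
Lemma gdual_cls_bound phi r : exists b, forall a, (b <= mdeg a)%N -> phi (cls f r a) = 0.
Proof.
have [l Hl ->] := grading_span (gdom_grading R) r.
elim: l Hl => [|y l IH] Hl.
  exists 0%N => a _; rewrite big_nil -(mul0r 0) -clsZ scale0r.
  exact: klinear0 (gdual_klinear phi).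
have [|b hb] := IH; first by move=> z zl; apply: Hl; rewrite inE zl orbT.
have [e ce] : exists e, gdom_comp e y by apply: Hl; rewrite inE eqxx.
have [S hS] := gdual_finite phi.
pose c := (e + \sum_(j <- S) `|j|).+1%N.
exists (maxn b c) => a; rewrite geq_max => /andP[ba ca].
rewrite big_cons gdual_clsD (hb a ba) addr0.
apply: (hS _ _ _ (cls_deg a ce)); apply/negP => jS.
set D := (\sum_i _)%N in jS.
have aD : (mdeg a <= D)%N.
  rewrite mdegE; apply: leq_sum => i _.
  by rewrite (leq_trans (leqnSn _)) // leq_pmulr // hsop_deg_gt0.
have : (`|(e%:Z - D%:Z : int)| <= \sum_(j <- S) `|j|)%N.
  by rewrite (big_rem _ jS) /= leq_addr.
apply/negP; rewrite -ltnNge.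
have eD : (e <= D)%N.
  by rewrite (leq_trans _ aD) // (leq_trans _ ca) // /c leqW // leq_addr.
rewrite distnC distnEl // -(ltn_add2l e) subnKC //.
exact: leq_trans ca aD.
Qed.

Lemma gdual_poly phi r : exists p : P0, forall a, p@_a = phi (cls f r a).
Proof.
have [b hb] := gdual_cls_bound phi r.
exists (\sum_(a : 'X_{1..d < b}) phi (cls f r a) *: 'X_[a]) => a.
have [ab|ba] := ltnP (mdeg a) b; first exact: (mcoeff_mpoly (fun a => phi (cls f r a))).
rewrite (hb a ba) raddf_sum big1 // => l _; rewrite /= mcoeffZ mcoeffX.
case: eqP => [e|]; last by rewrite mulr0.
by have := bmdeg l; rewrite e ltnNge ba.
Qed.

Definition dual_poly phi r : P0 := projT1 (cid (gdual_poly phi r)).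

Lemma dual_polyE phi r a : (dual_poly phi r)@_a = phi (cls f r a).
Proof. by rewrite /dual_poly; case: cid => p /= ->. Qed.

Lemma dual_polyD phi r s : dual_poly phi (r + s) = dual_poly phi r + dual_poly phi s.
Proof. by apply/mpolyP => a; rewrite mcoeffD !dual_polyE gdual_clsD. Qed.

Lemma dual_poly_addl phi psi r :
  dual_poly (phi + psi) r = dual_poly phi r + dual_poly psi r.
Proof. by apply/mpolyP => a; rewrite mcoeffD !dual_polyE. Qed.

Lemma dual_poly_scalel s phi r : dual_poly (s *: phi) r = dual_poly phi (s * r).
Proof. by apply/mpolyP => a; rewrite !dual_polyE -clsZ. Qed.

(** The factor x_i lowers the i-th exponent of the denominator by one; when a_i = 0 the class is a
    boundary, matching the missing coefficient of a multiple of X_i. *)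
Lemma dual_poly_var phi i r : dual_poly phi (x i * r) = 'X_i * dual_poly phi r.
Proof.
apply/mpolyP => a; rewrite dual_polyE ['X_i * _]mulrC.
have [ai|ai] := posnP (a i).
  rewrite (cls_boundary r ai) (klinear0 (gdual_klinear phi)).
  apply/esym/eqP; rewrite mcoeff_eq0; apply/negP => /msuppM_le/allpairsP[[b c] /= [_]].
  rewrite msuppX inE => /eqP-> e; move: ai; rewrite e mnmDE mnm1E eqxx addn1 //.
have ea : a = (U_(i) + (a - U_(i)))%MM.
  rewrite addmC submK //; apply/mnm_lepP => j; rewrite mnm1E; case: eqP => // <-.
  exact: ai.
by rewrite ea mcoeffMX dual_polyE addmC cls_shift.
Qed.

Lemma dual_poly_const phi c r : dual_poly phi (gdom_scal R c * r) = c%:MP * dual_poly phi r.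
Proof.
apply/mpolyP => a; rewrite mcoeffCM !dual_polyE -clsZ.
exact: (gdual_klinear phi).2.
Qed.

Lemma dual_poly_sum phi (I : Type) (t : seq I) (u : I -> R) :
  dual_poly phi (\sum_(i <- t) u i) = \sum_(i <- t) dual_poly phi (u i).
Proof.
apply: (big_morph _ (dual_polyD phi)).
by apply: (addrI (dual_poly phi 0)); rewrite -dual_polyD !addr0.
Qed.

Lemma dual_poly_param phi p r : dual_poly phi (hsop_map f p * r) = p * dual_poly phi r.
Proof.
rewrite [X in hsop_map f X](mpolyE p) rmorph_sum mulr_suml dual_poly_sum.
rewrite [X in _ = X * _](mpolyE p) mulr_suml.
apply: eq_bigr => m _; rewrite -mul_mpolyC rmorphM hsop_mapC -mulrA dual_poly_const.
rewrite -mulrA; congr (_ * _); rewrite mpolyXE_id rmorph_prod.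
elim: (index_enum _) => [|j l IH]; first by rewrite !big_nil !mul1r.
rewrite !big_cons -!mulrA -IH; elim: (m j) => [|t IHt]; first by rewrite rmorph1 !mul1r.
by rewrite !rmorphXn /= in IHt *; rewrite !exprS hsop_mapX -!mulrA dual_poly_var -IHt hsop_mapX.
Qed.

Lemma dual_poly_inj phi : (forall r, dual_poly phi r = 0) -> phi = 0.
Proof.
move=> phi0; apply: gdual_eqP => h; have [r [a ->]] := cls_surj h.
by rewrite -dual_polyE phi0 mcoeff0.
Qed.

(** phi of degree i is supported on classes of degree - i, and r / x^(a+1) has degree e - sum_l (a_l
    + 1) deg(x_l). The 1 in each exponent is the origin of the shift by sum_l deg(x_l). *)
Lemma dual_poly_degree (i : int) phi e r a : gdual_comp i phi -> gdom_comp e r ->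
    (dual_poly phi r)@_a != 0 ->
  (\sum_l a l * hsop_deg l)%N%:Z = e%:Z + i - (\sum_l hsop_deg (h := f) l)%N%:Z.
Proof.
move=> hphi ce; rewrite dual_polyE => phi0.
have ed : e%:Z - (\sum_l (a l).+1 * hsop_deg l)%N%:Z = - i.
  apply/eqP; apply: contraNT phi0 => ne; apply/eqP.
  exact: hphi ne (cls_deg a ce).
have es : (\sum_l (a l).+1 * hsop_deg l = \sum_l hsop_deg (h := f) l + \sum_l a l * hsop_deg l)%N.
  by rewrite -big_split; apply: eq_bigr => l _; rewrite mulSn.
move: ed; rewrite es PoszD => /eqP; rewrite subr_eq => /eqP->.
by rewrite [- i + _]addrC subrK addrC addKr.
Qed.
End CoefficientMap.

(** * Cutting a functional down to one degree *)

Section GradedFunctional.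
Variables (k : fieldType) (R : gdomain k) (M : gmodule R).

Lemma graded_functional (phi : M -> k) x : klinear phi -> phi x != 0 ->
  exists psi : gdual_type M, psi <> 0.
Proof.
move=> phil phix; have grM := gmod_grading M.
have [w Hw] := choice (grading_decomp grM).
have compP y s u : uniq s -> (forall i, gmod_comp M i (u i)) ->
    (forall i, i \notin s -> u i = 0) -> y = \sum_(i <- s) u i ->
    forall i, w y i = u i.
  move=> us cu u0 e; have [t [ut cw w0 ew]] := Hw y.
  by apply: (grading_uniq grM ut us); rewrite -?e -?ew.
have wc y i : gmod_comp M i (w y i) by have [t []] := Hw y.
have wD y z i : w (y + z) i = w y i + w z i.
  have [s [us _ s0 es]] := Hw y; have [t [ut _ t0 et]] := Hw z.
  have uU := undup_uniq (s ++ t).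
  apply: (compP _ _ (fun j => w y j + w z j) uU) => [j|j|]; first exact: gradingD.
    by rewrite mem_undup mem_cat negb_or => /andP[js jt]; rewrite s0 ?t0 ?addr0.
  have sU : {subset s <= undup (s ++ t)} by move=> j js; rewrite mem_undup mem_cat js.
  have tU : {subset t <= undup (s ++ t)} by move=> j jt; rewrite mem_undup mem_cat jt orbT.
  rewrite big_split /= (big_supp us uU sU s0) (big_supp ut uU tU t0).
  by congr (_ + _).
have wZ a y i : w (gdom_scal R a *: y) i = gdom_scal R a *: w y i.
  have [s [us _ s0 es]] := Hw y.
  apply: (compP _ _ (fun j => gdom_scal R a *: w y j) us) => [j|j js|].
  - rewrite -[in X in gmod_comp _ X _](add0r j); apply: (@gmod_compZ _ _ M 0%N) => //.
    by apply/gdom_comp0; exists a.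
  - by rewrite s0 ?scaler0.
  by rewrite -scaler_sumr; congr (_ *: _).
have wE i j y : gmod_comp M j y -> w y i = if i == j then y else 0.
  move=> cy; apply: (compP y [:: j] (fun i => if i == j then y else 0)) => //.
  - by move=> l; case: eqP => [->//|_]; exact: grading0.
  - by move=> l; rewrite inE => /negbTE->.
  by rewrite big_seq1 eqxx.
have [s [us _ s0 es]] := Hw x.
have [j phij] : exists j, phi (w x j) != 0.
  apply/not_existsP => H; case/eqP: phix; rewrite es (klinear_sum _ _ phil) big1 // => i _.
  by apply/eqP; apply: contraT => /(H i).
have pl : klinear (fun y => phi (w y j)).
  by split=> [y z|a y]; rewrite ?wD ?wZ ?phil.1 ?phil.2.
have pf : finite_degrees (fun y => phi (w y j)).
  exists [:: j] => i y; rewrite inE => ij cy.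
  by rewrite (wE j i) // eq_sym (negbTE ij) (klinear0 phil).
exists (GDual pl pf) => p0.
by have := congr1 (fun p : gdual_type M => p x) p0; apply/eqP.
Qed.
End GradedFunctional.

(** * The canonical module is nonzero *)

Section CanonicalModuleNonzero.
Variables (k : fieldType) (R : gdomain k) (f : hsop R).
Local Notation d := (hsop_dim f).
Local Notation x := (@hsop_elt _ _ f).
Local Notation P0 := {mpoly k[d]}.
Local Notation iota := (hsop_map f).
Local Notation cst t := [multinom t | i < d].

Lemma hsop_map_inj p : iota p = 0 -> p = 0.
Proof. exact: hsop_indep. Qed.

(** One coordinate in a basis over the fraction field, with the denominator s0 cleared. *)
Lemma param_functional : exists c : R -> P0,
  [/\ forall r s, c (r + s) = c r + c s, forall p r, c (iota p * r) = p * c r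
    & exists r, c r != 0].
Proof.
have [N [g g_span]] := hsop_finite f.
have [r [be [s0 [s0n ind span]]]] := @fraction_basis P0 R iota N g g_span.
have uniq_c (c c' : 'I_r -> P0) :
    \sum_i iota (c i) * be i = \sum_i iota (c' i) * be i -> forall i, c i = c' i.
  move=> e i; apply/eqP; rewrite -subr_eq0; apply/eqP; move: i.
  apply: (ind (fun i => c i - c' i)); apply/eqP; rewrite -subr_eq0 in e *.
  under eq_bigr do rewrite rmorphB mulrBl.
  by rewrite sumrB e subrr subr0.
have [cf cfP] := choice span.
have r0 : (0 < r)%N.
  case: r be ind span uniq_c cf cfP => // be ind span uniq_c cf cfP.
  have := cfP 1; rewrite big_ord0 mulr1 => /hsop_map_inj /eqP.
  by rewrite (negbTE s0n).
pose i0 := Ordinal r0; exists (fun v => cf v i0); split.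
- move=> u v; apply: (uniq_c _ (fun i => cf u i + cf v i)).
  rewrite -cfP mulrDr !cfP -big_split; apply: eq_bigr => i _.
  by rewrite rmorphD mulrDl.
- move=> p v; apply: (uniq_c _ (fun i => p * cf v i)).
  rewrite -cfP mulrCA cfP mulr_sumr; apply: eq_bigr => i _.
  by rewrite rmorphM mulrA.
exists (be i0).
suff -> : cf (be i0) i0 = (if i0 == i0 then s0 else 0) by rewrite eqxx.
have /(_ _ i0) := uniq_c (cf (be i0)) (fun i => if i == i0 then s0 else 0).
apply; rewrite -cfP (bigD1 i0) //= big1 ?addr0 // => i /negbTE->.
by rewrite rmorph0 mul0r.
Qed.

Section Residue.
Variable c : R -> P0.
Hypotheses (cD : forall r s, c (r + s) = c r + c s).
Hypothesis cZ : forall p r, c (iota p * r) = p * c r.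

Lemma iota_mon a : iota 'X_[a] = \prod_i x i ^+ a i.
Proof.
rewrite mpolyXE_id rmorph_prod; apply: eq_bigr => i _.
by rewrite rmorphXn; congr (_ ^+ _); apply: hsop_mapX.
Qed.

(* [res_rel y v]: v is the coefficient of c(r) at (x_1 ... x_d)^t, for one
   (equivalently any) expression y = r / (x_1 ... x_d)^(t+1). *)
Definition res_rel (y : fracmod R) (v : k) : Prop :=
  exists r t, y = pfrac r (cst t) /\ v = (c r)@_(cst t).

Lemma pfrac_raise r t u : pfrac r (cst t) = pfrac (iota 'X_[cst u] * r) (cst (t + u)).
Proof.
apply: pfracE; rewrite !den_const -addSn exprD iota_mon.
have -> : \prod_i x i ^+ (cst u) i = (\prod_i x i) ^+ u.
  by rewrite -prodrXl; apply: eq_bigr => i _; rewrite mnmE.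
by rewrite [_ ^+ t.+1 * _]mulrC mulrCA mulrA.
Qed.

Lemma res_raise r t u : (c r)@_(cst t) = (c (iota 'X_[cst u] * r))@_(cst (t + u)).
Proof.
rewrite cZ mulrC; have -> : cst (t + u) = (cst u + cst t)%MM.
  by apply/mnmP => i; rewrite mnmDE !mnmE addnC.
by rewrite mcoeffMX.
Qed.

Lemma pfrac_inj r s (a : 'X_{1..d}) : pfrac r a = pfrac s a -> r = s.
Proof.
rewrite /pfrac => /(mulIf _) e; apply/eqP; rewrite -tofrac_eq; apply/eqP/e.
by rewrite invr_eq0 tofrac_eq0 den_neq0.
Qed.

Lemma res_rel_fun y v v' : res_rel y v -> res_rel y v' -> v = v'.
Proof.
move=> [r [t [-> ->]]] [s [u [e ->]]].
rewrite (res_raise r t u) (res_raise s u t) [(u + t)%N]addnC.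
rewrite (pfrac_raise r t u) (pfrac_raise s u t) [(u + t)%N]addnC in e.
by rewrite (pfrac_inj e).
Qed.

Lemma pfracD r s (a : 'X_{1..d}) : pfrac (r + s) a = pfrac r a + pfrac s a.
Proof. by rewrite /pfrac rmorphD mulrDl. Qed.

Lemma res_relD y v z w : res_rel y v -> res_rel z w -> res_rel (y + z) (v + w).
Proof.
move=> [r [t [-> ->]]] [s [u [-> ->]]].
exists (iota 'X_[cst u] * r + iota 'X_[cst t] * s), (t + u)%N.
split; first by rewrite pfracD -pfrac_raise (addnC t u) -pfrac_raise.
by rewrite cD mcoeffD -res_raise (addnC t u) -res_raise.
Qed.

Lemma res_relZ a y v : res_rel y v -> res_rel (gdom_scal R a *: y) (a * v).
Proof.
move=> [r [t [-> ->]]]; exists (gdom_scal R a * r), t.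
rewrite -(hsop_mapC f) cZ mcoeffCM hsop_mapC; split=> //.
by rewrite /pfrac rmorphM -mulrA.
Qed.

(** Over (x_1 ... x_d)^(t+1), a fraction without x_i in its denominator has numerator divisible by
    x_i^(t+1), so c of that numerator has no monomial of exponent t in x_i. *)
Lemma res_rel_boundary (y : cech_top f) : cech_boundary y -> res_rel (val y) 0.
Proof.
case=> u hu ->.
have : forall i, res_rel (u i) 0.
  move=> i; have [r [t ->]] := hu i.
  have g0 : \prod_(l | predC1 i l) x l != 0 := @hsop_prod_neq0 _ _ f _.
  exists (iota ('X_i ^+ t.+1) * (r * \prod_(l | predC1 i l) x l)), t; split.
    rewrite -pfrac_const (@frac_div_raise _ _ r _ t 1) // expr1 addn1.
    rewrite (@frac_div_expand _ _ _ _ (x i)) ?hsop_neq0 // rmorphXn.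
    have -> : iota 'X_i = x i := hsop_mapX i.
    congr frac_div; first by rewrite mulrC.
    by rewrite [RHS](bigD1 i) //= mulrC.
  rewrite cZ mulrC; apply/esym/eqP; rewrite mcoeff_eq0; apply/negP.
  move=> /msuppM_le/allpairsP[[a b] /= [_]].
  rewrite mpolyXn msuppX inE => /eqP-> /mnmP/(_ i); rewrite mnmDE !mnmE mulmnE mnm1E eqxx.
  by move=> e; have := leqnn t; rewrite {1}e mul1n -ltnS -addSn ltnNge leq_addl.
move=> hu0; apply: (big_ind (res_rel^~ 0)) => // [|y1 y2 h1 h2]; last first.
  by rewrite -(addr0 0); apply: res_relD.
exists 0, 0%N; rewrite /pfrac rmorph0 mul0r; split=> //.
by have := cZ 0 0; rewrite rmorph0 !mul0r => ->; rewrite mcoeff0.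
Qed.
End Residue.

(** This inverts the passage to generating functions: coefficients of a P-linear c : R -> P serve as
    values of a functional on top cohomology. *)
Theorem canonical_module_neq0 : exists phi : canonical_module f, phi <> 0.
Proof.
have [c [cD cZ [r0 cr0]]] := param_functional.
pose rel (h : top_local_cohomology f) v :=
  exists y : cech_top f, h = gquot_pi (cech_image f) y /\ res_rel c (val y) v.
have rel_fun h v v' : rel h v -> rel h v' -> v = v'.
  move=> [y [-> hv]] [z [/gquot_pi_eq/gsub_predP yz hw]].
  have h0 := res_rel_boundary cD cZ yz.
  apply/eqP; rewrite -subr_eq0; apply/eqP.
  have := res_relD cD cZ h0 hw; rewrite add0r raddfB /= subrK => hvw.
  by rewrite (res_rel_fun cZ hv hvw) subrr.
have rel_tot h : exists v, rel h v.
  have [y ->] := gquot_pi_surj h.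
  have [r [t e]] := elimT (loc_predP _ _) (valP y).
  exists (c (r * \prod_i x i))@_(cst t); exists y; split=> //.
  exists (r * \prod_i x i), t; split=> //.
  by rewrite e -pfrac_const (@frac_div_raise _ _ r _ t 1) ?hsop_prod_neq0 // expr1 addn1.
have [phi hphi] := choice rel_tot.
have phil : klinear phi.
  split=> [g h|a h].
    apply: (rel_fun (g + h)) => //.
    have [y [ey hy]] := hphi g; have [z [ez hz]] := hphi h.
    exists (y + z); split; first by rewrite gquot_piD -ey -ez.
    by rewrite raddfD; apply: res_relD.
  apply: (rel_fun (gdom_scal R a *: h)) => //.
  have [y [ey hy]] := hphi h.
  exists (gdom_scal R a *: y); split.
    by rewrite {1}ey -[LHS]/(gquot_scale _ _) gquot_scaleE.
  by rewrite linearZ; apply: res_relZ.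
have [a ca] : exists a, (c r0)@_a != 0.
  apply/not_existsP => H; case/eqP: cr0; apply/mpolyP => a; rewrite mcoeff0.
  by apply/eqP; apply: contraT => /(H a).
(* [res_rel] reads coefficients at equal exponents only. The factor x^b pushes a to (t, ..., t),
   which is possible because |a| bounds each a_i. *)
pose t := mdeg a; pose b : 'X_{1..d} := (cst t - a)%MM.
have eb : cst t = (a + b)%MM.
  rewrite addmC submK //; apply/mnm_lepP => i; rewrite mnmE /t mdegE (bigD1 i) //=.
  exact: leq_addr.
apply: (@graded_functional _ _ _ phi (cls f (iota 'X_[b] * r0) (cst t)) phil).
have rl : rel (cls f (iota 'X_[b] * r0) (cst t)) (c r0)@_a.
  exists (cfrac (iota 'X_[b] * r0) (cst t)); split=> //.
  exists (iota 'X_[b] * r0), t; split=> //.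
  by rewrite cZ mulrC eb addmC mcoeffMX.
by rewrite (rel_fun _ _ _ (hphi _) rl).
Qed.
End CanonicalModuleNonzero.

(** * Modules embedding in the ring *)

Section Embedding.
Variables (k : fieldType) (R : gdomain k) (M : gmodule R).
Variable psi : {linear M -> gregular R}.
Hypothesis psi_inj : injective psi.
Hypothesis psi_deg : forall i x, gmod_comp M i x -> gmod_comp (gregular R) i (psi x).

Definition emb_image (y : gregular R) : Prop := exists x, y = psi x.

Lemma emb_image0 : emb_image 0.
Proof. by exists 0; rewrite linear0. Qed.

Lemma emb_image_linear r y z : emb_image y -> emb_image z -> emb_image (r *: y + z).
Proof. by move=> [u ->] [v ->]; exists (r *: u + v); rewrite linearP. Qed.

Lemma emb_image_span y : emb_image y -> exists2 l : seq (gregular R),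
  (forall z, z \in l -> exists i, gmod_comp (gregular R) i z /\ emb_image z) &
  y = \sum_(z <- l) z.
Proof.
case=> x ->; have [l hl ->] := grading_span (gmod_grading M) x.
exists [seq psi z | z <- l]; last by rewrite big_map linear_sum.
move=> _ /mapP[z /hl[i cz] ->]; exists i; split; first exact: psi_deg.
by exists z.
Qed.

Definition emb_ideal : gideal R :=
  GSubmodule emb_image0 emb_image_linear emb_image_span.

(** Comparing homogeneous components of psi x and using injectivity, psi reflects degrees as well as
    preserving them. *)
Lemma emb_comp_inv i x : gmod_comp (gregular R) i (psi x) -> gmod_comp M i x.
Proof.
move=> ci; have grM := gmod_grading M; have grR := gmod_grading (gregular R).
have [u [s [us cu u0 ex]]] := grading_decomp grM x.
pose v j := if j == i then psi x else 0.
have e : forall j, psi (u j) = v j.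
  apply: (@grading_uniq _ _ _ grR s [:: i]) => //.
  - by move=> j; apply: psi_deg.
  - by move=> j; rewrite /v; case: eqP => [->//|_]; apply: grading0.
  - by move=> j /u0->; rewrite linear0.
  - by move=> j; rewrite inE /v => /negbTE->.
  by rewrite big_seq1 /v eqxx ex linear_sum.
have xu : u i = x by apply: psi_inj; rewrite e /v eqxx.
by rewrite -xu.
Qed.

Lemma emb_giso : giso M (gsub_gmodule emb_ideal).
Proof.
have im x : psi x \in gsub_pred emb_ideal by apply/gsub_predP; exists x.
pose th x : gsub_gmodule emb_ideal := Sub (psi x) (im x).
have th_lin : linear th.
  by move=> r x y; apply: val_inj; rewrite linearP /= linearP.
pose thZ := GRing.isLinear.Build _ _ _ _ th th_lin.
pose thL : {linear M -> gsub_gmodule emb_ideal} := HB.pack th thZ.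
exists thL; last first.
  by move=> i x; split=> [/psi_deg|/emb_comp_inv].
have sur y : exists x, y = th x.
  have /gsub_predP[x ex] := valP y; exists x; exact: val_inj.
have [g hg] := choice sur; exists g => [x|y]; last by rewrite /= -hg.
by apply: psi_inj; have := congr1 val (hg (th x)).
Qed.
End Embedding.

(** * The b-invariant of an embedded canonical module *)

Section EmbeddedCanonicalModule.
Variables (k : fieldType) (R : gdomain k) (f : hsop R).
Variable psi : {linear canonical_module f -> gregular R}.
Hypothesis psi_inj : injective psi.
Hypothesis psi_deg : forall i x, gmod_comp (canonical_module f) i x ->
  gmod_comp (gregular R) i (psi x).

Lemma psi_neq0 w : w <> 0 -> psi w != 0.
Proof. by move=> w0; apply/eqP => e; apply: w0; apply: psi_inj; rewrite linear0. Qed.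

Lemma anticanonical_nonzero0 : anticanonical_nonzero f 0.
Proof.
exists psi; first by move=> j x cx; rewrite addr0; apply: psi_deg.
by have [w w0] := canonical_module_neq0 f; exists w; apply: psi_neq0.
Qed.

(** omega_R has rank one: psi(w1) v = psi(v) w1. So a nonzero phi of degree i is nonzero on the
    fixed homogeneous w1 of degree e, and e + i >= 0. *)
Lemma anticanonical_bounded : exists e : int, forall i,
  anticanonical_nonzero f i -> - e <= i.
Proof.
have [w w0] := canonical_module_neq0 f.
have [w1 [e [w10 cw1]]] : exists w1 e, w1 <> 0 /\ gmod_comp (canonical_module f) e w1.
  have [u [s [us cu u0 ew]]] := grading_decomp (gmod_grading (canonical_module f)) w.
  have [j uj] : exists j, u j <> 0.
    apply/not_existsP => H; apply: w0; rewrite ew big1 // => j _.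
    by apply: contrapT => /(H j).
  by exists (u j), j.
exists e => i [phi hphi [v phiv]].
have vw : psi w1 *: v = psi v *: w1.
  by apply: psi_inj; rewrite !linearZ /= -[LHS]/(_ * _) mulrC.
have : phi w1 != 0.
  apply: contraNneq phiv => phi1; have := congr1 phi vw.
  rewrite !linearZ /= phi1 scaler0 => /eqP.
  rewrite -[_ *: _]/(psi w1 * phi v) mulf_eq0 => /orP[|//].
  by rewrite (negbTE (psi_neq0 w10)).
have := hphi _ _ cw1; case ei: (e + i) => [m|m] /=; last by move=> ->; rewrite eqxx.
by move=> _ _; rewrite -[- e]sub0r lerBlDl ei.
Qed.

Lemma b_invariant_exists : exists b : int, is_b_invariant f b /\ b <= 0.
Proof.
have [e he] := anticanonical_bounded.
pose P m := `[< anticanonical_nonzero f (m%:Z - e) >].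
have toP i : anticanonical_nonzero f i -> exists2 m, P m & i = m%:Z - e.
  move=> hi; exists `|(i + e)%R|%N.
    apply/asboolP; rewrite gez0_abs ?addrK //.
    by rewrite -lerBlDr sub0r he.
  by rewrite gez0_abs ?addrK // -lerBlDr sub0r he.
have exP : exists m, P m by have [m Pm _] := toP _ anticanonical_nonzero0; exists m.
case: (ex_minnP exP) => m /asboolP Pm minm.
have le i : anticanonical_nonzero f i -> m%:Z - e <= i.
  by move=> /toP[l /minm ml ->]; rewrite lerD2r lez_nat.
by exists (m%:Z - e); split; [split | apply/le/anticanonical_nonzero0].
Qed.
End EmbeddedCanonicalModule.

(** * Linear actions on polynomial rings *)

Section LinearAction.
Variables (k : fieldType) (n : nat) (gT : finGroupType) (rho : galg_action k n gT).
Local Notation S := {mpoly k[n]}.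

Definition gact (g : gT) : {rmorphism S -> S} :=
  let phi := rho^~ g in
  let phiZ := GRing.isZmodMorphism.Build _ _ phi (galg_additive rho g) in
  let phiM := GRing.isMonoidMorphism.Build _ _ phi (galg_mult rho g) in
  HB.pack phi phiZ phiM.

Lemma gactE g p : gact g p = rho p g.
Proof. by []. Qed.

Lemma gactM g h p : gact (g * h)%g p = gact h (gact g p).
Proof.
rewrite !gactE; case: (galg_act rho) => to [_ mor] /=.
by apply: mor; rewrite inE.
Qed.

Lemma gact1 p : gact 1%g p = p.
Proof.
have := gactM 1 1 p; rewrite mulg1 !gactE; case: (galg_act rho) => to [inj _] /=.
by move=> e; apply: (inj 1%g); rewrite -e.
Qed.

Lemma gactC g c : gact g c%:MP = c%:MP.
Proof. exact: galgC. Qed.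

Lemma gact_homog g d p : p \is d.-homog -> gact g p \is d.-homog.
Proof. exact: galg_homog. Qed.

#[local] Opaque gact.

Definition gmx (g : gT) : 'M[k]_n := \matrix_(i, j) (gact g 'X_i)@_(U_(j)).

Lemma dhomog1_linform (p : S) : p \is 1.-homog -> p = linform (\row_j p@_(U_(j))).
Proof.
move=> hp; apply/mpolyP => m; rewrite raddf_sum /=.
have [/mdeg1P[j /eqP mj]|m1] := boolP (mdeg m == 1%N).
  rewrite (bigD1 j) //= big1 ?addr0 => [|i ij].
    by rewrite mcoeffZ mxE mcoeffX mj eqxx mulr1.
  rewrite mcoeffZ mcoeffX mj; case: eqP => [/mnmP/(_ j)|]; last by rewrite mulr0.
  by rewrite !mnm1E eqxx (negbTE ij).
rewrite (dhomog_nemf_coeff hp m1) big1 // => i _.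
rewrite mcoeffZ mcoeffX; case: eqP => [e|]; last by rewrite mulr0.
by case/eqP: m1; rewrite -e mdeg1.
Qed.

Lemma gactX g i : gact g 'X_i = \sum_j gmx g i j *: 'X_j.
Proof.
have h1 : ('X_i : S) \is 1.-homog by rewrite dhomogX; apply/eqP/mdeg1.
rewrite {1}(dhomog1_linform (gact_homog g h1)).
by apply: eq_bigr => j _; rewrite !mxE.
Qed.

Lemma gactZ g c p : gact g (c *: p) = c *: gact g p.
Proof. by rewrite -!mul_mpolyC rmorphM gactC. Qed.

Lemma gact_linform g v : gact g (linform v) = linform (v *m gmx g).
Proof.
rewrite /linform rmorph_sum; under eq_bigr do rewrite gactZ gactX scaler_sumr.
rewrite exchange_big; apply: eq_bigr => j _; rewrite mxE scaler_suml.
by apply: eq_bigr => i _; rewrite scalerA.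
Qed.

Lemma linform_inj : injective (@linform k n).
Proof.
move=> u v uv; apply/rowP => j; have := congr1 (mcoeff U_(j)) uv.
have E w : (linform w)@_(U_(j)) = w 0 j :> k.
  rewrite raddf_sum (bigD1 j) //= mcoeffZ mcoeffXU eqxx mulr1 big1 ?addr0 //.
  by move=> i /negbTE ij; rewrite mcoeffZ mcoeffXU ij mulr0.
by rewrite !E.
Qed.

Lemma gmx_rep : is_rep gmx.
Proof.
have H (M : 'M[k]_n) N : (forall v, linform (v *m M) = linform (v *m N)) -> M = N.
  move=> MN; apply/row_matrixP => i; rewrite !rowE; exact/linform_inj/MN.
split=> [|g h]; apply: H => v.
  by rewrite -gact_linform gact1 mulmx1.
by rewrite -gact_linform gactM !gact_linform mulmxA.
Qed.

Lemma gact_gmx g h : gmx g = gmx h -> gact g =1 gact h.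
Proof.
by move=> gh; apply: mpoly_rmorph_ext => [c|i]; rewrite ?gactC // !gactX gh.
Qed.

Lemma semi_invariant_det (abelian_G : abelian [set: gT]) :
  exists h : S, [/\ h != 0, h \is n.-homog
    & forall g, gact g h = (\det (gmx g))%:MP * h].
Proof.
have comm (g h : gT) : (g * h = h * g)%g.
  by apply: (centsP abelian_G); rewrite inE.
have faith : rep_faithful gmx gmx by move=> X [c [-> <-]].
have [h [h0 hh hg]] := semi_invariant_exists comm gmx_rep gact_linform gmx_rep faith.
by exists h.
Qed.

Lemma dedekind_independence (s : seq gT) (c : gT -> S) :
    {in s &, forall g h, gact g =1 gact h -> g = h} -> uniq s ->
    (forall v, \sum_(g <- s) c g * gact g v = 0) ->
  forall g, g \in s -> c g = 0.
Proof.
elim: s c => // g0 s IH c inj /= /andP[g0s us] rel.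
have cs g : g \in s -> c g = 0.
  move=> gs; have [v0 v0P] : exists v0, gact g v0 != gact g0 v0.
    apply/not_existsP => H; move: g0s; rewrite -(inj g g0) ?gs // ?inE ?gs ?orbT ?eqxx //.
    by move=> v; apply/eqP; apply: contraT => /(H v).
  (* The relation at v0 v minus g0(v0) times the relation at v loses its g0 term, and the induction
     hypothesis applies to what remains. *)
  have : c g * (gact g v0 - gact g0 v0) = 0.
    apply: (IH (fun g => c g * (gact g v0 - gact g0 v0))) => // [g1 g2 h1 h2|v].
      by apply: inj; rewrite inE ?h1 ?h2 orbT.
    have e : \sum_(h <- g0 :: s) c h * (gact h v0 - gact g0 v0) * gact h v =
        \sum_(h <- g0 :: s) c h * gact h (v0 * v) -
        gact g0 v0 * \sum_(h <- g0 :: s) c h * gact h v.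
      rewrite mulr_sumr -sumrB; apply: eq_bigr => h _.
      by rewrite rmorphM mulrBr mulrBl [gact g0 v0 * _]mulrCA !mulrA.
    rewrite !rel mulr0 subrr big_cons subrr mulr0 mul0r add0r in e.
    exact: e.
  by move/eqP; rewrite mulf_eq0 subr_eq0 (negbTE v0P) orbF => /eqP.
move=> g; rewrite inE => /predU1P[->|/cs//].
have := rel 1; rewrite big_cons rmorph1 mulr1 big_seq big1 ?addr0 // => h /cs->.
by rewrite mul0r.
Qed.

(* One representative for each automorphism in the image of the group: summing
   over the whole group could give zero in positive characteristic. *)
Definition act_rep (g : gT) : gT := odflt g [pick h | gmx h == gmx g].

Lemma act_repE g : gmx (act_rep g) = gmx g.
Proof. by rewrite /act_rep; case: pickP => [h /eqP|]. Qed.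

Lemma act_rep_eq g h : gmx g = gmx h -> act_rep g = act_rep h.
Proof.
move=> e; rewrite /act_rep (eq_pick (Q := fun l => gmx l == gmx h)) => [|l]; last by rewrite e.
by case: pickP => // /(_ h); rewrite eqxx.
Qed.

Definition act_reps : {set gT} := [set g | act_rep g == g].

Lemma act_rep_in g : act_rep g \in act_reps.
Proof. by rewrite inE; apply/eqP/act_rep_eq/act_repE. Qed.

Lemma act_reps_inj : {in act_reps &, injective gmx}.
Proof.
by move=> g h; rewrite !inE => /eqP <- /eqP <-; rewrite !act_repE => /act_rep_eq.
Qed.

Definition rtrace (p : S) : S := \sum_(g in act_reps) gact g p.

Lemma rtraceD p q : rtrace (p + q) = rtrace p + rtrace q.
Proof. by rewrite /rtrace -big_split; apply: eq_bigr => g _; rewrite rmorphD. Qed.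

(** Acting by h after the sum is right multiplication by h, which permutes the automorphisms in the
    image of G; t is that permutation on representatives. *)
Lemma rtrace_invariant p : rtrace p \in Defs.invariant rho.
Proof.
apply/invariantP => h; rewrite -gactE /rtrace rmorph_sum.
pose t g := act_rep (g * h)%g.
have tI : {in act_reps &, injective t}.
  move=> g1 g2 g1s g2s e; apply: act_reps_inj => //.
  have : gmx (t g1) = gmx (t g2) by rewrite e.
  rewrite !act_repE !gmx_rep.2 => /(congr1 (mulmx^~ (gmx h^-1))).
  by rewrite -!mulmxA -!gmx_rep.2 mulgV !mulg1.
have tS : t @: act_reps = act_reps.
  apply/eqP; rewrite eqEcard card_in_imset // leqnn andbT.
  by apply/subsetP => _ /imsetP[g _ ->]; apply: act_rep_in.
rewrite -[in RHS]tS big_imset //=; apply: eq_bigr => g _.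
by rewrite -gactM; apply/esym/gact_gmx/act_repE.
Qed.

Lemma rtraceM p q : p \in Defs.invariant rho -> rtrace (p * q) = p * rtrace q.
Proof.
move=> /invariantP pI; rewrite /rtrace mulr_sumr; apply: eq_bigr => g _.
by rewrite rmorphM gactE pI.
Qed.

Lemma rtrace_gact h p : rtrace (gact h p) = rtrace p.
Proof.
rewrite /rtrace; pose t g := act_rep (h * g)%g.
have tI : {in act_reps &, injective t}.
  move=> g1 g2 g1s g2s e; apply: act_reps_inj => //.
  have : gmx (t g1) = gmx (t g2) by rewrite e.
  rewrite !act_repE !gmx_rep.2 => /(congr1 (mulmx (gmx h^-1))).
  by rewrite !mulmxA -!gmx_rep.2 mulVg !mul1g.
have tS : t @: act_reps = act_reps.
  apply/eqP; rewrite eqEcard card_in_imset // leqnn andbT.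
  by apply/subsetP => _ /imsetP[g _ ->]; apply: act_rep_in.
rewrite -[in RHS]tS big_imset //=; apply: eq_bigr => g _.
by rewrite -gactM; apply/esym/gact_gmx/act_repE.
Qed.

Lemma rtrace_neq0 : exists p, rtrace p != 0.
Proof.
apply/not_existsP => H.
suff : (1 : S) = 0 by move/eqP; rewrite oner_eq0.
apply: (@dedekind_independence (enum act_reps) (fun=> 1) _ (enum_uniq _) _ (act_rep 1%g)).
- move=> g h; rewrite !mem_enum => gs hs gh; apply: act_reps_inj => //.
  by apply/matrixP => i j; rewrite !mxE gh.
- move=> v; rewrite big_enum /=; under eq_bigr do rewrite mul1r.
  by apply/eqP; apply: contraT => /(H v).
by rewrite mem_enum act_rep_in.
Qed.

Lemma rtrace_homog d p : p \is d.-homog -> rtrace p \is d.-homog.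
Proof. by move=> hp; apply: rpred_sum => g _; apply: gact_homog. Qed.
End LinearAction.
#[global] Opaque gact.

(** The determinant trick: r is a root of the characteristic polynomial of its multiplication
    matrix, because the determinant at r kills every generator and hence 1. *)
Lemma integral_of_finite (P A : comNzRingType) (iota : {rmorphism P -> A}) m (b : 'I_m -> A) :
    (forall r, exists c : 'I_m -> P, r = \sum_j iota (c j) * b j) ->
  forall r, integralOver iota r.
Proof.
move=> span r.
have [c hc] := choice (fun i => span (r * b i)).
pose C : 'M[P]_m := \matrix_(i, j) c i j.
exists (char_poly C); first exact: char_poly_monic.
apply/rootP.
have -> : (map_poly iota (char_poly C)).[r] = \det (r%:M - map_mx iota C).
  rewrite map_char_poly /char_poly -[LHS]/(horner_eval r _) -det_map_mx.
  congr (\det _); apply/matrixP => i j; rewrite !mxE /= /horner_eval.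
  by rewrite hornerD hornerN hornerC hornerMn hornerX.
set N := r%:M - _.
have Nb i : \sum_j N i j * b j = 0.
  have NE j : N i j = r *+ (i == j) - iota (c i j) by rewrite !mxE.
  under eq_bigr do rewrite NE mulrBl.
  rewrite sumrB (bigD1 i) //= eqxx mulr1n big1 ?addr0 => [|j /negbTE ji].
    by rewrite hc subrr.
  by rewrite eq_sym ji mulr0n mul0r.
have detb j : \det N * b j = 0.
  have [e ->] := cramer_ideal N b j.
  by rewrite big1 // => i _; rewrite Nb mulr0.
have [e e1] := span 1.
rewrite -[\det N]mulr1 e1 mulr_sumr big1 // => j _.
by rewrite mulrCA detb mulr0.
Qed.

(** * Parameters of the invariant ring inside S *)

Section InvariantParameters.
Variables (k : fieldType) (n : nat) (gT : finGroupType) (rho : galg_action k n gT).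
Local Notation S := {mpoly k[n]}.
Local Notation R := (invariant_ring rho).
Variable f : hsop R.
Local Notation d := (hsop_dim f).
Local Notation P0 := {mpoly k[d]}.

Definition inv_val : {rmorphism R -> S} :=
  [the {rmorphism (invariant_type rho) -> S} of val].

Lemma inv_valP (r : R) : inv_val r \in Defs.invariant rho.
Proof. exact: (valP (r : invariant_type rho)). Qed.

Lemma inv_val_inj : injective inv_val.
Proof. exact: val_inj. Qed.

Definition inv_sub (p : S) (pI : p \in Defs.invariant rho) : R := (Sub p pI : invariant_type rho).

Lemma inv_subK p pI : inv_val (@inv_sub p pI) = p.
Proof. exact: SubK. Qed.

Lemma inv_comp d' (r : R) : gdom_comp d' r <-> inv_val r \is d'.-homog.
Proof. by []. Qed.

Lemma inv_scal c : inv_val (gdom_scal R c) = c%:MP.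
Proof. exact: SubK. Qed.

#[local] Opaque inv_val.

Definition param i : S := inv_val (hsop_elt (h := f) i).

Lemma hsub_inv (p : P0) : hsub param p = inv_val (hsop_map f p).
Proof.
pose g : {rmorphism P0 -> S} := inv_val \o hsop_map f.
apply: (@mpoly_rmorph_ext _ _ _ (hsub param) g) => [c|i] /=.
  by rewrite hsubC hsop_mapC inv_scal.
by rewrite hsubX hsop_mapX.
Qed.

Lemma param_homog i : ihomog (hsop_deg (h := f) i)%:Z (param i).
Proof. by apply/ihomog_nat; have /inv_comp := @hsop_homog _ _ f i. Qed.

Lemma param_indep (p : P0) : hsub param p = 0 -> p = 0.
Proof.
rewrite hsub_inv => e; apply: (@hsop_map_inj _ _ f); apply: inv_val_inj.
by rewrite e rmorph0.
Qed.

Lemma inv_integral (r : R) : integralOver (hsub param) (inv_val r).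
Proof.
have [m [b span]] := hsop_finite f.
have [W Wm W0] := @integral_of_finite P0 R (hsop_map f) m b span r.
exists W => //; have /rootP := W0 => /(congr1 inv_val); rewrite rmorph0 => e.
apply/rootP; rewrite -[RHS]e -horner_map -map_poly_comp; congr (_.[_]).
by apply: eq_map_poly => p /=; rewrite hsub_inv.
Qed.

(** X_j is a root of the product of the T - g(X_j), whose coefficients are invariant and hence
    integral over P; integrality is transitive. *)
Lemma param_integral (j : 'I_n) : integralOver (hsub param) 'X_j.
Proof.
pose p : {poly S} := \prod_g ('X - (gact rho g 'X_j)%:P).
apply: (@integral_root_monic _ _ (hsub param) _ p).
- exact: monic_prod_XsubC.
- by rewrite /p (bigD1 1%g) //= rootM root_XsubC gact1 eqxx.
apply/integral_poly => i.
suff pI : p`_i \in Defs.invariant rho by rewrite -(inv_subK pI); apply: inv_integral.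
apply/invariantP => h; rewrite -gactE -coef_map.
have -> // : map_poly (gact rho h) p = p.
rewrite /p rmorph_prod /= [RHS](reindex_inj (mulIg h)).
by apply: eq_bigr => g _; rewrite map_polyXsubC -gactM.
Qed.
End InvariantParameters.

#[global] Opaque inv_val.
Arguments param {k n gT rho} f i.

(** * Embedding the canonical module in the invariant ring *)

Section CanonicalEmbedding.
Variables (k : fieldType) (n : nat) (gT : finGroupType) (rho : galg_action k n gT).
Local Notation S := {mpoly k[n]}.
Local Notation B := {mpoly S[n]}.
Local Notation R := (invariant_ring rho).
Variable f : hsop R.
Local Notation d := (hsop_dim f).
Local Notation P0 := {mpoly k[d]}.
Local Notation w := (canonical_module f).
Local Notation iota := (hsub (param f)).
Implicit Types (phi psi : gdual_type (top_local_cohomology f)).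

Definition inv_trace (s : S) : R := inv_sub (rtrace_invariant rho s).

Lemma inv_traceD s t : inv_trace (s + t) = inv_trace s + inv_trace t.
Proof. by apply: inv_val_inj; rewrite rmorphD !inv_subK rtraceD. Qed.

Lemma inv_traceM (r : R) s : inv_trace (inv_val rho r * s) = r * inv_trace s.
Proof. by apply: inv_val_inj; rewrite rmorphM !inv_subK rtraceM ?inv_valP. Qed.

Lemma inv_trace_gact g s : inv_trace (gact rho g s) = inv_trace s.
Proof. by apply: inv_val_inj; rewrite !inv_subK rtrace_gact. Qed.

Definition trace_dual phi (s : S) : P0 := dual_poly phi (inv_trace s).

Lemma trace_dual_linear phi : param_linear (param f) (trace_dual phi).
Proof.
split=> [u v|p v]; rewrite /trace_dual; first by rewrite inv_traceD dual_polyD.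
by rewrite hsub_inv inv_traceM dual_poly_param.
Qed.

(** The trace may fail to be surjective. Instead some Tr v is nonzero and t' Tr v = p lies in P, so
    the functional at t' r v is p times the generating function at r. *)
Lemma trace_dual_eq0 phi : (forall s, trace_dual phi s = 0) -> phi = 0.
Proof.
move=> phi0; have [v v0] := rtrace_neq0 rho.
have t0 : inv_trace v != 0.
  by apply: contra v0 => /eqP e; rewrite -(inv_subK (rtrace_invariant rho v)) -/(inv_trace v) e rmorph0.
have [m [b span]] := hsop_finite f.
have [t' [p [p0 ep]]] :=
  integral_norm (@integral_of_finite P0 R (hsop_map f) m b span (inv_trace v)) t0.
apply: dual_poly_inj => r; have := phi0 (inv_val rho (t' * r) * v).
rewrite /trace_dual inv_traceM mulrC mulrA ep dual_poly_param => /eqP.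
by rewrite mulf_eq0 (negbTE p0) => /eqP.
Qed.

Lemma hsub_param_gact g p : gact rho g (iota p) = iota p.
Proof. by rewrite hsub_inv gactE; apply/invariantP/inv_valP. Qed.

Lemma trace_dual_degree (i D : int) phi a : gdual_comp i phi -> ihomog D a ->
  ihomog (D + i - (\sum_l hsop_deg (h := f) l)%N%:Z) (iota (trace_dual phi a)).
Proof.
case: D => [e|e] hphi ha; last first.
  rewrite (ihomog_neg ha) /trace_dual.
  have -> : inv_trace 0 = 0 by have := inv_traceM 0 0; rewrite mulr0 mul0r.
  have -> : dual_poly phi 0 = 0.
    by have := dual_poly_param phi 0 0; rewrite mulr0 mul0r.
  by rewrite rmorph0; apply: ihomog0.
have ce : gdom_comp e (inv_trace a).
  by apply/inv_comp; rewrite inv_subK; apply/rtrace_homog/ihomog_nat.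
pose T := (\sum_l hsop_deg (h := f) l)%N; rewrite -/T.
rewrite [X in iota X]mpolyE (rmorph_sum iota) big_seq; apply: ihomog_sum => m.
rewrite mcoeff_msupp => /(dual_poly_degree hphi ce); rewrite -/T => <-.
rewrite -mul_mpolyC rmorphM hsubC mul_mpolyC; apply: ihomogZ.
rewrite mpolyXE_id rmorph_prod.
apply: (big_ind2 (fun q (e : nat) => ihomog e%:Z q)) => [||l _].
- exact: (@ihomogC n k 1).
- by move=> *; rewrite PoszD; apply: ihomogM.
rewrite rmorphXn hsubX; elim: (m l) => [|t IH]; first exact: (@ihomogC n k 1).
by rewrite exprS mulSn PoszD; apply: ihomogM; [apply: param_homog | apply: IH].
Qed.

(** The diagonal action on x and Y, to which the uniqueness of Delta is applied. *)
Definition diag_act g : {rmorphism B -> B} :=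
  mmap (@mpolyC n S \o gact rho g) (fun j => in_Y n k (gact rho g 'X_j)).

Lemma diag_actC g a : diag_act g a%:MP = (gact rho g a)%:MP.
Proof. by rewrite /diag_act /= mmapC. Qed.

Lemma diag_actX g j : diag_act g 'X_j = in_Y n k (gact rho g 'X_j).
Proof. by rewrite /diag_act /= mmapX mmap1U. Qed.

#[local] Opaque diag_act.

Lemma diag_act_in_Y g p : diag_act g (in_Y n k p) = in_Y n k (gact rho g p).
Proof.
pose g1 : {rmorphism S -> B} := diag_act g \o in_Y n k.
pose g2 : {rmorphism S -> B} := in_Y n k \o gact rho g.
apply: (@mpoly_rmorph_ext _ _ _ g1 g2) => [c|i] /=.
  by rewrite in_YC diag_actC !gactC in_YC.
by rewrite in_YX diag_actX.
Qed.

Lemma diag_act_fdiff g i : diag_act g (fdiff (param f) i) = fdiff (param f) i.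
Proof.
rewrite /fdiff rmorphB diag_act_in_Y diag_actC.
by have := hsub_param_gact g 'X_i; rewrite hsubX => ->.
Qed.

Lemma diag_act_zdiff g j :
  diag_act g (zdiff k j) = \sum_l ((gmx rho g j l)%:MP)%:MP * zdiff k l.
Proof.
rewrite /zdiff rmorphB diag_actX diag_actC gactX.
rewrite (rmorph_sum (in_Y n k)) (raddf_sum (@mpolyC n S)) -sumrB.
apply: eq_bigr => l _ /=.
by rewrite -!mul_mpolyC in_YM in_YC in_YX mpolyCM mulrBr.
Qed.

(** The functional is invariant because the trace is, so the action on the x-coefficients disappears
    and only the action on Y remains. *)
Lemma contract_diag_act phi g p :
  contract (param f) (trace_dual phi) (diag_act g p) =
  gact rho g (contract (param f) (trace_dual phi) p).
Proof.
have lin := trace_dual_linear phi.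
rewrite (mpolyE p) rmorph_sum !(contract_sum lin) rmorph_sum; apply: eq_bigr => m _.
have eX : 'X_[m] = in_Y n k 'X_[m] :> B.
  rewrite mpolyXE_id [X in in_Y n k X]mpolyXE_id (rmorph_prod (in_Y n k)).
  by apply: eq_bigr => i _; rewrite (rmorphXn (in_Y n k)) in_YX.
rewrite (contract_mon lin) rmorphM hsub_param_gact.
rewrite -mul_mpolyC rmorphM diag_actC eX diag_act_in_Y mulrC.
rewrite (contract_in_Y lin) mulrC; congr (_ * _).
rewrite -[X in contract _ _ X]mulr1 mul_mpolyC -mpolyX0 (contract_mon lin).
by rewrite mpolyX0 mulr1 /trace_dual inv_trace_gact.
Qed.

Variables (Del : B) (h : S).
Hypothesis Del_tot : tot (\sum_i (hsop_deg (h := f) i)%:Z - n%:Z) Del.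
Hypothesis Del_slide :
  forall p, in_ideal (fdiff (param f)) ((in_Y n k p - p%:MP) * Del).
Hypothesis Del_nondeg : forall s, in_ideal (fdiff (param f)) (s%:MP * Del) -> s = 0.
Hypothesis Del_act : forall (g : {rmorphism B -> B}) (N : 'M[k]_n),
  (forall i, g (fdiff (param f) i) = fdiff (param f) i) ->
  (forall j, g (zdiff k j) = \sum_l ((N j l)%:MP)%:MP * zdiff k l) ->
  in_ideal (fdiff (param f)) (Del - ((\det N)%:MP)%:MP * g Del).
Hypothesis h_neq0 : h != 0.
Hypothesis h_homog : h \is n.-homog.
Hypothesis h_act : forall g, gact rho g h = (\det (gmx rho g))%:MP * h.

(** The coefficient of the n-form q dx_1 ... dx_n attached to phi. *)
Definition quasi phi : S := contract (param f) (trace_dual phi) Del.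

Lemma quasiD phi psi : quasi (phi + psi) = quasi phi + quasi psi.
Proof.
rewrite /quasi /contract /mext -big_split; apply: eq_bigr => m _.
by rewrite /trace_dual dual_poly_addl rmorphD mulrDl.
Qed.

Lemma quasiZ r phi : quasi (r *: phi) = inv_val rho r * quasi phi.
Proof.
rewrite -(contract_bezoutianZ Del_slide (trace_dual_linear phi)).
rewrite /quasi /contract /mext; apply: eq_bigr => m _.
by rewrite /trace_dual dual_poly_scalel inv_traceM.
Qed.

Lemma quasi_eq0 phi : quasi phi = 0 -> phi = 0.
Proof.
move=> q0; apply: trace_dual_eq0.
exact: (contract_nondegenerate (param_integral f) (@param_indep _ _ _ _ f) Del_slide Del_nondeg
  (trace_dual_linear phi) q0).
Qed.

Lemma quasi_act g phi : quasi phi = (\det (gmx rho g))%:MP * gact rho g (quasi phi).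
Proof.
have lin := trace_dual_linear phi.
have := contract_ideal lin (Del_act (diag_act_fdiff g) (diag_act_zdiff g)).
rewrite (contractB lin) => /eqP; rewrite subr_eq0 => /eqP e.
rewrite {1}/quasi e -{1}(hsubC (param f)) (contract_param lin) hsubC.
by rewrite contract_diag_act.
Qed.

Lemma quasi_degree (i : int) phi : gdual_comp i phi -> ihomog (i - n%:Z) (quasi phi).
Proof.
move=> hphi; apply: ihomog_sum => m _.
(* The summands are the degree of the coefficient of Y^m in Delta, the shift by the functional, and
   the degree of Y^m. *)
have -> : i - n%:Z = \sum_i (hsop_deg (h := f) i)%:Z - n%:Z - (mdeg m)%:Z + i
    - (\sum_l hsop_deg (h := f) l)%N%:Z + (mdeg m)%:Z.
  rewrite (big_morph Posz PoszD (erefl _)).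
  set s := \sum_i _; set a := (mdeg m)%:Z.
  by rewrite addrAC -[_ - a + i]addrA [- a + i]addrC addrA subrK -addrA [i - s]addrC addrCA
    -addrA addrCA addrA subrr add0r addrC.
apply: ihomogM; first exact/trace_dual_degree/Del_tot.
by move=> l; rewrite mcoeffX; have [->|_] := eqVneq m l; rewrite ?eqxx.
Qed.

Lemma twist_invariant phi : h * quasi phi \in Defs.invariant rho.
Proof.
apply/invariantP => g; rewrite -gactE rmorphM h_act [in RHS](quasi_act g phi).
by rewrite -mulrA mulrCA.
Qed.

Definition twist phi : gregular R := inv_sub (twist_invariant phi).

Lemma twistE phi : inv_val rho (twist phi) = h * quasi phi.
Proof. exact: inv_subK. Qed.

Lemma twist_linear : linear (twist : w -> gregular R).
Proof.
move=> r phi psi; apply: (@inv_val_inj _ _ _ rho).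
rewrite twistE quasiD quasiZ -[r *: twist phi]/(r * twist phi).
by rewrite rmorphD rmorphM !twistE mulrDr mulrCA.
Qed.

Lemma twist_inj : injective twist.
Proof.
move=> phi psi e; apply/eqP; rewrite -subr_eq0; apply/eqP/quasi_eq0.
have : h * quasi (phi - psi) = 0.
  have -> : phi - psi = phi + (-1 : R) *: psi by rewrite scaleN1r.
  by rewrite quasiD quasiZ rmorphN rmorph1 mulN1r mulrBr -!twistE e subrr.
by move/eqP; rewrite mulf_eq0 (negbTE h_neq0) => /eqP.
Qed.

Lemma twist_degree (i : int) phi : gdual_comp i phi -> gdom_zcomp i (twist phi).
Proof.
move=> hphi.
have : ihomog i (inv_val rho (twist phi)).
  rewrite twistE -(subrK n%:Z i) addrC; apply: ihomogM (quasi_degree hphi).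
  exact/ihomog_nat.
case: i hphi => [e|e] hphi /=; first by move/ihomog_nat/inv_comp.
by move/ihomog_neg => e0; apply: (@inv_val_inj _ _ _ rho); rewrite e0 rmorph0.
Qed.
End CanonicalEmbedding.

Theorem theorem2p9 (k : fieldType) (n : nat) (gT : finGroupType)
    (rho : galg_action k n gT) (abelian_G : abelian [set: gT])
    (f : hsop (invariant_ring rho)) :
  (exists I : gideal (invariant_ring rho),
     giso (canonical_module f) (gsub_gmodule I)) /\
  (exists b : int, is_b_invariant f b /\ b <= 0).
Proof.
have [Del [Dtot Dslide Dnondeg Dact]] :=
  bezoutian_exists (@param_homog _ _ _ _ f) (param_integral f) (@param_indep _ _ _ _ f).
have [h [h0 hh hact]] := semi_invariant_det rho abelian_G.
pose psi := @twist _ _ _ rho f Del h Dact hact.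
have psi_lin : linear (psi : canonical_module f -> gregular (invariant_ring rho)).
  exact: twist_linear Dslide _ _.
pose psiZ := GRing.isLinear.Build _ _ _ _ _ psi_lin.
pose psiL : {linear canonical_module f -> gregular (invariant_ring rho)} := HB.pack psi psiZ.
have psi_inj : injective psiL by apply: twist_inj.
have psi_deg i x : gmod_comp (canonical_module f) i x ->
    gmod_comp (gregular (invariant_ring rho)) i (psiL x).
  by apply: twist_degree.
split; last exact: b_invariant_exists psi_inj psi_deg.
by exists (emb_ideal psi_deg); apply: emb_giso.
Qed.
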